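(* Let $\alpha,\beta,\theta\in\mathbb{R}$ satisfy $0<\theta<1$, $-1<\alpha<1$, $\alpha\ne0$, $\beta>-1$ and $\dfrac{\sin((\alpha+\theta)\pi)}{\sin(\theta\pi)}>0$. Let $\mathcal{H}$ be the Hilbert space of (classes of) measurable functions on $[0,\infty)$ with the inner product $$\langle f,g\rangle=\int_0^1 f(x)\overline{g(x)}(1-x)^\alpha x^\beta\,dx+\frac{\sin((\alpha+\theta)\pi)}{\sin(\theta\pi)}\int_1^\infty f(x)\overline{g(x)}(x-1)^\alpha x^\beta\,dx ,$$ and let $D=x(1-x)\frac{d^2}{dx^2}+\bigl(\beta+1-(\alpha+\beta+2)x\bigr)\frac{d}{dx}$. Then the operator $D$ with domain the subspace $\mathcal{E}\subset\mathcal{H}$ defined in the context is essentially self-adjoint in $\mathcal{H}$.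
   Context: The operator $D$ is applied on $(0,1)\cup(1,\infty)$. Space $\mathcal{E}$: the space of complex-valued functions $f$ on $[0,\infty)$ (values at $x=1$ being irrelevant) that are $C^\infty$ on $(0,1)\cup(1,\infty)$ and satisfy: (i) at $0$: $f$ is smooth at $0$ (i.e. $C^\infty$ up to $0$ from the right); (ii) at $1$: there are functions $u,v$, $C^\infty$ in a neighbourhood of $1$, such that for $x$ near $1$ $$f(x)=u(x)+v(x)(1-x)^{-\alpha}\ \ (x<1),\qquad f(x)=\frac{\sin(\theta\pi)}{\sin((\alpha+\theta)\pi)}\,u(x)+v(x)(x-1)^{-\alpha}\ \ (x>1);$$ (iii) at $\infty$: there is a function $w$, smooth at $0$, such that $f(x)=w(1/x)\,x^{-\alpha-\beta-r-1}$ for all large $x$, where $r$ is the minimal element of $\{p\in\theta+\mathbb{Z}: 2p+\alpha+\beta+1>0\}$. *)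

(* Defs.v *)
From HB Require Import structures.
From mathcomp Require Import all_boot all_order all_algebra.
From mathcomp Require Import generic_quotient ring_quotient.
From mathcomp Require Import all_classical all_reals all_analysis.
From mathcomp Require Import measurable_realfun ring complex.

Set Implicit Arguments.
Unset Strict Implicit.
Unset Printing Implicit Defensive.

Import Order.TTheory GRing.Theory Num.Theory.
Import numFieldNormedType.Exports.

Local Open Scope classical_set_scope.
Local Open Scope ring_scope.
Local Open Scope complex_scope.
Local Open Scope quotient_scope.

(* Unbounded operators on a complex inner product space [(V, ip)], where [ip]
   is linear in its first argument.  An operator is given by its graph, a
   subset of [V * V]. *)
Section UnboundedOperators.
Variables (R : realType) (V : lmodType R[i]) (ip : V -> V -> R[i]).
Implicit Types (T : set (V * V)) (x y z : V).

Definition hnorm x : R := Num.sqrt (complex.Re (ip x x)).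

Definition op_domain T : set V := [set x | exists y, T (x, y)].

Definition linear_operator T : Prop :=
  [/\ T (0, 0),
      forall (a : R[i]) x y x' y',
        T (x, y) -> T (x', y') -> T (a *: x + x', a *: y + y')
    & forall x y y', T (x, y) -> T (x, y') -> y = y'].

Definition densely_defined T : Prop :=
  forall y (e : R), 0 < e -> exists2 x, op_domain T x & hnorm (y - x) < e.

Definition adjoint T : set (V * V) :=
  [set p | forall x y, T (x, y) -> ip y p.1 = ip x p.2].

(* The closure of the graph in the norm topology of [V * V]. *)
Definition op_closure T : set (V * V) :=
  [set p | forall e : R, 0 < e ->
    exists x y, [/\ T (x, y), hnorm (p.1 - x) < e & hnorm (p.2 - y) < e]].

Definition symmetric_operator T : Prop :=
  [/\ linear_operator T, densely_defined T & T `<=` adjoint T].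

Definition self_adjoint T : Prop :=
  [/\ linear_operator T, densely_defined T & adjoint T = T].

Definition essentially_self_adjoint T : Prop :=
  symmetric_operator T /\ self_adjoint (op_closure T).

End UnboundedOperators.

Section WeightedL2.
Variables (R : realType) (alpha beta : R).
Local Notation mu := (@lebesgue_measure R).

Definition weight01 (x : R) : R := (1 - x) `^ alpha * x `^ beta.
Definition weight1oo (x : R) : R := (x - 1) `^ alpha * x `^ beta.

(* Functions on [0, oo) are represented by functions on the whole line, whose
   values at negative arguments are irrelevant. *)
Definition square_integrable (f : R -> R[i]) : Prop :=
  [/\ measurable_fun `[0:R, +oo[ (fun x => complex.Re (f x)),
      measurable_fun `[0:R, +oo[ (fun x => complex.Im (f x)),
      (\int[mu]_(x in `[0%R, 1%R])
         (Normc.normc (f x) ^+ 2 * weight01 x)%:E < +oo)%E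
    & (\int[mu]_(x in `[1%R, +oo[)
         (Normc.normc (f x) ^+ 2 * weight1oo x)%:E < +oo)%E].

Definition L2_pred : {pred R -> R[i]} := fun f => `[< square_integrable f >].

Record L2fun := MkL2fun { L2val :> R -> R[i] ; _ : L2val \in L2_pred }.

HB.instance Definition _ := [isSub for L2val].
HB.instance Definition _ := [Choice of L2fun by <:].

Lemma sqr_normcE (z : R[i]) :
  Normc.normc z ^+ 2 = complex.Re z ^+ 2 + complex.Im z ^+ 2.
Proof. by case: z => a b /=; rewrite sqr_sqrtr// addr_ge0// sqr_ge0. Qed.

Lemma measurable_weight01 (D : set R) : measurable_fun D weight01.
Proof.
apply: (measurable_funS measurableT) => //.
apply: measurable_funM; last exact: measurable_powR.
apply: (measurableT_comp (measurable_powR _)) => //.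
exact: measurable_funB.
Qed.

Lemma measurable_weight1oo (D : set R) : measurable_fun D weight1oo.
Proof.
apply: (measurable_funS measurableT) => //.
apply: measurable_funM; last exact: measurable_powR.
apply: (measurableT_comp (measurable_powR _)) => //.
exact: measurable_funB.
Qed.

Lemma weight01_ge0 x : 0 <= weight01 x.
Proof. by rewrite mulr_ge0// powR_ge0. Qed.

Lemma weight1oo_ge0 x : 0 <= weight1oo x.
Proof. by rewrite mulr_ge0// powR_ge0. Qed.

Lemma sub_01_half : `[0%R, 1%R] `<=` (`[0%R, +oo[ : set R).
Proof. by move=> x /=; rewrite !in_itv/= => /andP[->]. Qed.

Lemma sub_1oo_half : `[1%R, +oo[ `<=` (`[0%R, +oo[ : set R).
Proof. by move=> x /=; rewrite !in_itv/= !andbT; apply: le_trans. Qed.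

Lemma measurable_weighted_sqr (D : set R) (f : R -> R[i]) (k : R -> R) :
  measurable_fun D (fun x => complex.Re (f x)) ->
  measurable_fun D (fun x => complex.Im (f x)) ->
  measurable_fun D k ->
  measurable_fun D (fun x => (Normc.normc (f x) ^+ 2 * k x)%:E).
Proof.
move=> mR mI mk; apply/measurable_EFinP/measurable_funM => //.
rewrite (_ : (fun x => _) =
  (fun x => complex.Re (f x) ^+ 2 + complex.Im (f x) ^+ 2)); last first.
  by apply/funext => x; rewrite sqr_normcE.
by apply: measurable_funD; exact: measurable_funX.
Qed.

Lemma weighted_sqr_lin_fin (D : set R) (k : R -> R) (a : R[i]) (f g : R -> R[i]) :
  measurable D -> measurable_fun D k -> (forall x, 0 <= k x) ->
  measurable_fun D (fun x => complex.Re (f x)) ->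
  measurable_fun D (fun x => complex.Im (f x)) ->
  measurable_fun D (fun x => complex.Re (g x)) ->
  measurable_fun D (fun x => complex.Im (g x)) ->
  measurable_fun D (fun x => complex.Re (a * f x + g x)) ->
  measurable_fun D (fun x => complex.Im (a * f x + g x)) ->
  (\int[mu]_(x in D) (Normc.normc (f x) ^+ 2 * k x)%:E < +oo)%E ->
  (\int[mu]_(x in D) (Normc.normc (g x) ^+ 2 * k x)%:E < +oo)%E ->
  (\int[mu]_(x in D) (Normc.normc (a * f x + g x) ^+ 2 * k x)%:E < +oo)%E.
Proof.
move=> mD mk k0 fR fI gR gI hR hI ff gf.
have mf := measurable_weighted_sqr fR fI mk.
have mg := measurable_weighted_sqr gR gI mk.
have mh := measurable_weighted_sqr hR hI mk.
have p0 (h : R -> R[i]) x : D x -> (0 <= (Normc.normc (h x) ^+ 2 * k x)%:E)%E.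
  by move=> _; rewrite lee_fin mulr_ge0// sqr_ge0.
pose A := 2 * Normc.normc a ^+ 2.
have A0 : 0 <= A by rewrite mulr_ge0// sqr_ge0.
have B0 : (0 : R) <= 2 by [].
have mAf : measurable_fun D
    (fun x => (A%:E * (Normc.normc (f x) ^+ 2 * k x)%:E)%E).
  exact: measurable_funeM.
have mBg : measurable_fun D
    (fun x => (2%:E * (Normc.normc (g x) ^+ 2 * k x)%:E)%E).
  exact: measurable_funeM.
have Af0 x : D x -> (0 <= A%:E * (Normc.normc (f x) ^+ 2 * k x)%:E)%E.
  by move=> Dx; rewrite mule_ge0//; exact: p0.
have Bg0 x : D x -> (0 <= 2%:E * (Normc.normc (g x) ^+ 2 * k x)%:E)%E.
  by move=> Dx; rewrite mule_ge0//; exact: p0.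
apply: (@le_lt_trans _ _ (\int[mu]_(x in D)
   (A%:E * (Normc.normc (f x) ^+ 2 * k x)%:E
    + 2%:E * (Normc.normc (g x) ^+ 2 * k x)%:E))%E).
  apply: ge0_le_integral => //; first exact: (p0 (fun x => a * f x + g x)).
    exact: emeasurable_funD.
  move=> x _; rewrite -!EFinM -EFinD lee_fin (mulrA A) (mulrA 2) -mulrDl ler_wpM2r//.
  rewrite !sqr_normcE /A sqr_normcE.
  case: (a) (f x) (g x) => [a1 a2] [f1 f2] [g1 g2] /=.
  rewrite -subr_ge0.
  set S := (X in 0 <= X).
  have -> : S = (a1 * f1 - a2 * f2 - g1) ^+ 2 + (a1 * f2 + a2 * f1 - g2) ^+ 2.
    by rewrite /S; ring.
  by rewrite addr_ge0// sqr_ge0.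
rewrite ge0_integralD// !ge0_integralZl_EFin//; try exact: p0.
by rewrite lte_add_pinfty// lte_mul_pinfty// integral_ge0//; exact: p0.
Qed.

Lemma L2_submod_closed : submod_closed L2_pred.
Proof.
split.
  apply/asboolP; split; rewrite /=; do ?[exact: measurable_cst].
    by rewrite integral0_eq// => x _; rewrite expr0n/= addr0 sqrtr0 expr0n/= mul0r.
  by rewrite integral0_eq// => x _; rewrite expr0n/= addr0 sqrtr0 expr0n/= mul0r.
move=> a f g /asboolP[fR fI f1 f2] /asboolP[gR gI g1 g2]; apply/asboolP.
change (square_integrable (fun x => a * f x + g x)).
have hR : measurable_fun `[0:R, +oo[ (fun x => complex.Re (a * f x + g x)).
  rewrite (_ : (fun x => _) = (fun x => complex.Re a * complex.Re (f x)
      - complex.Im a * complex.Im (f x) + complex.Re (g x))).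
    apply: measurable_funD => //; apply: measurable_funB => //.
      exact: measurable_funM.
    exact: measurable_funM.
  by apply/funext => x; case: (a) (f x) (g x) => [? ?] [? ?] [? ?].
have hI : measurable_fun `[0:R, +oo[ (fun x => complex.Im (a * f x + g x)).
  rewrite (_ : (fun x => _) = (fun x => complex.Re a * complex.Im (f x)
      + complex.Im a * complex.Re (f x) + complex.Im (g x))).
    apply: measurable_funD => //; apply: measurable_funD => //.
      exact: measurable_funM.
    exact: measurable_funM.
  by apply/funext => x; case: (a) (f x) (g x) => [? ?] [? ?] [? ?].
have m0 : measurable (`[0%R, +oo[ : set R) by exact: measurable_itv.
split; [exact: hR|exact: hI| |].
- have mono (h : R -> R) := @measurable_funS _ _ _ _ _ _ h m0 sub_01_half.
  exact: (@weighted_sqr_lin_fin _ _ a f g (measurable_itv _)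
    (@measurable_weight01 _) weight01_ge0 (mono _ fR) (mono _ fI)
    (mono _ gR) (mono _ gI) (mono _ hR) (mono _ hI) f1 g1).
- have mono (h : R -> R) := @measurable_funS _ _ _ _ _ _ h m0 sub_1oo_half.
  exact: (@weighted_sqr_lin_fin _ _ a f g (measurable_itv _)
    (@measurable_weight1oo _) weight1oo_ge0 (mono _ fR) (mono _ fI)
    (mono _ gR) (mono _ gI) (mono _ hR) (mono _ hI) f2 g2).
Qed.

HB.instance Definition _ :=
  GRing.isSubmodClosed.Build R[i] (R -> R[i]) L2_pred L2_submod_closed.
HB.instance Definition _ := [SubChoice_isSubLmodule of L2fun by <:].

Definition L2_null : {pred L2fun} :=
  fun f => `[< {ae mu, forall x, 0 <= x -> L2val f x = 0} >].

Lemma L2_null_submod_closed : submod_closed L2_null.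
Proof.
split.
  by apply/asboolP; exact: aeW.
move=> a f g /asboolP f0 /asboolP g0; apply/asboolP.
apply: (@filterS2 _ _ (ae_filter_ringOfSetsType mu) _ _ _ _ f0 g0) => x fx gx x0 /=.
by rewrite -[LHS]/(a * f x + g x) fx// gx// mulr0 addr0.
Qed.

HB.instance Definition _ :=
  GRing.isSubmodClosed.Build R[i] L2fun L2_null L2_null_submod_closed.

(* Classes of square-integrable functions modulo equality almost everywhere. *)
Definition L2 : Type := Quotient.quot L2_null.
HB.instance Definition _ := GRing.Zmodule.on L2.
HB.instance Definition _ := EqQuotient.on L2.

Lemma L2_eqP (f g : L2fun) :
  \pi_L2 f = \pi_L2 g <-> {ae mu, forall x, 0 <= x -> f x = g x}.
Proof.
have -> : (\pi_L2 f = \pi_L2 g) = (f - g \in L2_null).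
  apply/propext; rewrite -Quotient.equivE.
  by split => [/eqmodP|h]; last exact/eqmodP.
split=> [/asboolP|fg]; last apply/asboolP.
- move=> h0; apply: (@filterS _ _ (ae_filter_ringOfSetsType mu) _ _ _ h0).
  move=> x h x0; apply/eqP; rewrite -subr_eq0; apply/eqP.
  exact: h.
- apply: (@filterS _ _ (ae_filter_ringOfSetsType mu) _ _ _ fg) => x h x0.
  by rewrite -[LHS]/(f x - g x) h// subrr.
Qed.

Lemma pi_L2D (f g : L2fun) : \pi_L2 (f + g) = \pi_L2 f + \pi_L2 g.
Proof. exact: Quotient.pi_add. Qed.

Definition L2_scale (a : R[i]) (h : L2) : L2 := \pi_L2 (a *: repr h).

Lemma pi_L2_scale a (f : L2fun) : L2_scale a (\pi_L2 f) = \pi_L2 (a *: f).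
Proof.
apply/L2_eqP; have /L2_eqP : \pi_L2 (repr (\pi_L2 f)) = \pi_L2 f by rewrite reprK.
move=> h0; apply: (@filterS _ _ (ae_filter_ringOfSetsType mu) _ _ _ h0).
move=> x h x0.
by rewrite -[LHS]/(a * repr (\pi_L2 f) x) -[RHS]/(a * f x) h.
Qed.

Lemma L2_scaleA a b h : L2_scale a (L2_scale b h) = L2_scale (a * b) h.
Proof.
rewrite -[h]reprK; move: (repr h) => f.
by rewrite (pi_L2_scale b) pi_L2_scale pi_L2_scale scalerA.
Qed.

Lemma L2_scale1 : left_id 1 L2_scale.
Proof. by move=> h; rewrite -[h]reprK pi_L2_scale scale1r. Qed.

Lemma L2_scaleDr : right_distributive L2_scale +%R.
Proof.
move=> a h k; rewrite -[h]reprK -[k]reprK.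
move: (repr h) (repr k) => f g.
by rewrite -pi_L2D !pi_L2_scale -pi_L2D scalerDr.
Qed.

Lemma L2_scaleDl h : {morph L2_scale^~ h : a b / a + b}.
Proof.
move=> a b; rewrite -[h]reprK; move: (repr h) => f.
by rewrite !pi_L2_scale scalerDl pi_L2D.
Qed.

HB.instance Definition _ := GRing.Zmodule_isLmodule.Build R[i] L2
  L2_scaleA L2_scale1 L2_scaleDr L2_scaleDl.

Definition complex_integral (D : set R) (h : R -> R[i]) : R[i] :=
  (\int[mu]_(x in D) complex.Re (h x)) +i* (\int[mu]_(x in D) complex.Im (h x)).

Definition inner (theta : R) (f g : R -> R[i]) : R[i] :=
  complex_integral `[0%R, 1%R]
    (fun x => f x * (g x)^* * (weight01 x)%:C)
  + (sin ((alpha + theta) * pi) / sin (theta * pi))%:C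
    * complex_integral `[1%R, +oo[
        (fun x => f x * (g x)^* * (weight1oo x)%:C).

Definition L2_inner (theta : R) (h k : L2) : R[i] := inner theta (repr h) (repr k).

Lemma complex_integral_ae (D : set R) (k : R -> R) (f1 f2 g1 g2 : L2fun) :
  measurable D -> D `<=` `[0%R, +oo[ -> measurable_fun D k ->
  \pi_L2 f1 = \pi_L2 f2 -> \pi_L2 g1 = \pi_L2 g2 ->
  complex_integral D (fun x => f1 x * (g1 x)^* * (k x)%:C) =
  complex_integral D (fun x => f2 x * (g2 x)^* * (k x)%:C).
Proof.
move=> mD D0 mk /L2_eqP f12 /L2_eqP g12.
have m0 : measurable (`[0%R, +oo[ : set R) by exact: measurable_itv.
have mval (f : L2fun) : measurable_fun D (fun x => complex.Re (f x)) /\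
                        measurable_fun D (fun x => complex.Im (f x)).
  by have /asboolP[? ? _ _] := valP f; split; exact: (measurable_funS m0 D0).
have mprod (f g : L2fun) :
    measurable_fun D (fun x => complex.Re (f x * (g x)^* * (k x)%:C)) /\
    measurable_fun D (fun x => complex.Im (f x * (g x)^* * (k x)%:C)).
  have [fR fI] := mval f; have [gR gI] := mval g; split.
    rewrite (_ : (fun x => _) = (fun x => (complex.Re (f x) * complex.Re (g x)
        + complex.Im (f x) * complex.Im (g x)) * k x)).
      by apply: measurable_funM => //; apply: measurable_funD;
        exact: measurable_funM.
    apply/funext => x; case: (L2val f x) (L2val g x) => [? ?] [? ?] /=; ring.
  rewrite (_ : (fun x => _) = (fun x => (complex.Im (f x) * complex.Re (g x)
      - complex.Re (f x) * complex.Im (g x)) * k x)).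
    by apply: measurable_funM => //; apply: measurable_funB;
      exact: measurable_funM.
  by apply/funext => x; case: (L2val f x) (L2val g x) => [? ?] [? ?] /=; ring.
have aeD : {ae mu, forall x, D x ->
    f1 x * (g1 x)^* * (k x)%:C = f2 x * (g2 x)^* * (k x)%:C}.
  apply: (@filterS2 _ _ (ae_filter_ringOfSetsType mu) _ _ _ _ f12 g12).
  move=> x fx gx /D0 /=; rewrite in_itv/= andbT => x0.
  by rewrite fx// gx.
have [mR1 mI1] := mprod f1 g1; have [mR2 mI2] := mprod f2 g2.
rewrite /complex_integral /Rintegral; congr (fine _ +i* fine _).
- apply: ae_eq_integral => //; do ?exact/measurable_EFinP.
  apply: (@filterS _ _ (ae_filter_ringOfSetsType mu) _ _ _ aeD) => x h Dx.
  by rewrite h.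
- apply: ae_eq_integral => //; do ?exact/measurable_EFinP.
  apply: (@filterS _ _ (ae_filter_ringOfSetsType mu) _ _ _ aeD) => x h Dx.
  by rewrite h.
Qed.

Lemma L2_innerE (theta : R) (f g : L2fun) :
  L2_inner theta (\pi_L2 f) (\pi_L2 g) = inner theta f g.
Proof.
have piK (h : L2fun) : \pi_L2 (repr (\pi_L2 h)) = \pi_L2 h by rewrite reprK.
rewrite /L2_inner /inner; congr (_ + _ * _); apply: complex_integral_ae => //.
- exact: sub_01_half.
- exact: measurable_weight01.
- exact: sub_1oo_half.
- exact: measurable_weight1oo.
Qed.

End WeightedL2.

Arguments L2_inner {R alpha beta}.

Section SmoothFunctions.
Variable R : realType.
Implicit Types (f : R -> R[i]) (D : set R).

(* As for [derive1n], the value is arbitrary where the derivative does not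
   exist. *)
Definition complex_derive n f (x : R) : R[i] :=
  derive1n n (fun t => complex.Re (f t)) x
  +i* derive1n n (fun t => complex.Im (f t)) x.

(* Being C^oo only for open [D], the derivatives being two-sided. *)
Definition smooth_on D f : Prop :=
  forall n x, D x ->
    derivable (derive1n n (fun t => complex.Re (f t))) x 1 /\
    derivable (derive1n n (fun t => complex.Im (f t))) x 1.

Definition smooth_near (a : R) f : Prop :=
  exists2 e : R, 0 < e & smooth_on `]a - e, a + e[ f.

(* Smoothness up to 0 from the right: all derivatives on some interval ]0, e[ have
   finite limits at 0, the limit of [f] itself being [f 0]. *)
Definition smooth_right0 f : Prop :=
  [/\ exists2 e : R, 0 < e & smooth_on `]0, e[ f,
      forall n, exists l : R * R,
        derive1n n (fun t => complex.Re (f t)) x @[x --> (0:R)^'+] --> l.1 /\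
        derive1n n (fun t => complex.Im (f t)) x @[x --> (0:R)^'+] --> l.2,
      complex.Re (f x) @[x --> (0:R)^'+] --> complex.Re (f 0)
    & complex.Im (f x) @[x --> (0:R)^'+] --> complex.Im (f 0)].

End SmoothFunctions.

Section HypergeometricOperator.
Variables (R : realType) (alpha beta theta : R).

Definition exponent_set : set R :=
  [set p | (exists k : int, p = theta + k%:~R) /\ 0 < 2 * p + alpha + beta + 1].

Definition is_minimum (S : set R) (r : R) : Prop := S r /\ lbound S r.

(* The space E; [r] stands for the minimum of [exponent_set]. *)
Definition spaceE (r : R) (f : R -> R[i]) : Prop :=
  [/\ smooth_on (`]0, 1[ `|` `]1, +oo[) f,
      smooth_right0 f,
      exists u v : R -> R[i],
        [/\ smooth_near 1 u, smooth_near 1 v &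
          \forall x \near (1 : R),
            (x < 1 -> f x = u x + v x * ((1 - x) `^ (- alpha))%:C) /\
            (1 < x ->
              f x = (sin (theta * pi) / sin ((alpha + theta) * pi))%:C * u x
                    + v x * ((x - 1) `^ (- alpha))%:C)]
    & exists2 w : R -> R[i], smooth_right0 w &
        \forall x \near +oo,
          f x = w x^-1 * (x `^ (- alpha - beta - r - 1))%:C].

Definition opD (f : R -> R[i]) (x : R) : R[i] :=
  (x * (1 - x))%:C * complex_derive 2 f x
  + (beta + 1 - (alpha + beta + 2) * x)%:C * complex_derive 1 f x.

(* The operator D with domain E, acting on classes of functions.  The values
   of [opD f] at 0, 1 and on the negative axis are meaningless, but do not
   affect its class. *)
Definition graphD (r : R) : set (L2 alpha beta * L2 alpha beta) :=
  [set p | exists f g : L2fun alpha beta,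
    [/\ spaceE r f, (g : R -> R[i]) = opD f,
        p.1 = \pi_(L2 alpha beta) f & p.2 = \pi_(L2 alpha beta) g]].

End HypergeometricOperator.

Arguments graphD {R}.

(* Main.v *)
(* On (0, 1) and (1, oo), [D f = (P f')' / w] for a function [P] and the weight [w], so
   Green's formula leaves the boundary terms [P (f' g - f g')].  For f and g in E these vanish
   at 0 and at infinity, and the transmission condition at 1 makes the left and right limits
   cancel in the inner product; hence D is symmetric.  It remains to see that D is densely
   defined and that the ranges of [D + i] and [D - i] are dense, i.e. that [h = y1 + i y2]
   orthogonal to one of them is zero.  Testing with real functions, [D y1 = y2] and
   [D y2 = - y1] (up to a sign) weakly, and by du Bois-Reymond's lemma classically on each
   interval.  With [q_i = P y_i'], the Wronskian [W = q1 y2 - y1 q2] satisfies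
   [W' = w (y1^2 + y2^2)].  Square integrability forces [W <= 0] on (1, oo), because of the
   behaviour at infinity, and [W >= 0] on (0, 1), because of the behaviour at 0.  The functions
   of E equal near 1 to the pair of constants (1, 1 / C) and to |1 - x|^(-alpha) transport the
   boundary data of y1 and y2 across 1, so that [W(1-) = C W(1+)] with [C > 0].  Hence both
   limits are zero, and W, being monotone, vanishes together with its derivative. *)
Require Import Defs.
From HB Require Import structures.
From mathcomp Require Import all_boot all_order all_algebra.
From mathcomp Require Import generic_quotient ring_quotient.
From mathcomp Require Import all_classical all_reals all_analysis.
From mathcomp Require Import measurable_realfun ring lra complex.

Set Implicit Arguments.
Unset Strict Implicit.
Unset Printing Implicit Defensive.

Import Order.TTheory GRing.Theory Num.Theory.
Import numFieldNormedType.Exports.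

Local Open Scope classical_set_scope.
Local Open Scope ring_scope.

(** * Smooth functions on a set *)

(** At 1 the exponents 0 and -alpha both give square-integrable functions, since |alpha| < 1, and so
    do the exponents 0 and -beta at 0 when beta < 1. On compactly supported functions alone D would
    thus not be essentially self-adjoint: the conditions at 0 and at 1 are genuine boundary
    conditions, and each has to be recovered for the adjoint. At infinity, 2 r + alpha + beta + 1 >
    0 says that x^(-s), with s = alpha + beta + r + 1, is square-integrable, and the same inequality
    makes the boundary term vanish. No hypergeometric asymptotics enter. For a solution h of the
    deficiency equation, with q = P h', the signs of W come from W^2 <= |q|^2 |h|^2 played against
    the integrability of W' = w |h|^2, which forbids W' >= c / x near 0 or near infinity. Near 0
    this requires q to tend to 0, which is obtained by testing with a function of E equal to 1
    there. The passage from dense ranges to essential self-adjointness is an orthogonal projection,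
    hence needs the completeness of H, which is proved for the weighted spaces. *)

Section Smooth.
Variable R : realType.
Implicit Types (f g h : R -> R) (D : set R) (x : R) (n : nat).

Definition smooth D f := forall n x, D x -> derivable (derive1n n f) x 1.

(** Smoothness is proved order by order: at a fixed order one can do induction with the function
    generalised, the derivative having one order less. *)
Definition ndiff n D f :=
  forall k x, (k <= n)%N -> D x -> derivable (derive1n k f) x 1.

Lemma smoothP D f : smooth D f <-> forall n, ndiff n D f.
Proof. by split=> [h n k x _|h n x]; [exact: h|exact: h]. Qed.

Lemma ndiffS n D f : ndiff n.+1 D f <->
  (forall x, D x -> derivable f x 1) /\ ndiff n D (derive1 f).
Proof.
split=> [h|[h0 h] [|k] x kn Dx].
- split=> [x Dx|k x kn Dx]; first exact: (h 0%N).
  by rewrite -derive1Sn; exact: h.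
- exact: h0.
- by rewrite derive1Sn; exact: h.
Qed.

Lemma ndiff0 D f : ndiff 0 D f <-> forall x, D x -> derivable f x 1.
Proof.
split=> [h x Dx|h k x]; first exact: (h 0%N).
by rewrite leqn0 => /eqP -> Dx; exact: h.
Qed.

Lemma ndiffW n D f : ndiff n.+1 D f -> ndiff n D f.
Proof. by move=> h k x kn; apply: h; exact: leqW. Qed.

Lemma derive1_eq_on D f g : open D -> (forall x, D x -> f x = g x) ->
  forall x, D x -> (derive1 f) x = (derive1 g) x.
Proof.
move=> oD fg x Dx; rewrite !derive1E; apply: near_eq_derive.
by near=> y; apply: fg; near: y; exact: open_nbhs_nbhs.
Unshelve. all: by end_near. Qed.

Lemma derivable_eq_on D f g : open D -> (forall x, D x -> f x = g x) ->
  forall x, D x -> derivable f x 1 -> derivable g x 1.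
Proof.
move=> oD fg x Dx; apply: near_eq_derivable.
by near=> y; apply: fg; near: y; exact: open_nbhs_nbhs.
Unshelve. all: by end_near. Qed.

Lemma is_derive_eq_on D f g d : open D -> (forall x, D x -> f x = g x) ->
  forall x, D x -> is_derive x 1 f d -> is_derive x 1 g d.
Proof.
move=> oD fg x Dx; apply: near_eq_is_derive.
by near=> y; apply: fg; near: y; exact: open_nbhs_nbhs.
Unshelve. all: by end_near. Qed.

Lemma derive1n_eq_on D f g : open D -> (forall x, D x -> f x = g x) ->
  forall n x, D x -> derive1n n f x = derive1n n g x.
Proof.
move=> oD fg; elim=> [|n IH] x Dx; first exact: fg.
by rewrite !derive1nS; exact: (derive1_eq_on oD).
Qed.

Lemma ndiff_eq n D f g : open D -> (forall x, D x -> f x = g x) ->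
  ndiff n D f -> ndiff n D g.
Proof.
move=> oD fg h k x kn Dx; apply: (derivable_eq_on oD _ Dx (h k x kn Dx)) => y Dy.
exact: (derive1n_eq_on oD).
Qed.

Lemma smooth_eq D f g : open D -> (forall x, D x -> f x = g x) ->
  smooth D f -> smooth D g.
Proof.
by move=> oD fg /smoothP h; apply/smoothP => n; exact: (ndiff_eq oD fg).
Qed.

Lemma smooth_setU D1 D2 f : (forall x, D1 x \/ D2 x) -> smooth D1 f ->
  smooth D2 f -> smooth setT f.
Proof. by move=> h s1 s2 n x _; have [/s1|/s2] := h x; apply. Qed.

Lemma smooth_sub D1 D2 f : D1 `<=` D2 -> smooth D2 f -> smooth D1 f.
Proof. by move=> h s n x /h; exact: s. Qed.

Lemma is_derive_derive1 f x d : is_derive x 1 f d -> (derive1 f) x = d.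
Proof. by move=> [_ <-]; rewrite derive1E. Qed.

(** The induction step of the closure lemmas below: it suffices to exhibit a derivative and to know
    its differentiability to the order before. *)
Lemma ndiff_lift n D f g : open D -> (forall x, D x -> is_derive x 1 f (g x)) ->
  ndiff n D g -> ndiff n.+1 D f.
Proof.
move=> oD fg h; apply/ndiffS; split=> [x Dx|]; first by have [] := fg x Dx.
by apply: (ndiff_eq oD _ h) => x Dx; rewrite (is_derive_derive1 (fg x Dx)).
Qed.

Lemma smooth_lift D f g : open D -> (forall x, D x -> is_derive x 1 f (g x)) ->
  smooth D g -> smooth D f.
Proof.
move=> oD fg /smoothP h; apply/smoothP => n; apply: ndiffW.
exact: (ndiff_lift oD fg).
Qed.

Lemma derivable_is_derive f x : derivable f x 1 -> is_derive x 1 f ((derive1 f) x).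
Proof. by move=> h; rewrite derive1E; exact: DeriveDef. Qed.

Lemma smooth_is_derive D f x : smooth D f -> D x -> is_derive x 1 f ((derive1 f) x).
Proof. by move=> h Dx; apply: derivable_is_derive; exact: (h 0%N). Qed.

Lemma smooth_derive1 D f : smooth D f -> smooth D (derive1 f).
Proof. by move=> h n x Dx; rewrite -derive1Sn; exact: h. Qed.

Lemma smooth_derive1n D f m : smooth D f -> smooth D (derive1n m f).
Proof.
move=> h; elim: m => [|m IH]; first exact: h.
rewrite derive1nS; exact: smooth_derive1.
Qed.

Lemma smooth_continuous D f x : smooth D f -> D x -> {for x, continuous f}.
Proof. by move=> h Dx; apply/differentiable_continuous/derivable1_diffP/(h 0%N). Qed.

Lemma is_deriveD' f g x a b : is_derive x 1 f a -> is_derive x 1 g b ->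
  is_derive x 1 (fun t => f t + g t) (a + b).
Proof. exact: is_deriveD. Qed.

Lemma is_deriveB' f g x a b : is_derive x 1 f a -> is_derive x 1 g b ->
  is_derive x 1 (fun t => f t - g t) (a - b).
Proof. exact: is_deriveB. Qed.

Lemma is_deriveN' f x a : is_derive x 1 f a ->
  is_derive x 1 (fun t => - f t) (- a).
Proof. exact: is_deriveN. Qed.

Lemma is_deriveM' f g x a b : is_derive x 1 f a -> is_derive x 1 g b ->
  is_derive x 1 (fun t => f t * g t) (a * g x + f x * b).
Proof.
move=> fa gb; apply: is_derive_eq.
by rewrite addrC /GRing.scale/=; congr (_ + _); exact: mulrC.
Qed.

Lemma is_derive_c (c : R) x : is_derive x 1 (fun=> c : R) 0.
Proof. exact: is_derive_cst. Qed.

Lemma is_deriveZ' f x a (c : R) : is_derive x 1 f a ->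
  is_derive x 1 (fun t => c * f t) (c * a).
Proof.
move=> fa; have := is_deriveM' (is_derive_c c x) fa.
by rewrite mul0r add0r.
Qed.

(** The square is written as two factors of the inverse, so that the induction hypothesis of
    [smoothV] applies to each of them. *)
Lemma is_deriveV' f x a : f x != 0 -> is_derive x 1 f a ->
  is_derive x 1 (fun t => (f t)^-1) (- a * (f x)^-1 * (f x)^-1).
Proof.
move=> f0 fa; have [d e] := fa; apply: DeriveDef; first exact: derivableV.
by rewrite deriveV// e /GRing.scale/= expr2 invfM; ring.
Qed.

Lemma is_derive_comp f g x a b : is_derive x 1 f a -> is_derive (f x) 1 g b ->
  is_derive x 1 (fun t => g (f t)) (b * a).
Proof. by move=> fa gb; exact: is_derive1_comp. Qed.

Lemma is_derive_x x : is_derive x 1 (fun t : R => t) 1.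
Proof. exact: is_derive_id. Qed.

Lemma is_derive_cong f x a b : is_derive x 1 f a -> a = b -> is_derive x 1 f b.
Proof. by move=> h <-. Qed.

Lemma is_deriveX' f x a n : is_derive x 1 f a ->
  is_derive x 1 (fun t => f t ^+ n) (n%:R * f x ^+ n.-1 * a).
Proof.
move=> fa; elim: n => [|n IH].
  by apply: (is_derive_cong (is_derive_c 1 x)); rewrite !mul0r.
rewrite (_ : (fun t => _) = (fun t => f t * f t ^+ n)); last first.
  by apply/funext => t; rewrite exprS.
apply: (is_derive_cong (is_deriveM' fa IH)).
by case: n {IH} => [|n]; rewrite ?exprS/= -?natr1; ring.
Qed.

Lemma smooth_cst D (c : R) : open D -> smooth D (fun=> c).
Proof.
move=> oD; apply/smoothP => n; elim: n c => [|n IH] c.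
  by apply/ndiff0 => x Dx; have [] := is_derive_c c x.
by apply: (ndiff_lift oD (g := fun=> 0)) => // x _; exact: is_derive_c.
Qed.

Lemma smooth_id D : open D -> smooth D (fun x => x).
Proof.
move=> oD; apply: (smooth_lift oD (g := fun=> 1)); last exact: smooth_cst.
Qed.

Lemma ndiffD n D f g : open D -> ndiff n D f -> ndiff n D g ->
  ndiff n D (fun x => f x + g x).
Proof.
move=> oD; elim: n f g => [|n IH] f g.
  move=> /ndiff0 hf /ndiff0 hg; apply/ndiff0 => x Dx.
  by have [] := is_deriveD' (derivable_is_derive (hf x Dx))
                   (derivable_is_derive (hg x Dx)).
move=> /ndiffS[hf hf'] /ndiffS[hg hg'].
apply: (ndiff_lift oD _ (IH _ _ hf' hg')) => x Dx.
exact: (is_deriveD' (derivable_is_derive (hf x Dx))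
                   (derivable_is_derive (hg x Dx))).
Qed.

Lemma ndiffM n D f g : open D -> ndiff n D f -> ndiff n D g ->
  ndiff n D (fun x => f x * g x).
Proof.
move=> oD; elim: n f g => [|n IH] f g.
  move=> /ndiff0 hf /ndiff0 hg; apply/ndiff0 => x Dx.
  by have [] := is_deriveM' (derivable_is_derive (hf x Dx))
                   (derivable_is_derive (hg x Dx)).
move=> sf sg; move: (sf) (sg) => /ndiffS[hf hf'] /ndiffS[hg hg'].
apply: (ndiff_lift oD (g := fun x => (derive1 f) x * g x + f x * (derive1 g) x)) => [x Dx|].
  exact: (is_deriveM' (derivable_is_derive (hf x Dx))
                   (derivable_is_derive (hg x Dx))).
apply: (ndiffD oD); apply: IH; [exact: hf'|exact: ndiffW|exact: ndiffW|exact: hg'].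
Qed.

Lemma smoothD D f g : open D -> smooth D f -> smooth D g ->
  smooth D (fun x => f x + g x).
Proof.
by move=> oD /smoothP hf /smoothP hg; apply/smoothP => n; exact: ndiffD.
Qed.

Lemma smoothM D f g : open D -> smooth D f -> smooth D g ->
  smooth D (fun x => f x * g x).
Proof.
by move=> oD /smoothP hf /smoothP hg; apply/smoothP => n; exact: ndiffM.
Qed.

Lemma smoothZ D f (c : R) : open D -> smooth D f -> smooth D (fun x => c * f x).
Proof. by move=> oD sf; apply: (smoothM oD _ sf); exact: smooth_cst. Qed.

Lemma smoothN D f : open D -> smooth D f -> smooth D (fun x => - f x).
Proof.
move=> oD sf; apply: (@smooth_eq _ (fun x => -1 * f x) _ oD); last exact: smoothZ.
by move=> x _; exact: mulN1r.
Qed.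

Lemma smoothB D f g : open D -> smooth D f -> smooth D g ->
  smooth D (fun x => f x - g x).
Proof. by move=> oD sf sg; apply: (smoothD oD sf); exact: smoothN. Qed.

Lemma smoothV D f : open D -> (forall x, D x -> f x != 0) -> smooth D f ->
  smooth D (fun x => (f x)^-1).
Proof.
move=> oD f0 /smoothP sf; apply/smoothP; elim=> [|n IH].
  apply/ndiff0 => x Dx; move/ndiff0: (sf 0%N) => /(_ x Dx) /derivable_is_derive h.
  by have [] := is_deriveV' (f0 x Dx) h.
apply: (ndiff_lift oD (g := fun x => - (derive1 f) x * (f x)^-1 * (f x)^-1)) => [x Dx|].
  apply: is_deriveV'; first exact: f0.
  by apply: derivable_is_derive; exact: (sf 0%N 0%N).
apply: (ndiffM oD); last exact: IH.
apply: (ndiffM oD); last exact: IH.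
have /smoothP h : smooth D (fun x => - (derive1 f) x).
  by apply: (smoothN oD); apply: smooth_derive1; apply/smoothP.
exact: h.
Qed.

Lemma smooth_comp D1 D2 f g : open D1 -> open D2 -> (forall x, D1 x -> D2 (f x)) ->
  smooth D1 f -> smooth D2 g -> smooth D1 (fun x => g (f x)).
Proof.
move=> o1 o2 f12 sf sg; apply/smoothP => n.
elim: n g sg => [|n IH] g sg.
  apply/ndiff0 => x Dx.
  by have [] := is_derive_comp (smooth_is_derive sf Dx)
    (smooth_is_derive sg (f12 x Dx)).
apply: (ndiff_lift o1 (g := fun x => (derive1 g) (f x) * (derive1 f) x)) => [x Dx|].
  exact: (is_derive_comp (smooth_is_derive sf Dx) (smooth_is_derive sg (f12 x Dx))).
apply: (ndiffM o1); first exact: IH (smooth_derive1 sg).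
have /smoothP h := smooth_derive1 sf; exact: h.
Qed.

Lemma open_gt0 : open [set x : R | 0 < x].
Proof. exact: open_gt. Qed.

Lemma smooth_powR (a : R) : smooth [set x | 0 < x] (fun x => x `^ a).
Proof.
apply/smoothP => n; elim: n a => [|n IH] a.
  by apply/ndiff0 => x x0; have [] := is_derive1_powR a x0.
apply: (ndiff_lift open_gt0 (g := fun x => a * x `^ (a - 1))).
apply: (ndiffM open_gt0); last exact: IH.
have /smoothP h := smooth_cst (c := a) open_gt0; exact: h.
Qed.

End Smooth.

(* Otherwise unification unfolds derivatives into limits. *)
Opaque derive1 derive1n smooth ndiff.

(** * A smooth step function *)

Section SmoothStep.
Variable R : realType.
Implicit Types x : R.

(** The difference quotient is at most c |h|. This settles the point 0 for the functions [flat]. *)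
Lemma is_derive_sqr_bound (f : R -> R) (c x : R) : f x = 0 ->
  (forall y, `|f y| <= c * (y - x) ^+ 2) -> is_derive x 1 f 0.
Proof.
move=> f0 fc.
have c0 : 0 <= c.
  have := fc (x + 1); rewrite addrAC subrr add0r expr1n mulr1.
  by apply: le_trans.
suff h : h^-1 *: (f (h *: (1 : R) + x) - f x) @[h --> (0 : R)^'] --> (0 : R).
  by apply: DeriveDef; [apply/cvg_ex; exists 0|apply/cvg_lim].
apply/cvgrPdist_le => /= e e0; near=> h.
have h0 : h != 0 by near: h; exact: nbhs_dnbhs_neq.
rewrite f0 !subr0 sub0r normrN normrZ.
apply: (@le_trans _ _ (`|h^-1| * (c * h ^+ 2))).
  rewrite ler_wpM2l//; apply: le_trans (fc _) _.
  by rewrite /GRing.scale/= mulr1 addrK.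
rewrite -[h ^+ 2]real_normK ?num_real// normfV expr2 mulrCA.
rewrite (mulrA `|h|^-1) mulVf ?normr_eq0// mul1r.
apply: (@le_trans _ _ ((c + 1) * `|h|)); first by rewrite ler_wpM2r// lerDl.
rewrite mulrC -ler_pdivlMr ?ltr_wpDl//.
near: h; apply: dnbhs0_le; by rewrite divr_gt0// ltr_wpDl.
Unshelve. all: by end_near. Qed.

(* The family is closed under differentiation, [flat k]' = [flat k.+2] - k [flat k.+1],
   whence smoothness at 0. *)
Definition flat k x : R := if 0 < x then x^-1 ^+ k * expR (- x^-1) else 0.

Lemma flat_ge0 k x : 0 <= flat k x.
Proof.
rewrite /flat; case: ifPn => // x0.
by rewrite mulr_ge0 ?expR_ge0// exprn_ge0// invr_ge0 ltW.
Qed.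

Lemma flat_gt0 k x : 0 < x -> 0 < flat k x.
Proof.
by move=> x0; rewrite /flat x0 mulr_gt0 ?expR_gt0// exprn_gt0// invr_gt0.
Qed.

Lemma flat_eq0 k x : x <= 0 -> flat k x = 0.
Proof. by move=> x0; rewrite /flat ltNge x0. Qed.

(** With t = 1 / x, exp t >= t^(k + 2) / (k + 2)!; the two powers of t beyond t^k leave x^2. *)
Lemma flat_bound k x : `|flat k x| <= k.+2`!%:R * (x - 0) ^+ 2.
Proof.
rewrite subr0 ger0_norm ?flat_ge0// /flat; case: ifPn => x0; last first.
  by rewrite mulr_ge0// sqr_ge0.
have t0 : 0 < x^-1 by rewrite invr_gt0.
rewrite expRN ler_pdivrMr ?expR_gt0//.
have -> : x^-1 ^+ k = x ^+ 2 * x^-1 ^+ k.+2.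
  have xV : x * x^-1 = 1 by rewrite divff ?gt_eqF//.
  transitivity ((x * x^-1) ^+ 2 * x^-1 ^+ k); first by rewrite xV expr1n mul1r.
  by rewrite !exprS; ring.
rewrite [leRHS](_ : _ = x ^+ 2 * (expR x^-1 * k.+2`!%:R)); last by ring.
rewrite ler_wpM2l ?sqr_ge0// -ler_pdivrMr ?ltr0n ?fact_gt0//.
by apply: le_trans (expR_ge1Dxn k.+1 (ltW t0)); rewrite lerDr.
Qed.

Lemma flat_derive k x :
  is_derive x 1 (flat k) (- k%:R * flat k.+1 x + flat k.+2 x).
Proof.
have [x0|x0|->] := ltgtP x 0.
- rewrite !flat_eq0 ?ltW// mulr0 addr0.
  apply: (@is_derive_eq_on _ [set y | y < 0] (fun=> 0) _ 0 _ _ x x0).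
  + exact: open_lt.
  + by move=> y /= y0; rewrite flat_eq0// ltW.
- apply: (@is_derive_eq_on _ [set y | 0 < y] (fun y => y^-1 ^+ k * expR (- y^-1)) _ _ _ _ x x0).
  + exact: open_gt.
  + by move=> y /= y0; rewrite /flat y0.
  + have dV : is_derive x 1 (fun t : R => t^-1) (- 1 * x^-1 * x^-1).
      by apply: is_deriveV'; rewrite gt_eqF.
    have dX : is_derive x 1 (fun t : R => t^-1 ^+ k)
        (k%:R * x^-1 ^+ k.-1 * (- 1 * x^-1 * x^-1)).
      exact: is_deriveX'.
    have dE := is_derive_comp (is_deriveN' dV) (is_derive_expR (- x^-1)).
    apply: (is_derive_cong (is_deriveM' dX dE)).
    rewrite /flat x0; case: k {dX} => [|k]; rewrite ?exprS/=; ring.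
- rewrite !flat_eq0 // mulr0 addr0.
  apply: (@is_derive_sqr_bound _ k.+2`!%:R); first exact: flat_eq0.
  exact: flat_bound.
Qed.

Lemma smooth_flat k : smooth setT (flat k).
Proof.
apply/smoothP => n; elim: n k => [|n IH] k.
  by apply/ndiff0 => x _; have [] := flat_derive k x.
apply: (ndiff_lift openT (g := fun x => - k%:R * flat k.+1 x + flat k.+2 x)).
  by move=> x _; exact: flat_derive.
apply: (ndiffD openT); last exact: IH.
apply: (ndiffM openT); last exact: IH.
have /smoothP h := smooth_cst (c := - k%:R) (@openT R); exact: h.
Qed.

Definition step x : R := flat 0 x / (flat 0 x + flat 0 (1 - x)).

Lemma step_den x : 0 < flat 0 x + flat 0 (1 - x).
Proof.
have [x0|x0] := ltP 0 x; first by rewrite ltr_pwDl ?flat_gt0 ?flat_ge0.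
by rewrite ltr_wpDl ?flat_ge0// flat_gt0// subr_gt0 (le_lt_trans x0).
Qed.

Lemma smooth_step : smooth setT step.
Proof.
apply: (smoothM openT); first exact: smooth_flat.
apply: (smoothV openT) => [x _|]; first by rewrite gt_eqF// step_den.
apply: (smoothD openT); first exact: smooth_flat.
apply: (@smooth_comp _ setT setT (fun x => 1 - x) (flat 0) openT openT) => //.
  by apply: (smoothB openT); [exact: (smooth_cst openT)|exact: (smooth_id openT)].
exact: smooth_flat.
Qed.

Lemma step_ge0 x : 0 <= step x.
Proof. by rewrite divr_ge0 ?flat_ge0// ltW// step_den. Qed.

Lemma step_le1 x : step x <= 1.
Proof. by rewrite ler_pdivrMr ?step_den// mul1r lerDl flat_ge0. Qed.

Lemma step_le0 x : x <= 0 -> step x = 0.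
Proof. by move=> x0; rewrite /step flat_eq0// mul0r. Qed.

Lemma step_ge1 x : 1 <= x -> step x = 1.
Proof.
move=> x1; rewrite /step (flat_eq0 0 (x := 1 - x)) ?subr_le0// addr0 divff//.
by rewrite gt_eqF// flat_gt0// (lt_le_trans ltr01).
Qed.

End SmoothStep.

Notation meas D := (measurable (D : set (measurableTypeR _))).
Notation mfun D f := (measurable_fun (D : set (measurableTypeR _)) f).

(** * Integrals of real functions *)

Section Integrals.
Variable R : realType.
Notation mu := (@lebesgue_measure R).
Implicit Types (D I : set R) (f g h : R -> R) (a b c d x : R).

Definition L1 D f := mu.-integrable D (EFin \o f).
Definition rint D f : R := \int[mu]_(x in D) f x.

Lemma L1_meas D f : meas D -> L1 D f -> mfun D f.
Proof. by move=> mD /integrableP[/measurable_EFinP]. Qed.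

Lemma L1_le D f g : meas D -> mfun D f ->
  (forall x, D x -> `|f x| <= g x) -> L1 D g -> L1 D f.
Proof.
move=> mD mf fg; apply: le_integrable => //; first exact/measurable_EFinP.
by move=> x Dx /=; rewrite lee_fin (le_trans (fg x Dx))// ler_norm.
Qed.

Lemma L1S D E f : meas D -> meas E -> D `<=` E -> L1 E f -> L1 D f.
Proof. by move=> mD mE DE; exact: integrableS. Qed.

Lemma L1D D f g : meas D -> L1 D f -> L1 D g -> L1 D (fun x => f x + g x).
Proof. by move=> mD hf hg; have := integrableD mD hf hg. Qed.

Lemma L1B D f g : meas D -> L1 D f -> L1 D g -> L1 D (fun x => f x - g x).
Proof. by move=> mD hf hg; have := integrableB mD hf hg. Qed.

Lemma L1Z D f (k : R) : meas D -> L1 D f -> L1 D (fun x => k * f x).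
Proof. by move=> mD hf; have := integrableZl mD k hf. Qed.

Lemma L1_norm D f : L1 D f -> L1 D (fun x => `|f x|).
Proof. exact: integrable_norm. Qed.

Lemma L1_eq D f g : meas D -> (forall x, D x -> f x = g x) ->
  L1 D f -> L1 D g.
Proof.
by move=> mD fg; apply: eq_integrable => // x /set_mem Dx /=; rewrite fg.
Qed.

Lemma L1M D f g (M : R) : meas D -> mfun D f ->
  (forall x, D x -> `|f x| <= M) -> L1 D g -> L1 D (fun x => f x * g x).
Proof.
move=> mD mf fM hg.
apply: (@L1_le _ _ (fun x => M * `|g x|)) => //.
- by apply: measurable_funM => //; exact: L1_meas hg.
- by move=> x Dx; rewrite normrM ler_wpM2r// fM.
- by apply: L1Z => //; exact: L1_norm.
Qed.

Lemma continuous_in_within D f : (forall x, D x -> {for x, continuous f}) ->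
  {within D, continuous f}.
Proof.
by move=> cf; apply: continuous_in_subspaceT => x /set_mem Dx; exact: cf.
Qed.

Lemma L1_cont a b f : (forall x, a <= x <= b -> {for x, continuous f}) ->
  L1 `[a, b] f.
Proof.
move=> cf; apply: continuous_compact_integrable; first exact: segment_compact.
by apply: continuous_in_within => x /=; rewrite in_itv/=; exact: cf.
Qed.

Lemma rint_eq D f g : (forall x, D x -> f x = g x) -> rint D f = rint D g.
Proof. by move=> fg; apply: eq_Rintegral => x /set_mem; exact: fg. Qed.

Lemma rintD D f g : meas D -> L1 D f -> L1 D g ->
  rint D (fun x => f x + g x) = rint D f + rint D g.
Proof. by move=> mD hf hg; rewrite /rint RintegralD. Qed.

Lemma rintB D f g : meas D -> L1 D f -> L1 D g ->
  rint D (fun x => f x - g x) = rint D f - rint D g.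
Proof. by move=> mD hf hg; rewrite /rint RintegralB. Qed.

Lemma rintZ D f (k : R) : meas D -> L1 D f ->
  rint D (fun x => k * f x) = k * rint D f.
Proof. by move=> mD hf; rewrite /rint RintegralZl. Qed.

Lemma rint_le D f g : meas D -> L1 D f -> L1 D g ->
  (forall x, D x -> f x <= g x) -> rint D f <= rint D g.
Proof. by move=> mD hf hg fg; exact: le_Rintegral. Qed.

Lemma rint_norm D f g : meas D -> L1 D f -> L1 D g ->
  (forall x, D x -> `|f x| <= g x) -> `|rint D f| <= rint D g.
Proof.
move=> mD hf hg fg; apply: le_trans (le_normr_Rintegral mD hf) _.
by apply: rint_le => //; exact: L1_norm.
Qed.

Lemma rint_ge0 D f : (forall x, D x -> 0 <= f x) -> 0 <= rint D f.
Proof. by move=> f0; rewrite /rint fine_ge0// integral_ge0. Qed.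

Lemma rint_EFin D f : meas D -> L1 D f ->
  (\int[mu]_(x in D) (f x)%:E)%E = (rint D f)%:E.
Proof. by move=> mD hf; rewrite /rint /Rintegral fineK// integrable_fin_num. Qed.

Lemma rint_ae D f g : meas D -> mfun D f -> mfun D g ->
  {ae mu, forall x, D x -> f x = g x} -> rint D f = rint D g.
Proof.
move=> mD mf mg fg; rewrite /rint /Rintegral; congr fine.
apply: ae_eq_integral => //; do ?exact/measurable_EFinP.
by apply: (@filterS _ _ (ae_filter_ringOfSetsType mu) _ _ _ fg) => x h Dx; rewrite h.
Qed.

Lemma L1_ae D f g : meas D -> mfun D g ->
  {ae mu, forall x, D x -> f x = g x} -> L1 D f -> L1 D g.
Proof.
move=> mD mg fg hf; apply/integrableP; split; first exact/measurable_EFinP.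
have /integrableP[mf] := hf; apply: le_lt_trans; rewrite le_eqVlt; apply/orP; left.
apply/eqP; apply: ae_eq_integral => //.
- by apply: measurableT_comp => //; exact/measurable_EFinP.
- exact: measurableT_comp.
apply: (@filterS _ _ (ae_filter_ringOfSetsType mu) _ _ _ fg) => x h Dx /=.
by rewrite h.
Qed.

Lemma rint_supp D I f : D `<=` I -> (forall x, I x -> ~ D x -> f x = 0) ->
  rint I f = rint D f.
Proof.
move=> DI f0; rewrite /rint Rintegral_mkcond [RHS]Rintegral_mkcond; congr Rintegral.
apply/funext => x; rewrite !patchE; case: ifPn => [/set_mem Ix|/negP Ix].
  by case: ifPn => // /negP Dx; apply: f0 => // Dx'; apply: Dx; exact/mem_set.
case: ifPn => // /set_mem Dx; exfalso; apply: Ix; apply/mem_set; exact: DI.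
Qed.

Lemma L1_supp D I f : meas D -> meas I -> D `<=` I ->
  (forall x, I x -> ~ D x -> f x = 0) -> L1 D f -> L1 I f.
Proof.
move=> mD mI DI f0 hf.
have h : L1 I (f \_ D).
  rewrite /L1 -restrict_EFin; apply/integrable_restrict => //.
  by rewrite setIidr.
apply: L1_eq h => // x Ix; rewrite patchE; case: ifPn => // /negP Dx.
by rewrite f0// => Dx'; apply: Dx; exact/mem_set.
Qed.

Lemma rint_cat a b c f : a <= b -> b <= c -> L1 `[a, c] f ->
  rint `[a, c] f = rint `[a, b] f + rint `[b, c] f.
Proof.
move=> ab bc h; apply/eqP; rewrite addrC -subr_eq; apply/eqP.
rewrite /rint Rintegral_itvB ?bnd_simp// Rintegral_itv_obnd_cbnd//.
apply: integrableS h => //; apply: subset_itvScc => //.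
Qed.

Lemma rint_id a f : rint `[a, a] f = 0.
Proof. by rewrite /rint set_itv1 Rintegral_set1. Qed.

Lemma FTC2 f F a b : a <= b -> (forall x, a <= x <= b -> is_derive x 1 F (f x)) ->
  (forall x, a <= x <= b -> {for x, continuous f}) ->
  rint `[a, b] f = F b - F a.
Proof.
rewrite le_eqVlt => /predU1P[<-|ab] dF cf; first by rewrite rint_id subrr.
have cF x : a <= x <= b -> {for x, continuous F}.
  move=> /dF[dFx _]; exact/differentiable_continuous/derivable1_diffP.
suff : (\int[mu]_(x in `[a, b]) (f x)%:E = (F b)%:E - (F a)%:E)%E.
  by rewrite rint_EFin//; [move=> []|exact: L1_cont].
apply: continuous_FTC2 => //.
- by apply: continuous_in_within => x /=; rewrite in_itv; exact: cf.
- split.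
  + by move=> x; rewrite in_itv/= => /andP[? ?]; have [] := dF x; rewrite // !ltW.
  + by apply: cvg_at_right_filter; apply: cF; rewrite lexx ltW.
  + by apply: cvg_at_left_filter; apply: cF; rewrite lexx ltW.
- move=> x; rewrite in_itv/= => /andP[? ?]; apply: is_derive_derive1.
  by apply: dF; rewrite !ltW.
Qed.

Lemma is_derive_continuous f x d : is_derive x 1 f d -> {for x, continuous f}.
Proof. by move=> [df _]; exact/differentiable_continuous/derivable1_diffP. Qed.

Lemma FTC1_int f a u x : a < x < u -> L1 `[a, u] f -> {for x, continuous f} ->
  is_derive x 1 (fun y => rint `[a, y] f) (f x).
Proof.
move=> /andP[ax xu] hf cf.
have [dF eF] := continuous_FTC1_closed xu hf ax cf.
by rewrite -eF; exact: derivable_is_derive.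
Qed.

End Integrals.

(** * Primitives on an open interval *)

Section Primitives.
Variable R : realType.
Notation mu := (@lebesgue_measure R).
Implicit Types (D : set R) (f g h F G : R -> R) (a b c d x : R).

(** Dominated convergence for the truncations of [h] to the intervals, with |h| as the dominating
    function. *)
Lemma rint_exhaust D h (c_ d_ : nat -> R) : meas D -> L1 D h ->
  (forall n, `[c_ n, d_ n] `<=` D) ->
  (forall x, D x -> \forall n \near \oo, c_ n <= x <= d_ n) ->
  rint `[c_ n, d_ n] h @[n --> \oo] --> rint D h.
Proof.
move=> mD hh sub ex.
have mh := L1_meas mD hh.
have mpatch n : mfun D (h \_ `[c_ n, d_ n]).
  have mi : meas (`[c_ n, d_ n]%classic : set R) by exact: measurable_itv.
  apply: (measurable_restrict h mi mD).1.
  by apply: measurable_funS mh => //; exact: subIsetl.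
have H := @dominated_convergence _ _ R mu D mD
  (fun n => EFin \o (h \_ `[c_ n, d_ n])) (EFin \o h) (EFin \o (fun x => `|h x|)).
have step1 n : (\int[mu]_(x in D) (EFin \o h \_ `[c_ n, d_ n]) x =
    (rint `[c_ n, d_ n] h)%:E)%E.
  rewrite -rint_EFin//; last by apply: L1S hh => //; exact: sub.
  rewrite -restrict_EFin -integral_mkcondr setIidr//; exact: sub.
suff C : (fun n => (rint `[c_ n, d_ n] h)%:E) @ \oo --> (rint D h)%:E.
  exact: (fine_cvg C).
rewrite -rint_EFin//; under eq_fun do rewrite -step1.
have [] // := H.
- by move=> n; exact/measurable_EFinP.
- exact/measurable_EFinP.
- apply: aeW => x Dx; apply: cvg_near_cst.
  have := ex x Dx; apply: filterS => n cxd /=.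
  by rewrite patchE mem_set//= in_itv.
- exact: L1_norm.
- apply: aeW => x n Dx /=; rewrite patchE lee_fin; case: ifPn => //.
  by rewrite normr0.
Qed.

Lemma rint_ge a b f : b <= a -> rint `[a, b] f = 0.
Proof.
rewrite le_eqVlt => /predU1P[->|ba]; first exact: rint_id.
by rewrite /rint set_itv_ge ?Rintegral_set0// bnd_simp -ltNge.
Qed.

Variable I : set R.
Hypotheses (oI : open I) (iI : is_interval I).

Lemma open_pm x : I x -> exists2 e : R, 0 < e & I (x - e) /\ I (x + e).
Proof.
move=> Ix; have /nbhs_ballP[e /= e0 eI] : nbhs x I by exact: open_nbhs_nbhs.
exists (e / 2); first by rewrite divr_gt0.
have e2 : 0 < e / 2 by rewrite divr_gt0.
split; apply: eI; rewrite /ball/=.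
  by rewrite (_ : x - (x - e / 2) = e / 2) ?gtr0_norm//; [lra|ring].
by rewrite (_ : x - (x + e / 2) = - (e / 2)) ?normrN ?gtr0_norm//; [lra|ring].
Qed.

Definition L1loc f := forall c d, I c -> I d -> L1 `[c, d] f.

Lemma itv_sub c d : I c -> I d -> `[c, d] `<=` I.
Proof. by move=> Ic Id x /=; rewrite in_itv/= => h; exact: (iI Ic Id). Qed.

Lemma L1loc_cont f : (forall x, I x -> {for x, continuous f}) -> L1loc f.
Proof.
move=> cf c d Ic Id; apply: L1_cont => x cxd; apply: cf; exact: (iI Ic Id).
Qed.

Lemma primL1 f : L1loc f ->
  exists G, forall c d, I c -> I d -> c <= d -> G d - G c = rint `[c, d] f.
Proof.
move=> hf; have [[x0 Ix0]|I0] := pselect (exists x, I x); last first.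
  by exists (fun=> 0) => c d Ic; exfalso; apply: I0; exists c.
(* The oriented integral from x0 to x: one of the two intervals is empty or a point. *)
exists (fun x => rint `[x0, x] f - rint `[x, x0] f) => c d Ic Id cd.
have [x0c|cx0] := leP x0 c.
  have x0d := le_trans x0c cd.
  rewrite (rint_ge _ x0d) (rint_ge _ x0c) !subr0.
  by rewrite (@rint_cat _ x0 c d)// ?[_ - _]addrC ?addKr//; exact: hf.
have [x0d|dx0] := leP x0 d.
  rewrite (rint_ge _ x0d) (rint_ge _ (ltW cx0)) subr0 sub0r opprK addrC.
  by rewrite -rint_cat// ?(ltW cx0)//; exact: hf.
rewrite (rint_ge _ (ltW dx0)) (rint_ge _ (ltW cx0)) !sub0r opprK addrC.
rewrite (@rint_cat _ c d x0) ?addrK// ?(ltW dx0)//; exact: hf.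
Qed.

Section PrimL1Prop.
Variables (f G : R -> R).
Hypothesis hf : L1loc f.
Hypothesis GE : forall c d, I c -> I d -> c <= d -> G d - G c = rint `[c, d] f.

(** Around x the primitive becomes an integral with the fixed lower end x - e, to which the theorems
    on indefinite integrals apply. *)
Let G_local x e : 0 < e -> I (x - e) -> I (x + e) -> forall y,
  y \in `]x - e, x + e[ -> rint `[x - e, y] f + G (x - e) = G y.
Proof.
move=> e0 Im Ip y; rewrite in_itv/= => /andP[y1 y2].
rewrite -GE ?subrK// ?ltW//; apply: (iI Im Ip); by rewrite !ltW.
Qed.

Lemma primL1_continuous x : I x -> {for x, continuous G}.
Proof.
move=> Ix; have [e e0 [Im Ip]] := open_pm Ix.
have xle : x - e <= x + e by rewrite lerD2l ge0_cp// ltW.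
have h := parameterized_integral_continuous xle (hf Im Ip).
have /= hx : {for x, continuous (fun y => rint `[x - e, y] f + G (x - e))}.
  apply: continuousD; last exact: cst_continuous.
  move: h => /(continuous_within_itvP _ _)[|+ _ _].
    by rewrite ltrD2l gt0_cp.
  by apply; rewrite in_itv/= ltrBlDr ltrDl e0.
have Gx : G x = rint `[x - e, x] f + G (x - e).
  by rewrite G_local// in_itv/= ltrBlDr ltrDl e0.
change (G y @[y --> x] --> G x); rewrite Gx.
apply: cvg_trans hx; apply: near_eq_cvg.
near=> y; apply: G_local => //.
near: y; apply: near_in_itvoo; by rewrite in_itv/= ltrBlDr ltrDl e0.
Unshelve. all: by end_near. Qed.

Lemma primL1_derive x : I x -> {for x, continuous f} -> is_derive x 1 G (f x).
Proof.
move=> Ix cf; have [e e0 [Im Ip]] := open_pm Ix.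
have xin : `]x - e, x + e[%classic x by rewrite /= in_itv/= ltrBlDr ltrDl e0.
apply: (@is_derive_eq_on _ _ (fun y => rint `[x - e, y] f + G (x - e)) _ _ _ _ x xin).
- exact: interval_open.
- by move=> y /= yi; exact: G_local.
- rewrite -[f x]addr0; apply: is_deriveD'; apply: (@FTC1_int _ _ _ (x + e)) => //.
  exact: hf.
Qed.

End PrimL1Prop.

Lemma primC f : (forall x, I x -> {for x, continuous f}) ->
  exists F, forall x, I x -> is_derive x 1 F (f x).
Proof.
move=> cf; have hf := L1loc_cont cf; have [F FE] := primL1 hf.
by exists F => x Ix; apply: (primL1_derive hf FE Ix); exact: cf.
Qed.

Lemma FTC2I f F c d : I c -> I d -> c <= d ->
  (forall x, I x -> is_derive x 1 F (f x)) ->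
  (forall x, I x -> {for x, continuous f}) -> rint `[c, d] f = F d - F c.
Proof.
move=> Ic Id cd dF cf; apply: FTC2 => // x cxd; [apply: dF|apply: cf];
  exact: (iI Ic Id).
Qed.

Lemma derive_ge0_nd F f : (forall x, I x -> is_derive x 1 F (f x)) ->
  (forall x, I x -> 0 <= f x) -> forall c d, I c -> I d -> c <= d -> F c <= F d.
Proof.
move=> dF f0 c d Ic Id; rewrite le_eqVlt => /predU1P[->//|cd].
have Icd x : c <= x <= d -> I x by exact: (iI Ic Id).
have [x xcd] := @MVT _ F f c d cd
  (fun x (xi : x \in `]c, d[) => dF x (Icd x (subset_itv_oo_cc xi)))
  (continuous_in_within (fun x (xi : x \in `[c, d]) =>
     is_derive_continuous (dF x (Icd x xi)))).
move=> /eqP; rewrite subr_eq => /eqP ->; rewrite lerDr mulr_ge0 ?subr_ge0 ?(ltW cd)//.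
by apply: f0; apply: Icd; exact: (subset_itv_oo_cc xcd).
Qed.

End Primitives.

(** * Test functions *)

Section Tests.
Variable R : realType.
Notation mu := (@lebesgue_measure R).
Implicit Types (D : set R) (f g h k F G eta zeta phi psi : R -> R) (a b c d x : R).

Lemma rint_dominated D (f_ : nat -> R -> R) f g : meas D ->
  (forall n, mfun D (f_ n)) -> mfun D f -> L1 D g ->
  (forall n x, D x -> `|f_ n x| <= g x) ->
  (forall x, D x -> f_ n x @[n --> \oo] --> f x) ->
  rint D (f_ n) @[n --> \oo] --> rint D f.
Proof.
move=> mD mf_ mf hg fg ff.
have hf_ n : L1 D (f_ n) by exact: (L1_le mD (mf_ n) (fg n) hg).
have H := @dominated_convergence _ _ R mu D mD
  (fun n => EFin \o f_ n) (EFin \o f) (EFin \o g).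
have [| | | | |hf _ C] := H.
- by move=> n; exact/measurable_EFinP.
- exact/measurable_EFinP.
- by apply: aeW => x Dx; apply: cvg_EFin; [exact: nearW|exact: ff].
- exact: hg.
- by apply: aeW => x n Dx /=; rewrite lee_fin; exact: fg.
suff C' : (fun n => (rint D (f_ n))%:E) @ \oo --> (rint D f)%:E.
  exact: (fine_cvg C').
rewrite -rint_EFin//; under eq_fun do rewrite -rint_EFin//.
exact: C.
Qed.

Lemma cont_bounded a b f : (forall x, a <= x <= b -> {for x, continuous f}) ->
  exists2 M : R, 0 <= M & forall x, a <= x <= b -> `|f x| <= M.
Proof.
have [ab|ba] := leP a b; last first.
  move=> _; exists 0 => // x /andP[ax xb]; exfalso.
  by move: (lt_le_trans ba (le_trans ax xb)); rewrite ltxx.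
move=> cf; have cn : {within `[a, b], continuous (fun x => `|f x|)}.
  apply: continuous_in_within => x /=; rewrite in_itv/= => xab.
  apply: continuous_comp; first exact: cf.
  exact: norm_continuous.
have [c cab cM] := EVT_max ab cn.
by exists `|f c| => // x xab; apply: cM; rewrite in_itv.
Qed.

Definition supp c d eta := forall x, ~~ (c < x < d) -> eta x = 0.

(** Smoothness is required on the whole line, not only on [I], so that a test function on one of the
    intervals (0, 1), (1, oo) is at once a smooth function on the other, where it is zero. *)
Definition test I eta := smooth setT eta /\
  exists c d, [/\ I c, I d, c <= d & supp c d eta].

Lemma suppW c d c' d' eta : c' <= c -> d <= d' -> supp c d eta -> supp c' d' eta.
Proof.
move=> cc dd se x xn; apply: se; apply: contra xn => /andP[cx xd].
by rewrite (le_lt_trans cc)//= (lt_le_trans xd).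
Qed.

Lemma supp_left c d eta x : supp c d eta -> x <= c -> eta x = 0.
Proof. by move=> se xc; apply: se; rewrite ltNge xc. Qed.

Lemma supp_right c d eta x : supp c d eta -> d <= x -> eta x = 0.
Proof. by move=> se xc; apply: se; rewrite [X in _ && X]ltNge xc andbF. Qed.

(** The support stays in [c, d] while the flanks steepen with n: the bumps converge pointwise to the
    indicator of ]c, d[. *)
Definition bump (n : nat) c d x : R :=
  step (n%:R * (x - c)) * step (n%:R * (d - x)).

Lemma smooth_bump n c d : smooth setT (bump n c d).
Proof.
have h (u : R -> R) : smooth setT u -> smooth setT (fun x => step (u x)).
  by move=> su; exact: (@smooth_comp _ setT setT u (@step R) openT openT (fun _ _ => I) su (@smooth_step R)).
have hc e := smooth_cst (c := e) (@openT R).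
have hi := smooth_id (@openT R).
exact: (smoothM openT (h _ (smoothZ openT (smoothB openT hi (hc c))))
  (h _ (smoothZ openT (smoothB openT (hc d) hi)))).
Qed.

Lemma bump_supp n c d : supp c d (bump n c d).
Proof.
move=> x; rewrite negb_and -!leNgt /bump => /orP[xc|dx].
  by rewrite step_le0 ?mul0r// mulr_ge0_le0// subr_le0.
by rewrite mulrC step_le0 ?mul0r// mulr_ge0_le0// subr_le0.
Qed.

Lemma bump_ge0 n c d x : 0 <= bump n c d x.
Proof. by rewrite mulr_ge0 ?step_ge0. Qed.

Lemma bump_le1 n c d x : bump n c d x <= 1.
Proof. by rewrite mulr_ile1 ?step_ge0 ?step_le1. Qed.

Lemma bump_cvg c d x : c < x < d -> \forall n \near \oo, bump n c d x = 1.
Proof.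
move=> /andP[cx xd].
have h (e : R) : 0 < e -> \forall n \near \oo, step (n%:R * e) = 1.
  move=> e0; near=> n; apply: step_ge1.
  rewrite -ler_pdivrMr// mul1r; near: n; exact: nbhs_infty_ger.
have xc0 : 0 < x - c by rewrite subr_gt0.
have dx0 : 0 < d - x by rewrite subr_gt0.
by apply: filterS2 (h _ xc0) (h _ dx0) => n e1 e2; rewrite /bump e1 e2 mulr1.
Unshelve. all: by end_near. Qed.

Lemma smooth_meas D f : smooth setT f -> mfun D f.
Proof.
move=> sf; have cf : continuous (f : R -> R).
  by move=> x; exact: (@smooth_continuous R setT f x sf Logic.I).
apply: (measurable_funS measurableT) => //; exact: continuous_measurable_fun.
Qed.

Section Interval.
Variable I : set R.
Hypotheses (oI : open I) (iI : is_interval I).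
(** An exhaustion of [I] by compact intervals: a property that holds almost everywhere on each of
    them holds almost everywhere on [I], by countability. *)
Variables (c_ d_ : nat -> R).
Hypotheses (Ic : forall n, I (c_ n)) (Id : forall n, I (d_ n)).
Hypothesis exI : forall x, I x -> \forall n \near \oo, c_ n < x < d_ n.

Let mI : meas I. Proof. exact: open_measurable. Qed.

Lemma test_hull eta zeta : test I eta -> test I zeta ->
  exists c d, [/\ I c, I d, c <= d, supp c d eta & supp c d zeta].
Proof.
move=> [_ [c [d [c1 d1 cd se]]]] [_ [c' [d' [c1' d1' cd' sz]]]].
exists (Num.min c c'), (Num.max d d'); split.
- by rewrite minEle; case: ifP.
- by rewrite maxEle; case: ifP.
- by rewrite ge_min le_max cd.
- by apply: suppW se; rewrite ?ge_min ?le_max lexx.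
- by apply: suppW sz; rewrite ?ge_min ?le_max lexx orbT.
Qed.

Lemma test_lin eta zeta e : test I eta -> test I zeta ->
  test I (fun x => eta x - e * zeta x).
Proof.
move=> he hz; have [c [d [hc hd cd se sz]]] := test_hull he hz.
split; first by apply: (smoothB openT); [exact: he.1|apply: (smoothZ openT); exact: hz.1].
by exists c, d; split => // x xn; rewrite se// sz// mulr0 subr0.
Qed.

Lemma test_bump n c d : I c -> I d -> c <= d -> test I (bump n c d).
Proof.
by move=> hc hd cd; split; [exact: smooth_bump|exists c, d; split => //; exact: bump_supp].
Qed.

Lemma test_cont eta x : test I eta -> {for x, continuous eta}.
Proof. by move=> [s _]; exact: (smooth_continuous s). Qed.

Lemma test_bounded eta : test I eta -> exists2 M : R, 0 <= M & forall x, `|eta x| <= M.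
Proof.
move=> te; have [_ [c [d [_ _ cd se]]]] := te.
have [M M0 hM] := @cont_bounded c d eta (fun x _ => test_cont (x := x) te).
exists M => // x; have [xcd|xn] := boolP (c <= x <= d); first exact: hM.
rewrite se ?normr0//; apply: contra xn => /andP[? ?]; by rewrite !ltW.
Qed.

Lemma L1_test eta k : test I eta -> L1loc I k -> L1 I (fun x => eta x * k x).
Proof.
move=> te hk; have [_ [c [d [hc hd cd se]]]] := te.
have [M M0 hM] := test_bounded te.
apply: (@L1_supp _ `[c, d]) => //.
- exact: itv_sub.
- move=> x _; rewrite /= in_itv/= => xn; rewrite se ?mul0r//.
  by apply/negP => /andP[? ?]; apply: xn; rewrite !ltW.
- apply: (@L1M _ _ _ _ M) => //; last exact: hk.
  apply: L1_meas => //; apply: L1_cont => x _; exact: test_cont te.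
Qed.

Lemma rint_test eta k c d : I c -> I d -> supp c d eta ->
  rint I (fun x => eta x * k x) = rint `[c, d] (fun x => eta x * k x).
Proof.
move=> hc hd se; apply: rint_supp; first exact: itv_sub.
move=> x _; rewrite /= in_itv/= => xn; rewrite se ?mul0r//.
by apply/negP => /andP[? ?]; apply: xn; rewrite !ltW.
Qed.

(** Lebesgue's differentiation theorem: the indefinite integral of [k] vanishes on [c_n, d_n], and
    its derivative is [k] almost everywhere there. *)
Lemma ae_zero k : L1loc I k ->
  (forall c d, I c -> I d -> c < d -> rint `[c, d] k = 0) ->
  {ae mu, forall x, I x -> k x = 0}.
Proof.
move=> hk k0.
have h n : {ae mu, forall x, c_ n < x < d_ n -> k x = 0}.
  pose f := k \_ `[c_ n, d_ n].
  have hf : L1 setT f.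
    rewrite /L1 /f -restrict_EFin; apply/integrable_restrict => //.
    by rewrite setTI; exact: hk.
  have hfy y : L1 `[c_ n, y] f by exact: (L1S _ _ _ hf).
  have lf : locally_integrable setT f.
    have := @integrable_locally _ k `[c_ n, d_ n] _ _; apply => //.
    exact: hk.
  have := FTC1 (a := BLeft (c_ n)) hfy lf.
  apply: (@filterS _ _ (ae_filter_ringOfSetsType mu)) => x H /andP[cx xd].
  have H0 : ((c_ n)%:E < x%:E)%E by rewrite lte_fin.
  pose F y := rint `[c_ n, y] f.
  have F' : derive1 F x = f x := (H H0).2.
  have : derive1 F x = 0.
    rewrite (@derive1_eq_on _ `]c_ n, d_ n[ F (fun=> 0))//.
    - exact: (is_derive_derive1 (is_derive_c 0 x)).
    - move=> y /=; rewrite in_itv/= => /andP[cy yd].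
      rewrite -(k0 (c_ n) y) ?/F//; last first.
        by apply: (iI (Ic n) (Id n)); rewrite !ltW.
      apply: rint_eq => z /=; rewrite in_itv/= => /andP[cz zy].
      by rewrite /f patchE mem_set//= in_itv/= cz (le_trans zy)// ltW.
    - by rewrite /= in_itv/= cx xd.
  by rewrite F' /f patchE mem_set//= in_itv/= !ltW.
have := ae_foralln h.
apply: (@filterS _ _ (ae_filter_ringOfSetsType mu)) => x H Ix.
by have [n _ /(_ n (leqnn n))] := exI Ix; exact: H.
Qed.

(** Testing with the bumps on [c, d] and letting them converge to the indicator shows that all
    integrals of [k] over intervals vanish. *)
Lemma fundamental_lemma k : L1loc I k ->
  (forall eta, test I eta -> rint I (fun x => eta x * k x) = 0) ->
  {ae mu, forall x, I x -> k x = 0}.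
Proof.
move=> hk H; apply: ae_zero => // c d hc hd cd.
have hcd : L1 `[c, d] k := hk _ _ hc hd.
have sub : `]c, d[ `<=` `[c, d] by exact: subset_itv_oo_cc.
have ho : L1 `]c, d[ k by exact: (L1S _ _ sub hcd).
have mk := L1_meas (measurable_itv _) ho.
have E : rint `[c, d] k = rint `]c, d[ k.
  rewrite /rint -Rintegral_itv_obnd_cbnd; last first.
    by apply: L1S hcd => //; exact: subset_itv_oc_cc.
  by rewrite Rintegral_itv_bndo_bndc.
have C : rint `]c, d[ (fun x => bump n c d x * k x) @[n --> \oo] --> rint `]c, d[ k.
  apply: (@rint_dominated `]c, d[ (fun n x => bump n c d x * k x) k (fun x => `|k x|)) => //.
  - move=> n; apply: measurable_funM => //.
    by apply: smooth_meas; exact: smooth_bump.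
  - exact: L1_norm.
  - move=> n x _; rewrite normrM ger0_norm ?bump_ge0//.
    by rewrite -[leRHS]mul1r ler_wpM2r// bump_le1.
  - move=> x /=; rewrite in_itv/= => xcd; apply: cvg_near_cst.
    have := bump_cvg xcd; apply: filterS => n ->; exact: mul1r.
have C0 : rint `]c, d[ (fun x => bump n c d x * k x) @[n --> \oo] --> (0 : R).
  apply: cvg_near_cst; apply: nearW => n.
  rewrite -(H (bump n c d)); last by apply: test_bump => //; exact: ltW.
  apply/esym/rint_supp.
    by apply: subset_trans sub _; exact: itv_sub.
  by move=> x _; rewrite /= in_itv/= => /negP xn; rewrite bump_supp// mul0r.
by rewrite E; exact: (cvg_unique _ C C0).
Qed.

End Interval.
End Tests.

(** * Weak solutions *)

Section Weak.
Variable R : realType.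
Notation mu := (@lebesgue_measure R).
Implicit Types (D : set R) (f g h k F G H eta zeta phi psi : R -> R) (a b c d x : R).

Variable I : set R.
Hypotheses (oI : open I) (iI : is_interval I).
Variables (c_ d_ : nat -> R).
Hypotheses (Ic : forall n, I (c_ n)) (Id : forall n, I (d_ n)).
Hypothesis exI : forall x, I x -> \forall n \near \oo, c_ n < x < d_ n.

Let mI : meas I. Proof. exact: open_measurable. Qed.

Lemma is_interval_setT : is_interval [set: R].
Proof. by []. Qed.

(** [f] may be arbitrary outside [I]: the line is covered by [I], where both factors are smooth, and
    by the complement of the support interval, where the product is zero. *)
Lemma test_mul f eta : smooth I f -> test I eta -> test I (fun x => f x * eta x).
Proof.
move=> sf [se [c [d [hc hd cd sp]]]]; split; last first.
  by exists c, d; split => // x xn; rewrite sp// mulr0.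
apply: (@smooth_setU _ I (~` `[c, d])).
- move=> x; have [xcd|xn] := pselect (`[c, d]%classic x); last by right.
  by left; exact: (itv_sub iI hc hd).
- apply: (smoothM oI sf); exact: (smooth_sub _ se).
- have oU : open (~` `[c, d]) by apply: closed_openC; exact: itv_closed.
  apply: (smooth_eq oU _ (smooth_cst (c := 0) oU)) => x /=.
  rewrite in_itv/= => xn; rewrite sp ?mulr0//.
  by apply/negP => /andP[? ?]; apply: xn; rewrite !ltW.
Qed.

Lemma rint0 D : rint D (fun=> 0 : R) = 0.
Proof. by rewrite /rint /Rintegral integral0. Qed.

(** The primitive that is zero to the left of the support equals the total integral to its right, so
    mean zero is what makes it a test function. *)
Lemma prim_test zeta : test I zeta -> rint I zeta = 0 ->
  exists2 psi, test I psi & forall x, is_derive x 1 psi (zeta x).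
Proof.
move=> tz z0; have [sz [c [d [hc hd cd sp]]]] := tz.
have cz x : [set: R] x -> {for x, continuous zeta}.
  by move=> _; exact: (test_cont tz).
have [F dF] := primC openT is_interval_setT cz.
have FE a b : a <= b -> rint `[a, b] zeta = F b - F a.
  by move=> ab; exact: (@FTC2I _ setT is_interval_setT zeta F a b).
have dpsi x : is_derive x 1 (fun y => F y - F c) (zeta x).
  have := is_deriveB' (dF x Logic.I) (is_derive_c (F c) x).
  by rewrite subr0.
exists (fun y => F y - F c) => //; split.
  by apply: (smooth_lift openT _ sz) => x _; exact: dpsi.
exists c, d; split => // x; rewrite negb_and -!leNgt => /orP[xc|dx].
  rewrite -[LHS]opprK opprB -FE// (rint_eq (g := fun=> 0)) ?rint0 ?oppr0// => y /=.
  by rewrite in_itv/= => /andP[_ yc]; exact: supp_left sp yc.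
rewrite -FE ?(le_trans cd)// (@rint_cat _ _ d)//; last first.
  by apply: L1_cont => y _; exact: cz.
rewrite [X in _ + X](rint_eq (g := fun=> 0)) ?rint0 ?addr0; last first.
  by move=> y /=; rewrite in_itv/= => /andP[dy _]; exact: supp_right sp dy.
rewrite -z0; apply/esym/rint_supp; first exact: (itv_sub iI hc hd).
move=> y _ /=; rewrite in_itv/= => xn; apply: sp.
by apply/negP => /andP[? ?]; apply: xn; rewrite !ltW.
Qed.

Lemma test_derive1 eta : test I eta -> test I (derive1 eta).
Proof.
move=> [se [c [d [hc hd cd sp]]]]; split; first exact: smooth_derive1.
(* The derivative is seen to vanish only where [eta] vanishes on a neighbourhood, so the support
   interval is widened inside [I]. *)
have [e e0 [ce _]] := open_pm oI hc; have [e' e0' [_ de]] := open_pm oI hd.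
exists (c - e), (d + e'); split => //.
  by rewrite lerBlDr (le_trans cd)// -addrA lerDl addr_ge0 ?ltW.
move=> x; rewrite negb_and -!leNgt => /orP[xc|dx].
  rewrite (@derive1_eq_on _ [set y | y < c] eta (fun=> 0)).
  - exact: (is_derive_derive1 (is_derive_c 0 x)).
  - exact: open_lt.
  - by move=> y /= yc; apply: (supp_left sp); exact: ltW.
  - by rewrite /= (le_lt_trans xc)// ltrBlDr ltrDl.
rewrite (@derive1_eq_on _ [set y | d < y] eta (fun=> 0)).
- exact: (is_derive_derive1 (is_derive_c 0 x)).
- exact: open_gt.
- by move=> y /= yc; apply: (supp_right sp); exact: ltW.
- by rewrite /= (lt_le_trans _ dx)// ltrDl.
Qed.

Lemma test_is_derive eta x : test I eta -> is_derive x 1 eta (derive1 eta x).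
Proof. by move=> [se _]; exact: (smooth_is_derive se). Qed.

Lemma L1loc_cst (k : R) : L1loc I (fun=> k).
Proof. by move=> c d _ _; apply: L1_cont => x _; exact: cst_continuous. Qed.

Lemma L1_test0 eta : test I eta -> L1 I eta.
Proof.
move=> te; apply: L1_eq (L1_test oI iI te (L1loc_cst 1)) => //.
by move=> x _; rewrite mulr1.
Qed.

(** If all test functions had integral zero, the fundamental lemma would make the constant 1 vanish
    almost everywhere. *)
Lemma test_unit : exists2 eta, test I eta & rint I eta = 1.
Proof.
suff [eta te i0] : exists2 eta, test I eta & rint I eta != 0.
  exists (fun x => (rint I eta)^-1 * eta x); last first.
    by rewrite rintZ// ?mulVf//; exact: L1_test0.
  apply: test_mul => //; exact: smooth_cst.
apply: contrapT => H.
have H1 := fundamental_lemma iI Ic Id exI (L1loc_cst 1).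
have {}H1 : {ae mu, forall x, I x -> (1 : R) = 0}.
  apply: H1 => eta te; apply: contrapT => /eqP h; apply: H; exists eta => //.
  by rewrite (rint_eq (g := fun x => eta x * 1))// => x _; rewrite mulr1.
have [e e0 [cI dI]] := open_pm oI (Ic 0%N); set c := c_ 0%N in cI dI.
have ced : c - e <= c + e by rewrite lerD2l ge0_cp// ltW.
have : rint `[c - e, c + e] (fun=> 1 : R) = 0.
  rewrite -(rint0 `[c - e, c + e]); apply: rint_ae => //.
  apply: (@filterS _ _ (ae_filter_ringOfSetsType mu) _ _ _ H1) => x h xcd.
  by apply: h; exact: (itv_sub iI cI dI xcd).
rewrite (@FTC2 _ _ (fun x => x))//.
  by lra.
by move=> x _; exact: cst_continuous.
Qed.

(** Subtracting its integral times [eta0] gives any test function mean zero, hence makes it the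
    derivative of another one; this shows that [k - kap] is orthogonal to all test functions. *)
Lemma du_bois_reymond k : L1loc I k ->
  (forall psi, test I psi -> rint I (fun x => derive1 psi x * k x) = 0) ->
  exists kappa, {ae mu, forall x, I x -> k x = kappa}.
Proof.
move=> hk H; have [eta0 te0 i0] := test_unit.
exists (rint I (fun x => eta0 x * k x)); set kap := rint I _.
suff : {ae mu, forall x, I x -> k x - kap = 0}.
  apply: (@filterS _ _ (ae_filter_ringOfSetsType mu)) => x h Ix.
  by apply/eqP; rewrite -subr_eq0 h.
have hkk : L1loc I (fun x => k x - kap).
  by move=> c d hc hd; apply: L1B => //; [exact: hk|exact: L1loc_cst].
apply: (fundamental_lemma iI Ic Id exI hkk) => eta te.
have l1 := L1_test oI iI te hk.
have l2 := L1_test0 te.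
have l3 := L1_test oI iI te0 hk.
have l4 := L1_test0 te0.
pose zeta x := eta x - rint I eta * eta0 x.
have tz : test I zeta by exact: test_lin.
have z0 : rint I zeta = 0.
  by rewrite /zeta rintB//; [rewrite rintZ// i0 mulr1 subrr|exact: L1Z].
have [psi tp dp] := prim_test tz z0.
have := H psi tp; rewrite (rint_eq (g := fun x => eta x * k x - rint I eta * (eta0 x * k x))); last first.
  by move=> x _; rewrite (is_derive_derive1 (dp x)) /zeta; ring.
rewrite rintB//; last exact: L1Z.
rewrite rintZ// -/kap => E.
rewrite (rint_eq (g := fun x => eta x * k x - kap * eta x)); last by move=> x _; ring.
by rewrite rintB//; [rewrite rintZ// mulrC|exact: L1Z].
Qed.

Lemma ibp_test eta H h : test I eta -> (forall x, I x -> is_derive x 1 H (h x)) ->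
  (forall x, I x -> {for x, continuous h}) ->
  rint I (fun x => eta x * h x) = - rint I (fun x => derive1 eta x * H x).
Proof.
move=> te dH ch; have td := test_derive1 te.
have cH x : I x -> {for x, continuous H} by move=> /dH /is_derive_continuous.
have [c [d [hc hd cd s1 s2]]] := test_hull te td.
rewrite (rint_test iI _ hc hd s1) (rint_test iI _ hc hd s2).
have sub := itv_sub iI hc hd.
have l1 : L1 `[c, d] (fun x => eta x * h x).
  apply: L1_cont => x xcd; apply: continuousM; first exact: test_cont te.
  by apply: ch; apply: sub; rewrite /= in_itv.
have l2 : L1 `[c, d] (fun x => derive1 eta x * H x).
  apply: L1_cont => x xcd; apply: continuousM; first exact: test_cont td.
  by apply: cH; apply: sub; rewrite /= in_itv.
apply/eqP; rewrite -addr_eq0 -rintD//; apply/eqP.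
transitivity (eta d * H d - eta c * H c); last first.
  by rewrite (supp_left (x := c) s1)// (supp_right (x := d) s1)// !mul0r subrr.
apply: (@FTC2 _ _ (fun x => eta x * H x)) => //.
- move=> x xcd; apply: (is_derive_cong (is_deriveM' (test_is_derive x te) (dH x _))).
    by apply: sub; rewrite /= in_itv.
  exact: addrC.
- move=> x xcd; have Ix : I x by apply: sub; rewrite /= in_itv.
  apply: continuousD; apply: continuousM.
  + exact: test_cont te.
  + exact: ch.
  + exact: test_cont td.
  + exact: cH.
Qed.

End Weak.

(** * Regularity of weak solutions *)

Section Regularity.
Variable R : realType.
Notation mu := (@lebesgue_measure R).
Implicit Types (D : set R) (f g h k F G H P Q eta zeta phi psi : R -> R) (a b c d x : R).

Variable I : set R.
Hypotheses (oI : open I) (iI : is_interval I).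
Variables (c_ d_ : nat -> R).
Hypotheses (Ic : forall n, I (c_ n)) (Id : forall n, I (d_ n)).
Hypothesis exI : forall x, I x -> \forall n \near \oo, c_ n < x < d_ n.

Let mI : meas I. Proof. exact: open_measurable. Qed.

Lemma le_cvg0 (S A : R) (e_ : nat -> R) : e_ n @[n --> \oo] --> 0 ->
  (forall n, `|S| <= A * e_ n) -> S = 0.
Proof.
move=> e0 SA; apply/normr0_eq0/eqP; rewrite eq_le normr_ge0 andbT.
have C : A * e_ n @[n --> \oo] --> A * 0 by apply: cvgMr.
rewrite -[leRHS](mulr0 A).
apply: (ler_cvg_to (cvg_cst _) C); exact: nearW.
Qed.

(** Since [g] is only integrable, [G] need not be differentiable everywhere. On the support interval
    [g] is approximated in mean by continuous functions, whose primitives then converge uniformly to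
    [G]. *)
Lemma ibp_L1 eta g G : test I eta -> L1loc I g ->
  (forall c d, I c -> I d -> c <= d -> G d - G c = rint `[c, d] g) ->
  rint I (fun x => eta x * g x) = - rint I (fun x => derive1 eta x * G x).
Proof.
move=> te hg GE; have td := test_derive1 oI te.
have cG := primL1_continuous oI iI hg GE.
have [c [d [hc hd cd s1 s2]]] := test_hull te td.
rewrite (rint_test iI _ hc hd s1) (rint_test iI _ hc hd s2).
have sub := itv_sub iI hc hd.
have mE : meas (`[c, d]%classic : set R) by exact: measurable_itv.
have [M M0 hM] := test_bounded te; have [M' M0' hM'] := test_bounded td.
have lg : L1 `[c, d] g by exact: hg.
have muE : (mu `[c, d] < +oo)%E.
  by rewrite lebesgue_measure_itv/=; case: ifP => _; rewrite -?EFinB ltry.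
have [g_ [cg_ ig_ eg_]] := approximation_continuous_integrable mE muE lg.
have lgn n : L1 `[c, d] (g_ n) by exact: ig_.
have ldn n : L1 `[c, d] (fun x => g x - g_ n x) by exact: L1B.
have lnn n : L1 `[c, d] (fun x => `|g x - g_ n x|) by exact: (L1_norm (ldn n)).
pose e_ n := rint `[c, d] (fun x => `|g x - g_ n x|).
have e_ge0 n : 0 <= e_ n by apply: rint_ge0 => x _; exact: normr_ge0.
have e_cvg : e_ n @[n --> \oo] --> 0.
  suff C : (fun n => (e_ n)%:E) @ \oo --> (0 : R)%:E by exact: (fine_cvg C).
  have -> : (fun n => (e_ n)%:E) =
    (fun n => \int[mu]_(z in `[c, d]) `|(g z - g_ n z)%:E|)%E.
    by apply/funext => n; rewrite /e_ -rint_EFin.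
  exact: eg_.
have mt zeta : test I zeta -> mfun `[c, d] zeta by move=> [sz _]; exact: smooth_meas.
have lM zeta k : test I zeta -> L1 `[c, d] k -> L1 `[c, d] (fun x => zeta x * k x).
  move=> tz hk; have [N N0 hN] := test_bounded tz.
  by apply: (@L1M _ _ _ _ N) => //; exact: mt.
have lG : L1 `[c, d] G.
  by apply: L1_cont => x xcd; apply: cG; apply: sub; rewrite /= in_itv.
apply/eqP; rewrite -addr_eq0; apply/eqP.
(* The identity holds exactly for [g_ n]. The bound M on |eta| multiplies the error of g in mean;
   the bound M' on |eta'| multiplies the uniform error of G, integrated over the length d - c. *)
apply: (@le_cvg0 _ (M + M' * (d - c)) e_ e_cvg) => n.
have cgn x : [set: R] x -> {for x, continuous (g_ n)} by move=> _; exact: cg_.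
have [Pn dPn] := primC openT (@is_interval_setT R) cgn.
pose Gn x := Pn x - Pn c + G c.
have dGn x : is_derive x 1 Gn (g_ n x).
  have := is_deriveD' (is_deriveB' (dPn x Logic.I) (is_derive_c (Pn c) x)) (is_derive_c (G c) x).
  by rewrite subr0 addr0.
have cGn x : {for x, continuous Gn} := is_derive_continuous (dGn x).
have lGn : L1 `[c, d] Gn by apply: L1_cont.
have E0 : rint `[c, d] (fun x => eta x * g_ n x) +
          rint `[c, d] (fun x => derive1 eta x * Gn x) = 0.
  apply/eqP; rewrite addr_eq0; apply/eqP.
  rewrite -(rint_test iI _ hc hd s1) -(rint_test iI _ hc hd s2).
  exact: (ibp_test oI iI te (fun x _ => dGn x) (fun x _ => cgn x Logic.I)).
rewrite -[X in `|X|]subr0 -[in X in _ - X]E0 opprD addrACA -!rintB//;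
  do ?exact: lM.
have GGn x : c <= x <= d -> `|G x - Gn x| <= e_ n.
  move=> /andP[cx xd].
  have Ix : I x by apply: sub; rewrite /= in_itv/= cx.
  have sx : `[c, x] `<=` `[c, d] by exact: subset_itvScc.
  have sx' : `[x, d] `<=` `[c, d] by exact: subset_itvScc.
  have -> : G x - Gn x = rint `[c, x] (fun t => g t - g_ n t).
    rewrite rintB//; [|by apply: (L1S _ _ sx)|by apply: (L1S _ _ sx)].
    rewrite -GE// (@FTC2I _ setT (@is_interval_setT R) _ Pn)// /Gn; ring.
  apply: (@le_trans _ _ (rint `[c, x] (fun t => `|g t - g_ n t|))).
    by apply: rint_norm => //; exact: (L1S _ _ sx).
  rewrite /e_ (rint_cat cx xd)// lerDl; apply: rint_ge0 => t _; exact: normr_ge0.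
apply: le_trans (ler_normD _ _) _; rewrite mulrDl; apply: lerD.
  rewrite -rintZ//; apply: rint_norm => //.
  - by apply: L1B => //; exact: lM.
  - exact: L1Z.
  - by move=> x _; rewrite -mulrBr normrM ler_wpM2r.
rewrite mulrAC; have -> : M' * e_ n * (d - c) = rint `[c, d] (fun=> M' * e_ n).
  rewrite mulrBr; apply/esym.
  apply: (@FTC2 _ (fun=> M' * e_ n) (fun x => M' * e_ n * x) c d cd).
  - by move=> x _; apply: (is_derive_cong (is_deriveZ' (M' * e_ n) (is_derive_x x))); rewrite mulr1.
  - by move=> x _; exact: cst_continuous.
apply: rint_norm => //.
- by apply: L1B => //; exact: lM.
- by apply: L1_cont => x _; exact: cst_continuous.
- move=> x /=; rewrite in_itv/= => xcd; rewrite -mulrBr normrM.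
  by rewrite ler_pM// GGn.
Qed.

(** With G' = g, H' = G / P and Q' = 1 / P, the equation says weakly that (P (y - H)')' = 0, so y -
    H must be a constant plus a multiple of Q. To reach the lemma of du Bois-Reymond an arbitrary
    [psi] must be written as P phi' with [phi] a test function; this is possible after subtracting a
    multiple of one fixed function [psi0], and the defect K caused by [psi0] is the coefficient of
    Q. *)
Theorem weak_regularity P y g : smooth I P -> (forall x, I x -> P x != 0) ->
  L1loc I y -> L1loc I g ->
  (forall phi, test I phi ->
    rint I (fun x => derive1 (fun t => P t * derive1 phi t) x * y x) =
    rint I (fun x => phi x * g x)) ->
  exists Y q : R -> R,
    [/\ forall x, I x -> is_derive x 1 Y (q x / P x),
        forall c d, I c -> I d -> c <= d -> q d - q c = rint `[c, d] g,
        forall x, I x -> {for x, continuous q} &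
        {ae mu, forall x, I x -> y x = Y x}].
Proof.
move=> sP coef01 hy hg weak.
have sV := smoothV oI coef01 sP.
have [G GE] := primL1 hg.
have cG := primL1_continuous oI iI hg GE.
have cV x : I x -> {for x, continuous (fun t => (P t)^-1)}.
  by move=> Ix; exact: (smooth_continuous sV).
have cGP x : I x -> {for x, continuous (fun t => G t / P t)}.
  by move=> Ix; apply: continuousM; [exact: cG|exact: cV].
have [H dH] := primC oI iI cGP.
have [Q dQ] := primC oI iI cV.
have [eta0 te0 i0] := test_unit oI iI Ic Id exI.
pose psi0 x := P x * eta0 x.
have tp0 : test I psi0 by exact: test_mul.
have lH : L1loc I H.
  by apply: (L1loc_cont iI) => x Ix; exact: (is_derive_continuous (dH x Ix)).
have lQ : L1loc I Q.
  by apply: (L1loc_cont iI) => x Ix; exact: (is_derive_continuous (dQ x Ix)).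
have lyH : L1loc I (fun x => y x - H x).
  by move=> c d hc hd; apply: L1B => //; [exact: hy|exact: lH].
have LT := L1_test oI iI.
pose K := rint I (fun x => derive1 psi0 x * (y x - H x)).
have [| |kap hkap] := @du_bois_reymond _ I oI iI c_ d_ Ic Id exI (fun x => y x - H x + K * Q x).
- move=> c d hc hd; apply: L1D => //; first exact: lyH.
  by apply: L1Z => //; exact: lQ.
- move=> psi tp.
  (* Since psi0 / P = eta0 has integral 1, this choice makes zeta / P of mean zero, hence some
     phi'. *)
  pose A := rint I (fun x => psi x * (P x)^-1).
  pose zeta x := psi x - A * psi0 x.
  have tz : test I zeta by exact: test_lin.
  pose zP x := (P x)^-1 * zeta x.
  have tzP : test I zP by exact: test_mul.
  have lpV : L1 I (fun x => psi x * (P x)^-1) by apply: LT => //; exact: L1loc_cont.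
  have zP0 : rint I zP = 0.
    rewrite (rint_eq (g := fun x => psi x * (P x)^-1 - A * eta0 x)); last first.
      by move=> x Ix; rewrite /zP /zeta /psi0; field; exact: coef01.
    rewrite rintB//; [|apply: L1Z => //];
      do ?exact: (L1_test0 oI iI te0).
    by rewrite rintZ//; [rewrite i0 mulr1 subrr|exact: (L1_test0 oI iI te0)].
  have [phi tphi dphi] := prim_test iI tzP zP0.
  have Pphi x : I x -> P x * derive1 phi x = zeta x.
    by move=> Ix; rewrite (is_derive_derive1 (dphi x)) /zP mulrA divff ?mul1r// coef01.
  have := weak phi tphi.
  rewrite (rint_eq (g := fun x => derive1 zeta x * y x)); last first.
    by move=> x Ix; rewrite (derive1_eq_on oI Pphi).
  rewrite (ibp_L1 tphi hg GE).
  rewrite [in RHS](rint_eq (g := fun x => zeta x * (G x / P x))); last first.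
    by move=> x Ix; rewrite (is_derive_derive1 (dphi x)) /zP; ring.
  rewrite (ibp_test oI iI tz dH cGP) opprK => E1.
  have tdz := test_derive1 oI tz.
  have tdp := test_derive1 oI tp.
  have tdp0 := test_derive1 oI tp0.
  have E2 : rint I (fun x => derive1 zeta x * (y x - H x)) = 0.
    rewrite (rint_eq (g := fun x => derive1 zeta x * y x - derive1 zeta x * H x)).
      by rewrite rintB//; [rewrite E1 subrr|exact: LT|exact: LT].
    by move=> x _; ring.
  have dz x : derive1 zeta x = derive1 psi x - A * derive1 psi0 x.
    exact: (is_derive_derive1 (is_deriveB' (test_is_derive x tp)
             (is_deriveZ' A (test_is_derive x tp0)))).
  have E3 : rint I (fun x => derive1 psi x * (y x - H x)) = A * K.
    move: E2; rewrite (rint_eq (g := fun x => derive1 psi x * (y x - H x)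
        - A * (derive1 psi0 x * (y x - H x)))); last first.
      by move=> x _; rewrite dz; ring.
    rewrite rintB//; [|exact: LT|by apply: L1Z => //; exact: LT].
    rewrite rintZ//; last exact: LT.
    by move=> /eqP; rewrite subr_eq0 => /eqP.
  rewrite (rint_eq (g := fun x => derive1 psi x * (y x - H x) + K * (derive1 psi x * Q x))); last first.
    by move=> x _; ring.
  rewrite rintD//; [|exact: LT|by apply: L1Z => //; exact: LT].
  rewrite rintZ//; last exact: LT.
  rewrite E3 /A (ibp_test oI iI tp dQ cV); ring.
exists (fun x => H x - K * Q x + kap), (fun x => G x - K); split.
- move=> x Ix.
  apply: (is_derive_cong (is_deriveD' (is_deriveB' (dH x Ix)
    (is_deriveZ' K (dQ x Ix))) (is_derive_c kap x))).
  by rewrite mulrBl addr0.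
- by move=> c d hc hd cd; rewrite -GE//; ring.
- move=> x Ix; apply: continuousB; [exact: cG|exact: cst_continuous].
- apply: (@filterS _ _ (ae_filter_ringOfSetsType mu) _ _ _ hkap) => x h Ix.
  by rewrite -(h Ix); ring.
Qed.

End Regularity.

(** * The two intervals and integrals of powers *)

Section PowerIntegrals.
Variable R : realType.
Notation mu := (@lebesgue_measure R).
Implicit Types (D I : set R) (f g h F : R -> R) (a b c d x K s : R).

Lemma cont_meas I f : open I -> (forall x, I x -> {for x, continuous f}) -> mfun I f.
Proof.
move=> oI cf; apply: open_continuous_measurable_fun => // x /set_mem; exact: cf.
Qed.

(** Fatou's lemma for the truncations of [h], whose integrals are differences of values of [F], at
    most 2 K. *)
Lemma L1_primitive I (c_ d_ : nat -> R) h F K : open I -> is_interval I ->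
  (forall n, I (c_ n)) -> (forall n, I (d_ n)) ->
  (forall x, I x -> \forall n \near \oo, c_ n < x < d_ n) ->
  (forall x, I x -> is_derive x 1 F (h x)) ->
  (forall x, I x -> {for x, continuous h}) ->
  (forall x, I x -> 0 <= h x) -> (forall x, I x -> `|F x| <= K) -> L1 I h.
Proof.
move=> oI iI Ic Id exI dF ch h0 FK.
have mI : meas I by exact: open_measurable.
have mh := cont_meas oI ch.
apply/integrableP; split; first exact/measurable_EFinP.
have sub n : `[c_ n, d_ n] `<=` I := itv_sub iI (Ic n) (Id n).
pose f_ n x := (h \_ `[c_ n, d_ n]) x.
have mf n : mfun I (f_ n).
  have mi : meas (`[c_ n, d_ n]%classic : set R) by exact: measurable_itv.
  apply: (measurable_restrict h mi mI).1.
  by apply: measurable_funS mh => //; exact: subIsetl.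
have f0 n x : I x -> 0 <= f_ n x.
  by move=> Ix; rewrite /f_ patchE; case: ifP => // _; exact: h0.
have K0 : 0 <= K by apply: le_trans (FK _ (Ic 0%N)); exact: normr_ge0.
have b n : (\int[mu]_(x in I) (f_ n x)%:E <= (K + K)%:E)%E.
  have -> : (\int[mu]_(x in I) (f_ n x)%:E = \int[mu]_(x in `[c_ n, d_ n]) (h x)%:E)%E.
    rewrite -(setIidr (@sub n)) integral_mkcondr.
    by apply: eq_integral => x _; rewrite restrict_EFin.
  rewrite rint_EFin//; last by apply: (L1loc_cont iI ch).
  rewrite lee_fin; have [cd|dc] := leP (c_ n) (d_ n); last first.
    by rewrite rint_ge ?addr_ge0// ltW.
  rewrite (FTC2I iI _ _ cd dF ch)//; apply: lerD.
    by apply: le_trans (FK _ (Id n)); exact: ler_norm.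
  by apply: le_trans (FK _ (Ic n)); rewrite -normrN; exact: ler_norm.
have mf' n : measurable_fun (I : set (measurableTypeR R)) (EFin \o f_ n).
  exact/measurable_EFinP.
have f0' n x : I x -> (0 <= (EFin \o f_ n) x)%E.
  by move=> Ix; rewrite lee_fin; exact: f0.
have H := @fatou _ _ R mu I mI (fun n => EFin \o f_ n) mf' f0'.
apply: (@le_lt_trans _ _ (K + K)%:E); last exact: ltry.
apply: (@le_trans _ _ (limn_einf (fun n => \int[mu]_(x in I) (EFin \o f_ n) x)%E)).
  apply: le_trans H; rewrite le_eqVlt; apply/orP; left; apply/eqP.
  apply: eq_integral => x /set_mem Ix /=.
  have C : (EFin \o f_^~ x) n @[n --> \oo] --> (`|h x|)%:E.
    apply: cvg_near_cst; have := exI x Ix; apply: filterS => n /andP[cx xd] /=.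
    by rewrite /f_ patchE mem_set/= ?in_itv/= ?ltW// ger0_norm// h0.
  rewrite is_cvg_limn_einfE; last by apply/cvg_ex; exists (`|h x|)%:E.
  by apply/esym/cvg_lim.
rewrite limn_einf_lim; apply: lime_le; first exact: is_cvg_einfs.
apply: nearW => n; apply: le_trans (b n).
by apply: ereal_inf_lbound; exists n => //=.
Qed.

Definition I0 : set R := `]0, 1[%classic.
Definition I1 : set R := `]1, +oo[%classic.

Lemma I0E x : I0 x <-> 0 < x < 1. Proof. by rewrite /I0 /= in_itv. Qed.
Lemma I1E x : I1 x <-> 1 < x. Proof. by rewrite /I1 /= in_itv/= andbT. Qed.
Lemma I0_open : open I0. Proof. exact: interval_open. Qed.
Lemma I1_open : open I1. Proof. exact: interval_open. Qed.
Lemma I0_itv : is_interval I0. Proof. exact: interval_is_interval. Qed.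
Lemma I1_itv : is_interval I1. Proof. exact: interval_is_interval. Qed.
Lemma I0_meas : meas I0. Proof. exact: measurable_itv. Qed.
Lemma I1_meas : meas I1. Proof. exact: measurable_itv. Qed.

(* The intervals [c0 n, d0 n] and [c1 n, d1 n] exhaust (0, 1) and (1, oo); boundary values
   at 0, 1 and oo are limits along these end points. *)
Definition eps (n : nat) : R := n.+2%:R^-1.

Lemma eps_gt0 n : 0 < eps n. Proof. by rewrite invr_gt0 ltr0n. Qed.

Lemma eps_lt1 n : eps n < 1. Proof. by rewrite invf_lt1 ?ltr1n// ltr0n. Qed.

Lemma eps_cvg : eps n @[n --> \oo] --> 0.
Proof.
apply/cvgrPdist_lt => e e0; near=> n.
rewrite sub0r normrN gtr0_norm ?eps_gt0// /eps.
rewrite -[ltRHS]invrK ltf_pV2 ?posrE ?invr_gt0 ?ltr0n//.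
apply: (@le_lt_trans _ _ n%:R); last by rewrite ltr_nat ltnS leqnSn.
by near: n; exact: nbhs_infty_ger.
Unshelve. all: by end_near. Qed.

Lemma eps_near x : 0 < x -> \forall n \near \oo, eps n < x.
Proof. by move=> x0; have /cvgr_lt := eps_cvg; apply. Qed.

Definition c0 n := eps n.
Definition d0 n : R := 1 - eps n.
Definition c1 n := 1 + eps n.
Definition d1 (n : nat) : R := n.+2%:R.

Lemma I0c n : I0 (c0 n). Proof. by apply/I0E; rewrite eps_gt0 eps_lt1. Qed.
Lemma I0d n : I0 (d0 n).
Proof. by apply/I0E; rewrite /d0 subr_gt0 eps_lt1 ltrBlDr ltrDl eps_gt0. Qed.
Lemma I1c n : I1 (c1 n). Proof. by apply/I1E; rewrite ltrDl eps_gt0. Qed.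
Lemma I1d n : I1 (d1 n). Proof. by apply/I1E; rewrite /d1 ltr1n. Qed.

Lemma I0_ex x : I0 x -> \forall n \near \oo, c0 n < x < d0 n.
Proof.
move=> /I0E/andP[x0 x1].
have x1' : 0 < 1 - x by rewrite subr_gt0.
apply: filterS2 (eps_near x0) (eps_near x1') => n h1 h2.
by rewrite /c0 /d0 h1/= ltrBrDr addrC -ltrBrDr.
Qed.

Lemma I1_ex x : I1 x -> \forall n \near \oo, c1 n < x < d1 n.
Proof.
move=> /I1E x1; have x1' : 0 < x - 1 by rewrite subr_gt0.
near=> n; apply/andP; split; first by rewrite /c1 addrC -ltrBrDr; near: n; exact: eps_near.
apply: (@le_lt_trans _ _ n%:R); last by rewrite /d1 ltr_nat ltnS leqnSn.
by near: n; exact: nbhs_infty_ger.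
Unshelve. all: by end_near. Qed.

Lemma continuous_powR a x : 0 < x -> {for x, continuous (fun t => t `^ a)}.
Proof. by move=> x0; exact: (smooth_continuous (@smooth_powR R a)). Qed.

Lemma is_derive_powR_affine (e k a x : R) : 0 < e * x + k ->
  is_derive x 1 (fun t => (e * t + k) `^ a) (a * (e * x + k) `^ (a - 1) * e).
Proof.
move=> h.
have d1 : is_derive x 1 (fun t => e * t + k) e.
  apply: (is_derive_cong (is_deriveD' (is_deriveZ' e (is_derive_x x)) (is_derive_c k x))).
  by rewrite mulr1 addr0.
exact: (is_derive_comp (g := fun t => t `^ a) d1 (is_derive1_powR a h)).
Qed.

Lemma continuous_powR_affine (e k a x : R) : 0 < e * x + k ->
  {for x, continuous (fun t => (e * t + k) `^ a)}.
Proof. by move=> h; exact: (is_derive_continuous (is_derive_powR_affine a h)). Qed.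

Lemma powR_le1 a x : 0 <= a -> 0 <= x <= 1 -> x `^ a <= 1.
Proof.
move=> a0 /andP[x0 x1]; have <- : (1 : R) `^ a = 1 by rewrite powR1.
by apply: ge0_ler_powR => //; rewrite nnegrE.
Qed.

Lemma powR_ge1_le1 a x : a <= 0 -> 1 <= x -> x `^ a <= 1.
Proof. by move=> a0 x1; rewrite -(powRr0 x) ler_powR. Qed.

(** One statement for x^a (e = 1, k = 0) and for (1 - x)^a (e = -1, k = 1). *)
Lemma L1_I0_affine (e k a : R) : -1 < a -> e != 0 ->
  (forall x, I0 x -> 0 < e * x + k <= 1) -> L1 I0 (fun x => (e * x + k) `^ a).
Proof.
move=> a1 e0 h; have a10 : 0 < a + 1 by rewrite -ltrBlDr sub0r.
pose F x := ((a + 1) * e)^-1 * (e * x + k) `^ (a + 1).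
apply: (@L1_primitive I0 c0 d0 _ F `|((a + 1) * e)^-1| I0_open I0_itv I0c I0d I0_ex).
- move=> x /h/andP[h0 _].
  apply: (is_derive_cong (is_deriveZ' _ (is_derive_powR_affine (a + 1) h0))).
  by rewrite addrK; field; rewrite e0 gt_eqF.
- by move=> x /h/andP[h0 _]; exact: continuous_powR_affine.
- by move=> x _; exact: powR_ge0.
- move=> x /h/andP[h0 h1]; rewrite normrM ler_piMr// ger0_norm ?powR_ge0//.
  by apply: powR_le1; [exact: ltW|rewrite (ltW h0)].
Qed.

Lemma L1_I0_powR a : -1 < a -> L1 I0 (fun x => x `^ a).
Proof.
move=> a1; apply: (L1_eq (f := fun x => (1 * x + 0) `^ a)) => [|x _|].
- exact: I0_meas.
- by rewrite mul1r addr0.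
- apply: L1_I0_affine => // x /I0E /andP[x0 x1].
  by rewrite mul1r addr0 x0 ltW.
Qed.

Lemma L1_I0_powR1 a : -1 < a -> L1 I0 (fun x => (1 - x) `^ a).
Proof.
move=> a1; apply: (L1_eq (f := fun x => (-1 * x + 1) `^ a)) => [|x _|].
- exact: I0_meas.
- by rewrite mulN1r addrC.
- apply: L1_I0_affine => //.
  move=> x /I0E /andP[x0 x1].
  by rewrite mulN1r addrC subr_gt0 x1/= lerBlDr lerDl ltW.
Qed.

Lemma L1_I1_powR a : a < -1 -> L1 I1 (fun x => x `^ a).
Proof.
move=> a1; have a10 : a + 1 < 0 by rewrite -ltrBrDr sub0r.
pose F x := (a + 1)^-1 * x `^ (a + 1).
have x0 x : I1 x -> 0 < x by move=> /I1E; apply: lt_trans.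
apply: (@L1_primitive I1 c1 d1 _ F `|(a + 1)^-1| I1_open I1_itv I1c I1d I1_ex).
- move=> x /x0 h.
  apply: (is_derive_cong (is_deriveZ' _ (is_derive1_powR (a + 1) h))).
  by rewrite addrK mulrA mulVf ?mul1r// lt_eqF.
- by move=> x /x0 h; exact: continuous_powR.
- by move=> x _; exact: powR_ge0.
- move=> x /I1E h; rewrite normrM ler_piMr// ger0_norm ?powR_ge0//.
  by apply: powR_ge1_le1; exact: ltW.
Qed.

(** The exponent -a - 2 makes the integrand u^a u' for u = (x - 1) / x, so there is an explicit
    primitive, bounded because u lies in (0, 1]. *)
Lemma L1_I1_powR1 a : -1 < a -> L1 I1 (fun x => (x - 1) `^ a * x `^ (- a - 2)).
Proof.
move=> a1; have a10 : 0 < a + 1 by rewrite -ltrBlDr sub0r.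
have xp x : I1 x -> 0 < x by move=> /I1E; apply: lt_trans.
have ym x : I1 x -> 0 < x - 1 by move=> /I1E; rewrite subr_gt0.
pose u x : R := (x - 1) / x.
have u0 x : I1 x -> 0 < u x by move=> Ix; apply: divr_gt0; [exact: ym|exact: xp].
have u1 x : I1 x -> u x <= 1.
  by move=> Ix; rewrite ler_pdivrMr ?xp// mul1r lerBlDr lerDl.
have du x : I1 x -> is_derive x 1 u (x^-1 * x^-1).
  move=> Ix; have xn0 : x != 0 by rewrite gt_eqF// xp.
  apply: (is_derive_cong (is_deriveM' (is_deriveB' (is_derive_x x) (is_derive_c 1 x))
     (is_deriveV' xn0 (is_derive_x x)))).
  by field.
pose F x := (a + 1)^-1 * u x `^ (a + 1).
have E x : I1 x -> (x - 1) `^ a * x `^ (- a - 2) = u x `^ a * (x^-1 * x^-1).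
  move=> Ix; have h0 : 0 <= x by exact/ltW/xp.
  have h1 : 0 <= x - 1 by exact/ltW/ym.
  have h2 : 0 <= x^-1 by rewrite invr_ge0.
  rewrite /u powRM// -mulrA; congr (_ * _).
  rewrite -invfM -powR_inv1// -powRrM mulN1r.
  rewrite powRB; last by rewrite (gt_eqF (xp _ Ix)) implybT.
  by congr (_ / _); rewrite powR_mulrn.
have ch x : I1 x -> {for x, continuous (fun x => (x - 1) `^ a * x `^ (- a - 2))}.
  move=> Ix; apply: continuousM; last by apply: continuous_powR; exact: xp.
  have := @continuous_powR_affine 1 (-1) a x; rewrite mul1r => /(_ (ym _ Ix)).
  by under [X in {for _, continuous X}]eq_fun do rewrite mul1r.
apply: (@L1_primitive I1 c1 d1 _ F `|(a + 1)^-1| I1_open I1_itv I1c I1d I1_ex).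
- move=> x Ix; rewrite E//.
  have := is_derive_comp (g := fun t => t `^ (a + 1)) (du x Ix) (is_derive1_powR (a + 1) (u0 x Ix)).
  move=> h; apply: (is_derive_cong (is_deriveZ' _ h)).
  by rewrite addrK; field; rewrite (gt_eqF a10) (gt_eqF (xp _ Ix)).
- exact: ch.
- by move=> x _; rewrite mulr_ge0 ?powR_ge0.
- move=> x Ix; rewrite normrM ler_piMr// ger0_norm ?powR_ge0//.
  by apply: powR_le1; [exact: ltW|rewrite ltW ?u0 ?u1].
Qed.

End PowerIntegrals.

(** * Square integrability from pointwise bounds *)

Section WeightedSquare.
Variable R : realType.
Notation mu := (@lebesgue_measure R).
Implicit Types (D I : set R) (f g h u v w m : R -> R) (a b c d x K s : R).

Lemma powR_bounded a c d : 0 < c ->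
  exists2 K, 0 <= K & forall x, c <= x <= d -> x `^ a <= K.
Proof.
move=> c0; have [|K K0 hK] := @cont_bounded R c d (fun t => t `^ a).
  by move=> x /andP[cx _]; apply: continuous_powR; exact: lt_le_trans cx.
by exists K => // x /hK; apply: le_trans; exact: ler_norm.
Qed.

Lemma continuous_powR1m a x : x < 1 ->
  {for x, continuous (fun t : R => (1 - t) `^ a)}.
Proof.
move=> x1; have -> : (fun t : R => (1 - t) `^ a) = (fun t => (-1 * t + 1) `^ a).
  by apply/funext => t; rewrite mulN1r addrC.
by apply: continuous_powR_affine; rewrite mulN1r addrC subr_gt0.
Qed.

Lemma I0lt1 x : @I0 R x -> x < 1. Proof. by move=> /I0E/andP[]. Qed.
Lemma I0gt0 x : @I0 R x -> 0 < x. Proof. by move=> /I0E/andP[]. Qed.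
Lemma I1gt1 x : @I1 R x -> 1 < x. Proof. by move=> /I1E. Qed.
Lemma I1gt0 x : @I1 R x -> 0 < x. Proof. by move=> /I1E; apply: lt_trans. Qed.

(** On each half of (0, 1) one of the factors is bounded and the other integrable. *)
Lemma L1_I0_beta a b : -1 < a -> -1 < b ->
  L1 (@I0 R) (fun x => (1 - x) `^ a * x `^ b).
Proof.
move=> a1 b1; have h2 : (0 : R) < 2^-1 by rewrite invr_gt0.
have [Ka Ka0 hKa] := @powR_bounded a 2^-1 1 h2.
have [Kb Kb0 hKb] := @powR_bounded b 2^-1 1 h2.
apply: (@L1_le _ _ _ (fun x => Ka * x `^ b + Kb * (1 - x) `^ a)).
- exact: I0_meas.
- apply: cont_meas; first exact: I0_open.
  move=> x Ix; apply: continuousM.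
    by apply: continuous_powR1m; exact: I0lt1.
  by apply: continuous_powR; exact: I0gt0.
- move=> x /I0E/andP[x0 x1]; rewrite ger0_norm ?mulr_ge0 ?powR_ge0//.
  have [xh|xh] := leP x 2^-1.
    rewrite -[leLHS]addr0; apply: lerD; last by rewrite mulr_ge0 ?powR_ge0.
    by rewrite ler_wpM2r ?powR_ge0// hKa//; apply/andP; split; lra.
  rewrite -[leLHS]add0r; apply: lerD; first by rewrite mulr_ge0 ?powR_ge0.
  by rewrite mulrC ler_wpM2r ?powR_ge0// hKb//; apply/andP; split; lra.
- apply: L1D; [exact: I0_meas| |]; apply: L1Z; do ?exact: I0_meas.
    exact: L1_I0_powR.
  exact: L1_I0_powR1.
Qed.

Variables (alpha beta s : R).
Hypotheses (halpha : -1 < alpha < 1) (hbeta : -1 < beta).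
Hypothesis hs : 2 * s > alpha + beta + 1.
Notation w0 := (weight01 alpha beta).
Notation w1 := (weight1oo alpha beta).

(** The real form of [square_integrable], on open intervals, where the weights are smooth and
    positive; [square_integrableP] relates the two. *)
Definition weightedL2 f := [/\ mfun (@I0 R) f, mfun (@I1 R) f,
  L1 (@I0 R) (fun x => w0 x * f x ^+ 2) & L1 (@I1 R) (fun x => w1 x * f x ^+ 2)].

Lemma sqr_norm_le x K : `|x| <= K -> x ^+ 2 <= K ^+ 2.
Proof.
move=> xK; rewrite -real_normK ?num_real// lerXn2r// nnegrE//.
exact: le_trans xK.
Qed.

Lemma sqr_1D_le x : (1 + x) ^+ 2 <= 2 * (1 + x ^+ 2).
Proof. by rewrite -subr_ge0; have := sqr_ge0 (1 - x); rewrite !expr2; lra. Qed.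

Lemma near1_bound (K m y : R) : 0 <= K -> `|y| <= K * (1 + m) ->
  y ^+ 2 <= 2 * K ^+ 2 * (1 + m ^+ 2).
Proof.
move=> K0 /sqr_norm_le h; apply: le_trans h _.
rewrite exprMn [leRHS](_ : _ = K ^+ 2 * (2 * (1 + m ^+ 2))); last by ring.
by rewrite ler_wpM2l ?sqr_ge0// sqr_1D_le.
Qed.

(** Near 1 the weight turns |1 - x|^(-2 alpha) into |1 - x|^(-alpha), integrable as alpha < 1, and
    at infinity the exponent alpha + beta - 2 s is less than -1; between these zones [g] is
    continuous on compact intervals. *)
Lemma L2_of_bound g (e K M : R) : 0 < e -> 0 <= K ->
  (forall x, @I0 R x -> {for x, continuous g}) ->
  (forall x, @I1 R x -> {for x, continuous g}) ->
  (forall x, 0 < x < e -> `|g x| <= K) ->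
  (forall x, 1 - e < x < 1 -> `|g x| <= K * (1 + (1 - x) `^ (- alpha))) ->
  (forall x, 1 < x < 1 + e -> `|g x| <= K * (1 + (x - 1) `^ (- alpha))) ->
  (forall x, M < x -> `|g x| <= K * x `^ (- s)) ->
  weightedL2 g.
Proof.
move=> e0 K0 cg0 cg1 gl gm gr gi.
have mg0 := cont_meas (@I0_open R) cg0.
have mg1 := cont_meas (@I1_open R) cg1.
have /andP[al au] := halpha.
have mul_w (D : set R) (w h : R -> R) : mfun D w -> mfun D h ->
    mfun D (fun x => w x * h x ^+ 2).
  by move=> mw mh; apply: measurable_funM => //; exact: measurable_funX.
split => //.
- have [|K1 K10 hK1] := @cont_bounded R e (1 - e) g.
    move=> x /andP[x0 x1]; apply: cg0; apply/I0E; rewrite (lt_le_trans e0)//=.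
    by rewrite (le_lt_trans x1)// ltrBlDr ltrDl.
  pose A := K ^+ 2 + K1 ^+ 2 + 2 * K ^+ 2.
  have A0 : 0 <= A by rewrite /A; have := sqr_ge0 K; have := sqr_ge0 K1; lra.
  have bnd x : I0 x -> g x ^+ 2 <= A * (1 + ((1 - x) `^ (- alpha)) ^+ 2).
    move=> /I0E/andP[x0 x1]; set m := (1 - x) `^ (- alpha).
    have m0 := sqr_ge0 m.
    have h1 (B : R) : 0 <= B <= A -> g x ^+ 2 <= B * (1 + m ^+ 2) -> g x ^+ 2 <= A * (1 + m ^+ 2).
      move=> /andP[_ BA] /le_trans; apply; rewrite ler_wpM2r//; lra.
    have h2 (B : R) : 0 <= B -> B <= B * (1 + m ^+ 2).
      by move=> B0; rewrite ler_peMr// lerDl.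
    have k1 := sqr_ge0 K; have k2 := sqr_ge0 K1.
    have [xe|ex] := ltP x e.
      apply: (h1 (K ^+ 2)); first by rewrite k1 /A; lra.
      apply: le_trans (h2 _ k1); apply: sqr_norm_le; apply: gl; by rewrite x0.
    have [xe|xe] := leP x (1 - e).
      apply: (h1 (K1 ^+ 2)); first by rewrite k2 /A; lra.
      by apply: le_trans (h2 _ k2); apply: sqr_norm_le; apply: hK1; rewrite ex.
    apply: (h1 (2 * K ^+ 2)); first by rewrite /A; apply/andP; split; lra.
    by apply: near1_bound => //; apply: gm; rewrite xe.
  apply: (@L1_le _ _ _ (fun x => A * ((1 - x) `^ alpha * x `^ beta +
      (1 - x) `^ (- alpha) * x `^ beta))).
  + exact: I0_meas.
  + by apply: mul_w => //; exact: measurable_weight01.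
  + move=> x Ix; rewrite ger0_norm; last by apply: mulr_ge0; [exact: weight01_ge0|exact: sqr_ge0].
    apply: (@le_trans _ _ (w0 x * (A * (1 + ((1 - x) `^ (- alpha)) ^+ 2)))).
      by rewrite ler_wpM2l ?weight01_ge0// bnd.
    rewrite mulrCA ler_wpM2l// mulrDr mulr1 lerD2l /weight01 powRN expr2.
    have t0 : (1 - x) `^ alpha != 0 by rewrite gt_eqF// powR_gt0// subr_gt0 I0lt1.
    by rewrite mulrAC mulrA divff// mul1r.
  + apply: L1Z; first exact: I0_meas.
    by apply: L1D; [exact: I0_meas|apply: L1_I0_beta|apply: L1_I0_beta] => //; lra.
(* The 2 keeps (x - 1) / x in [1/2, 1] beyond M', where (x - 1)^alpha is then at most N3 x^alpha,
   whatever the sign of alpha. *)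
- pose M' := Num.max M 2.
  have M2 : 2 <= M' by rewrite /M' le_max lexx orbT.
  have [|K1 K10 hK1] := @cont_bounded R (1 + e) M' g.
    move=> x /andP[x0 x1]; apply: cg1; apply/I1E; rewrite (lt_le_trans _ x0)//.
    by rewrite ltrDl.
  pose A := K1 ^+ 2 + 2 * K ^+ 2.
  have A0 : 0 <= A by rewrite /A; have := sqr_ge0 K; have := sqr_ge0 K1; lra.
  have bnd x : I1 x -> x <= M' -> g x ^+ 2 <= A * (1 + ((x - 1) `^ (- alpha)) ^+ 2).
    move=> /I1E x1 xM; set m := (x - 1) `^ (- alpha).
    have m0 := sqr_ge0 m.
    have h1 (B : R) : 0 <= B <= A -> g x ^+ 2 <= B * (1 + m ^+ 2) -> g x ^+ 2 <= A * (1 + m ^+ 2).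
      move=> /andP[_ BA] /le_trans; apply; rewrite ler_wpM2r//; lra.
    have h2 (B : R) : 0 <= B -> B <= B * (1 + m ^+ 2).
      by move=> B0; rewrite ler_peMr// lerDl.
    have k1 := sqr_ge0 K; have k2 := sqr_ge0 K1.
    have [xe|ex] := ltP x (1 + e).
      apply: (h1 (2 * K ^+ 2)); first by rewrite /A; apply/andP; split; lra.
      by apply: near1_bound => //; apply: gr; rewrite x1.
    apply: (h1 (K1 ^+ 2)); first by rewrite k2 /A; lra.
    by apply: le_trans (h2 _ k2); apply: sqr_norm_le; apply: hK1; rewrite ex.
  (* On [1, M'] the factor x^beta is traded for x^(-alpha - 2) and for x^(alpha - 2), the companions
     of (x - 1)^alpha and (x - 1)^(-alpha) in [L1_I1_powR1]. *)
  have [N1 N10 hN1] := @powR_bounded (beta + (alpha + 2)) 1 M' ltr01.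
  have [N2 N20 hN2] := @powR_bounded (beta + (2 - alpha)) 1 M' ltr01.
  have h2 : (0 : R) < 2^-1 by rewrite invr_gt0.
  have [N3 N30 hN3] := @powR_bounded alpha 2^-1 1 h2.
  pose G x := A * N1 * ((x - 1) `^ alpha * x `^ (- alpha - 2)) +
    A * N2 * ((x - 1) `^ (- alpha) * x `^ (- (- alpha) - 2)) +
    K ^+ 2 * N3 * x `^ (alpha + beta - 2 * s).
  apply: (@L1_le _ _ _ G).
  + exact: I1_meas.
  + by apply: mul_w => //; exact: measurable_weight1oo.
  + move=> x Ix; rewrite ger0_norm; last by apply: mulr_ge0; [exact: weight1oo_ge0|exact: sqr_ge0].
    have x0 := I1gt0 Ix; have xn0 : x != 0 by rewrite gt_eqF.
    have x1 := I1gt1 Ix.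
    have pD p q : x `^ (p + q) = x `^ p * x `^ q by rewrite powRD// xn0 implybT.
    have T1 : 0 <= A * N1 * ((x - 1) `^ alpha * x `^ (- alpha - 2)).
      by rewrite !mulr_ge0 ?powR_ge0.
    have T2 : 0 <= A * N2 * ((x - 1) `^ (- alpha) * x `^ (- (- alpha) - 2)).
      by rewrite !mulr_ge0 ?powR_ge0.
    have T3 : 0 <= K ^+ 2 * N3 * x `^ (alpha + beta - 2 * s).
      by rewrite !mulr_ge0 ?powR_ge0 ?sqr_ge0.
    have [xM|Mx] := leP x M'.
      apply: (@le_trans _ _ (A * N1 * ((x - 1) `^ alpha * x `^ (- alpha - 2)) +
         A * N2 * ((x - 1) `^ (- alpha) * x `^ (- (- alpha) - 2)))); last first.
        by rewrite /G lerDl.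
      apply: (@le_trans _ _ (w1 x * (A * (1 + ((x - 1) `^ (- alpha)) ^+ 2)))).
        by rewrite ler_wpM2l ?weight1oo_ge0// bnd.
      rewrite mulrCA -!(mulrA A) -(mulrDr A) ler_wpM2l// mulrDr mulr1 /weight1oo.
      have xb1 : x `^ beta <= N1 * x `^ (- alpha - 2).
        rewrite -ler_pdivrMr ?powR_gt0// -powRN -pD (_ : - (- alpha - 2) = alpha + 2).
          by apply: hN1; rewrite ltW.
        by ring.
      have xb2 : x `^ beta <= N2 * x `^ (- - alpha - 2).
        rewrite -ler_pdivrMr ?powR_gt0// -powRN -pD (_ : - (- - alpha - 2) = 2 - alpha).
          by apply: hN2; rewrite ltW.
        by ring.
      apply: lerD.
        by rewrite (mulrCA N1) ler_wpM2l ?powR_ge0.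
      have t0 : (x - 1) `^ alpha != 0 by rewrite gt_eqF// powR_gt0// subr_gt0.
      rewrite (mulrCA N2) expr2 powRN [leLHS](_ : _ = ((x - 1) `^ alpha)^-1 * x `^ beta).
        by rewrite ler_wpM2l ?invr_ge0 ?powR_ge0.
      by field.
    apply: (@le_trans _ _ (K ^+ 2 * N3 * x `^ (alpha + beta - 2 * s))); last first.
      by rewrite /G lerDr addr_ge0.
    have Mx' : M < x by apply: le_lt_trans Mx; rewrite /M' le_max lexx.
    have x2 : 2 < x by apply: le_lt_trans Mx.
    have := sqr_norm_le (gi x Mx') => gx.
    apply: (@le_trans _ _ (w1 x * (K * x `^ (- s)) ^+ 2)).
      by rewrite ler_wpM2l ?weight1oo_ge0.
    have xa : (x - 1) `^ alpha <= N3 * x `^ alpha.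
      have -> : (x - 1) `^ alpha = ((x - 1) / x) `^ alpha * x `^ alpha.
        rewrite -powRM ?divr_ge0 ?subr_ge0 ?ltW//; congr (_ `^ _).
        by rewrite -mulrA mulVf// mulr1.
      rewrite ler_wpM2r ?powR_ge0// hN3//.
      by rewrite ler_pdivlMr// ler_pdivrMr//; apply/andP; split; lra.
    have -> : x `^ (alpha + beta - 2 * s) = x `^ alpha * x `^ beta * (x `^ (- s)) ^+ 2.
      rewrite expr2 -!pD; congr (_ `^ _); ring.
    rewrite /weight1oo exprMn.
    rewrite [leLHS](_ : _ = (K ^+ 2 * x `^ beta * x `^ (- s) ^+ 2) * (x - 1) `^ alpha); last by ring.
    rewrite [leRHS](_ : _ = (K ^+ 2 * x `^ beta * x `^ (- s) ^+ 2) * (N3 * x `^ alpha)); last by ring.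
    by rewrite ler_wpM2l// !mulr_ge0 ?sqr_ge0 ?powR_ge0.
  + have mI := @I1_meas R.
    apply: L1D => //; [apply: L1D => //|]; apply: L1Z => //.
    * by apply: L1_I1_powR1.
    * by apply: L1_I1_powR1; lra.
    * by apply: L1_I1_powR; move: hs; lra.
Qed.

End WeightedSquare.

(** * The real domain of the operator *)

Section RealDomain.
Variable R : realType.
Notation mu := (@lebesgue_measure R).
Implicit Types (D I J : set R) (f g h u v w m : R -> R) (a b c d x K s e : R).

(** The real form of [smooth_right0]. *)
Definition rlim0 f := [/\ exists2 e : R, 0 < e & smooth `]0, e[ f,
  forall n, exists l : R, derive1n n f x @[x --> 0^'+] --> l &
  f x @[x --> 0^'+] --> f 0].

Lemma right0P (P : R -> Prop) : (\forall x \near 0^'+, P x) <->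
  exists2 e : R, 0 < e & forall x, 0 < x < e -> P x.
Proof.
split=> [/nbhs_ballP[e /= e0 H]|[e e0 H]].
  exists e => // x /andP[x0 xe]; apply: H => //.
  by rewrite /ball/= sub0r normrN gtr0_norm.
by near=> x; apply: H; apply/andP; split; near: x;
  [exact: nbhs_right_gt|exact: nbhs_right_lt].
Unshelve. all: by end_near. Qed.

Lemma rlim0_bound f n : rlim0 f -> exists e K : R,
  [/\ 0 < e, 0 <= K & forall x, 0 < x < e -> `|derive1n n f x| <= K].
Proof.
move=> [_ /(_ n)[l fl] _].
have /cvgr_norm_le/(_ (`|l| + 1)) : derive1n n f x @[x --> 0^'+] --> l by [].
rewrite ltrDl => /(_ ltr01)/right0P[e e0 H].
by exists e, (`|l| + 1); split => //; rewrite addr_ge0.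
Qed.

Variables (alpha beta C s : R).
Hypotheses (halpha : -1 < alpha < 1) (hbeta : -1 < beta) (C0 : 0 < C).
Hypothesis hs : 2 * s > alpha + beta + 1.

Definition hypD f x := x * (1 - x) * derive1 (derive1 f) x
  + (beta + 1 - (alpha + beta + 2) * x) * derive1 f x.

(* [spaceE] for real-valued functions, where [s] stands for [alpha + beta + r + 1] and [C]
   for [sin ((alpha + theta) pi) / sin (theta pi)]. *)
Definition realE f := [/\ smooth (@I0 R `|` @I1 R) f, rlim0 f,
  exists u v, exists2 e : R, 0 < e & [/\ smooth `]1 - e, 1 + e[ u,
    smooth `]1 - e, 1 + e[ v,
    forall x, 1 - e < x < 1 -> f x = u x + v x * (1 - x) `^ (- alpha) &
    forall x, 1 < x < 1 + e -> f x = C^-1 * u x + v x * (x - 1) `^ (- alpha)] &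
  exists w, exists2 M : R, rlim0 w &
    forall x, M < x -> f x = w x^-1 * x `^ (- s)].

Lemma I01_open : open (@I0 R `|` @I1 R).
Proof. by apply: openU; [exact: I0_open|exact: I1_open]. Qed.

Lemma ER_smooth0 f : realE f -> smooth (@I0 R) f.
Proof. by move=> [sf _ _ _]; apply: smooth_sub sf => x; left. Qed.

Lemma ER_smooth1 f : realE f -> smooth (@I1 R) f.
Proof. by move=> [sf _ _ _]; apply: smooth_sub sf => x; right. Qed.

Lemma smooth_Dr J f : open J -> smooth J f -> smooth J (hypD f).
Proof.
move=> oJ sf.
have s1 := smooth_derive1 sf; have s2 := smooth_derive1 s1.
have si := smooth_id oJ.
have sc c := smooth_cst (c := c) oJ.
have sa := smoothM oJ (smoothM oJ si (smoothB oJ (sc 1) si)) s2.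
have sb := smoothM oJ (smoothB oJ (sc (beta + 1))
  (smoothM oJ (sc (alpha + beta + 2)) si)) s1.
exact: (smoothD oJ sa sb).
Qed.

Lemma Dr_continuous J f x : open J -> smooth J f -> J x -> {for x, continuous (hypD f)}.
Proof. by move=> oJ sf Jx; exact: (smooth_continuous (smooth_Dr oJ sf) Jx). Qed.

Lemma Dr_eq_on J f g : open J -> (forall x, J x -> f x = g x) ->
  forall x, J x -> hypD f x = hypD g x.
Proof.
move=> oJ fg x Jx; rewrite /hypD (derive1_eq_on oJ fg Jx).
by rewrite (derive1_eq_on oJ (derive1_eq_on oJ fg) Jx).
Qed.

(** Serves both sides of 1, with m = |1 - x|^(-alpha) and k equal to 1 on the left and to C^-1 on
    the right. The cross term keeps x (1 - x) next to m', because that product is again a multiple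
    of m. *)
Lemma Dr_local J f u v m k (x : R) : open J -> smooth J u -> smooth J v -> smooth J m ->
  (forall x, J x -> f x = k * u x + v x * m x) -> J x ->
  derive1 f x = k * derive1 u x + (derive1 v x * m x + v x * derive1 m x) /\
  hypD f x = k * hypD u x + v x * hypD m x + m x * hypD v x +
    2 * (x * (1 - x) * derive1 m x) * derive1 v x.
Proof.
move=> oJ su sv sm fE.
have d1 y : J y -> derive1 f y = k * derive1 u y + (derive1 v y * m y + v y * derive1 m y).
  move=> Jy; rewrite (derive1_eq_on oJ fE Jy).
  exact: (is_derive_derive1 (is_deriveD' (is_deriveZ' k (smooth_is_derive su Jy))
    (is_deriveM' (smooth_is_derive sv Jy) (smooth_is_derive sm Jy)))).
move=> Jx; split; first exact: d1.
have su' := smooth_derive1 su; have sv' := smooth_derive1 sv; have sm' := smooth_derive1 sm.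
rewrite /hypD (derive1_eq_on oJ d1 Jx) d1//.
rewrite (is_derive_derive1 (is_deriveD' (is_deriveZ' k (smooth_is_derive su' Jx))
  (is_deriveD' (is_deriveM' (smooth_is_derive sv' Jx) (smooth_is_derive sm Jx))
     (is_deriveM' (smooth_is_derive sv Jx) (smooth_is_derive sm' Jx))))).
move: (derive1 (derive1 u) x) (derive1 (derive1 v) x) (derive1 (derive1 m) x).
move: (derive1 u x) (derive1 v x) (derive1 m x) (u x) (v x) (m x) => *.
ring.
Qed.

Lemma is_derive_1mx a x : x < 1 ->
  is_derive x 1 (fun t => (1 - t) `^ a) (- a * (1 - x) `^ (a - 1)).
Proof.
move=> x1; have h : 0 < -1 * x + 1 by rewrite mulN1r addrC subr_gt0.
have := is_derive_powR_affine a h.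
have -> : (fun t : R => (-1 * t + 1) `^ a) = (fun t => (1 - t) `^ a).
  by apply/funext => t; rewrite mulN1r addrC.
move=> H; apply: (is_derive_cong H).
by rewrite mulN1r (addrC (- x)); ring.
Qed.

Lemma is_derive_xm1 a x : 1 < x ->
  is_derive x 1 (fun t => (t - 1) `^ a) (a * (x - 1) `^ (a - 1)).
Proof.
move=> x1; have h : 0 < 1 * x + -1 by rewrite mul1r subr_gt0.
have := is_derive_powR_affine a h.
have -> : (fun t : R => (1 * t + -1) `^ a) = (fun t => (t - 1) `^ a).
  by apply/funext => t; rewrite mul1r.
by move=> H; apply: (is_derive_cong H); rewrite mul1r mulr1.
Qed.

Lemma smooth_1mx a : smooth [set x | x < 1] (fun t => (1 - t) `^ a).
Proof.
have o1 : open [set x : R | x < 1] by exact: open_lt.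
apply: (@smooth_comp _ _ [set x | 0 < x] (fun t => 1 - t) (fun t => t `^ a)) => //.
- by move=> x /=; rewrite subr_gt0.
- apply: (smoothB o1); [exact: (smooth_cst o1)|exact: (smooth_id o1)].
- exact: smooth_powR.
Qed.

Lemma smooth_xm1 a : smooth [set x | 1 < x] (fun t => (t - 1) `^ a).
Proof.
have o1 : open [set x : R | 1 < x] by exact: open_gt.
apply: (@smooth_comp _ _ [set x | 0 < x] (fun t => t - 1) (fun t => t `^ a)) => //.
- by move=> x /=; rewrite subr_gt0.
- apply: (smoothB o1); [exact: (smooth_id o1)|exact: (smooth_cst o1)].
- exact: smooth_powR.
Qed.

Lemma powRm1 a x : 0 < x -> x * x `^ (a - 1) = x `^ a.
Proof.
move=> x0; have xn0 : x != 0 by rewrite gt_eqF.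
rewrite powRB; last by rewrite xn0 implybT.
by rewrite powRr1 ?(ltW x0)// mulrC divfK.
Qed.

(** -alpha is an exponent of D at 1: the more singular terms of D m cancel, and D m is of the order
    of m itself. This keeps D f square-integrable for f in E. *)
Lemma m_left x : x < 1 -> let m := fun t : R => (1 - t) `^ (- alpha) in
  x * (1 - x) * derive1 m x = alpha * x * m x /\
  hypD m x = alpha * (beta + 1) * m x.
Proof.
move=> x1 m; have t0 : 0 < 1 - x by rewrite subr_gt0.
have dm y : [set z | z < 1] y -> derive1 m y = alpha * (1 - y) `^ (- alpha - 1).
  by move=> /= y1; rewrite (is_derive_derive1 (is_derive_1mx (- alpha) y1)) opprK.
have E1 := powRm1 (- alpha) t0; have E2 := powRm1 (- alpha - 1) t0.
have oJ : open [set z : R | z < 1] by exact: open_lt.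
rewrite /hypD (derive1_eq_on oJ dm x1) (dm _ x1).
rewrite (is_derive_derive1 (is_deriveZ' alpha (is_derive_1mx (- alpha - 1) x1))).
rewrite /m -E1 -E2; split; ring.
Qed.

Lemma m_right x : 1 < x -> let m := fun t : R => (t - 1) `^ (- alpha) in
  x * (1 - x) * derive1 m x = alpha * x * m x /\
  hypD m x = alpha * (beta + 1) * m x.
Proof.
move=> x1 m; have t0 : 0 < x - 1 by rewrite subr_gt0.
have dm y : [set z | 1 < z] y -> derive1 m y = - alpha * (y - 1) `^ (- alpha - 1).
  by move=> /= y1; rewrite (is_derive_derive1 (is_derive_xm1 (- alpha) y1)).
have E1 := powRm1 (- alpha) t0; have E2 := powRm1 (- alpha - 1) t0.
have oJ : open [set z : R | 1 < z] by exact: open_gt.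
rewrite /hypD (derive1_eq_on oJ dm x1) (dm _ x1).
rewrite (is_derive_derive1 (is_deriveZ' (- alpha) (is_derive_xm1 (- alpha - 1) x1))).
rewrite /m -E1 -E2; split; ring.
Qed.

Lemma near1_smooth_bound u (e : R) : 0 < e -> smooth `]1 - e, 1 + e[ u ->
  exists2 K, 0 <= K & forall x, 1 - e / 2 <= x <= 1 + e / 2 -> `|u x| <= K.
Proof.
move=> e0 su; apply: cont_bounded => x /andP[xl xr].
by apply: (smooth_continuous su); rewrite /= in_itv/=; apply/andP; split; lra.
Qed.

Lemma itv1_open (e : R) : open (`]1 - e, 1 + e[%classic : set R).
Proof. exact: interval_open. Qed.

Lemma ER_near1 f : realE f -> exists e K : R, [/\ 0 < e, 0 <= K,
  forall x, 1 - e < x < 1 -> `|f x| <= K * (1 + (1 - x) `^ (- alpha)) /\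
     `|hypD f x| <= K * (1 + (1 - x) `^ (- alpha)) &
  forall x, 1 < x < 1 + e -> `|f x| <= K * (1 + (x - 1) `^ (- alpha)) /\
     `|hypD f x| <= K * (1 + (x - 1) `^ (- alpha))].
Proof.
move=> [_ _ [u [v [e e0 [su sv fl fr]]]] _].
have oJ := @itv1_open e.
(* The coefficient of |1 - x|^(-alpha) in D f: D f has the same shape as f near 1, with u and v
   replaced by D u and [v2]. *)
pose v2 x := alpha * (beta + 1) * v x + 2 * alpha * x * derive1 v x + hypD v x.
have su1 := smooth_derive1 su; have su2 := smooth_derive1 su1.
have sv1 := smooth_derive1 sv; have sv2 := smooth_derive1 sv1.
have si := smooth_id oJ; have sc c := smooth_cst (c := c) oJ.
have sv2' : smooth `]1 - e, 1 + e[ v2.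
  apply: (smoothD oJ (smoothD oJ (smoothM oJ (sc (alpha * (beta + 1))) sv)
    (smoothM oJ (smoothM oJ (sc (2 * alpha)) si) sv1))).
  exact: smooth_Dr.
have [K1 K10 h1] := near1_smooth_bound e0 su.
have [K2 K20 h2] := near1_smooth_bound e0 sv.
have [K3 K30 h3] := near1_smooth_bound e0 (smooth_Dr oJ su).
have [K4 K40 h4] := near1_smooth_bound e0 sv2'.
pose k := 1 + C^-1.
have Ci0 : 0 < C^-1 by rewrite invr_gt0.
have k0 : 0 <= k by rewrite /k; lra.
pose K := k * K1 + K2 + k * K3 + K4.
have kK1 : 0 <= k * K1 by rewrite mulr_ge0.
have kK3 : 0 <= k * K3 by rewrite mulr_ge0.
have K0 : 0 <= K by rewrite /K; lra.
have bnd (k' a b m A B : R) : 0 <= k' <= k -> 0 <= m -> `|a| <= A -> `|b| <= B ->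
    0 <= A -> 0 <= B -> k * A <= K -> B <= K -> `|k' * a + b * m| <= K * (1 + m).
  move=> /andP[k'0 k'k] m0 aA bB A0 B0 kA BK.
  apply: le_trans (ler_normD _ _) _; rewrite mulrDr mulr1; apply: lerD.
    rewrite normrM (ger0_norm k'0); apply: le_trans kA.
    by apply: ler_pM.
  by rewrite normrM (ger0_norm m0) ler_wpM2r// (le_trans bB).
have e2 : 0 < e / 2 by lra.
have [k1K k2K k3K k4K] : [/\ k * K1 <= K, K2 <= K, k * K3 <= K & K4 <= K].
  by rewrite /K; split; move: (k * K1) (k * K3) kK1 kK3 => *; lra.
have kC : 0 <= C^-1 <= k by rewrite /k; apply/andP; split; lra.
have k1 : (0 : R) <= (1 : R) <= k by rewrite ler01 /k/= lerDl ltW.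
exists (e / 2), K; split; [exact: e2|exact: K0|move=> x /andP[xl xr]|move=> x /andP[xl xr]].
- have xin : 1 - e / 2 <= x <= 1 + e / 2 by apply/andP; split; lra.
  have Jx : `]1 - e, 1[%classic x by rewrite /= in_itv/=; apply/andP; split; lra.
  have m0 := powR_ge0 (1 - x) (- alpha).
  have sub : `]1 - e, 1[%classic `<=` (`]1 - e, 1 + e[%classic : set R).
    by move=> y; rewrite /= !in_itv/= => /andP[? ?]; apply/andP; split; lra.
  have oJ1 : open (`]1 - e, 1[%classic : set R) by exact: interval_open.
  have sm : smooth (`]1 - e, 1[%classic : set R) (fun t => (1 - t) `^ (- alpha)).
    by apply: smooth_sub (@smooth_1mx (- alpha)) => y; rewrite /= in_itv/= => /andP[].
  have fE y : `]1 - e, 1[%classic y -> f y = 1 * u y + v y * (1 - y) `^ (- alpha).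
    by rewrite /= in_itv/= mul1r; exact: fl.
  have [_ DE] := Dr_local oJ1 (smooth_sub sub su) (smooth_sub sub sv) sm fE Jx.
  have [mE1 mE2] := m_left xr.
  split.
    rewrite fE//; exact: (bnd _ _ _ _ K1 K2 k1 m0 (h1 x xin) (h2 x xin) K10 K20 k1K k2K).
  rewrite DE mE1 mE2.
  rewrite [X in `|X|](_ : _ = 1 * hypD u x + v2 x * (1 - x) `^ (- alpha)); last by rewrite /v2; ring.
  exact: (bnd _ _ _ _ K3 K4 k1 m0 (h3 x xin) (h4 x xin) K30 K40 k3K k4K).
- have xin : 1 - e / 2 <= x <= 1 + e / 2 by apply/andP; split; lra.
  have Jx : `]1, 1 + e[%classic x by rewrite /= in_itv/=; apply/andP; split; lra.
  have m0 := powR_ge0 (x - 1) (- alpha).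
  have sub : `]1, 1 + e[%classic `<=` (`]1 - e, 1 + e[%classic : set R).
    by move=> y; rewrite /= !in_itv/= => /andP[? ?]; apply/andP; split; lra.
  have oJ1 : open (`]1, 1 + e[%classic : set R) by exact: interval_open.
  have sm : smooth (`]1, 1 + e[%classic : set R) (fun t => (t - 1) `^ (- alpha)).
    by apply: smooth_sub (@smooth_xm1 (- alpha)) => y; rewrite /= in_itv/= => /andP[].
  have fE y : `]1, 1 + e[%classic y -> f y = C^-1 * u y + v y * (y - 1) `^ (- alpha).
    by rewrite /= in_itv/=; exact: fr.
  have [_ DE] := Dr_local oJ1 (smooth_sub sub su) (smooth_sub sub sv) sm fE Jx.
  have [mE1 mE2] := m_right xl.
  split.
    rewrite fE//; exact: (bnd _ _ _ _ K1 K2 kC m0 (h1 x xin) (h2 x xin) K10 K20 k1K k2K).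
  rewrite DE mE1 mE2.
  rewrite [X in `|X|](_ : _ = C^-1 * hypD u x + v2 x * (x - 1) `^ (- alpha)); last by rewrite /v2; ring.
  exact: (bnd _ _ _ _ K3 K4 kC m0 (h3 x xin) (h4 x xin) K30 K40 k3K k4K).
Qed.

Lemma ER_near0 f : realE f -> exists e K : R, [/\ 0 < e, 0 <= K &
  forall x, 0 < x < e -> [/\ `|f x| <= K, `|derive1 f x| <= K & `|hypD f x| <= K]].
Proof.
move=> [_ rf _ _].
have [e0 [K0 [e00 K00 h0]]] := rlim0_bound 0 rf.
have [e1 [K1 [e10 K10 h1]]] := rlim0_bound 1 rf.
have [e2 [K2 [e20 K20 h2]]] := rlim0_bound 2 rf.
pose L := `|beta + 1| + `|alpha + beta + 2|.
have L0 : 0 <= L by rewrite addr_ge0.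
have LK : 0 <= L * K1 by rewrite mulr_ge0.
exists (Num.min (Num.min e0 e1) (Num.min e2 1)), (K0 + K1 + K2 + L * K1).
split; first by rewrite !lt_min e00 e10 e20 ltr01.
  by rewrite !addr_ge0.
move=> x; rewrite !lt_min => /and3P[x0 /andP[xe0 xe1] /andP[xe2 x1]].
have k0 : `|f x| <= K0 by apply: h0; rewrite x0.
have k1 : `|derive1 f x| <= K1 by have := h1 x; rewrite derive1n1 x0 xe1; apply.
have k2 : `|derive1 (derive1 f) x| <= K2.
  by have := h2 x; rewrite derive1nS derive1n1 x0 xe2; apply.
split; [by lra|by lra|].
apply: (@le_trans _ _ (K2 + L * K1)); last by lra.
apply: le_trans (ler_normD _ _) _; apply: lerD.
  rewrite normrM; apply: le_trans k2; rewrite ler_piMl// ger0_norm.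
    by rewrite mulr_ile1//; lra.
  by rewrite mulr_ge0//; lra.
rewrite normrM; apply: ler_pM => //.
apply: le_trans (ler_normB _ _) _; rewrite lerD2l normrM ler_piMr//.
by rewrite ger0_norm; lra.
Qed.

(** Differentiation preserves the shape w(1/x) x^(-sg): the exponent gains 1 and w(y) becomes -y
    w'(y) - sg w(y). [ER_infty] uses this twice, the coefficient x (1 - x) of D compensating two
    derivatives. *)
Lemma derive_decay (sg M : R) f w x : 0 < M -> smooth `]0, M^-1[ w ->
  (forall x, M < x -> f x = w x^-1 * x `^ (- sg)) -> M < x ->
  derive1 f x = (- x^-1 * derive1 w x^-1 - sg * w x^-1) * x `^ (- (sg + 1)).
Proof.
move=> M0 sw fE Mx.
have x0 : 0 < x by exact: lt_trans Mx.
have oM : open [set x : R | M < x] by exact: open_gt.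
have Vx : `]0, M^-1[%classic x^-1.
  by rewrite /= in_itv/= invr_gt0 x0 ltf_pV2.
rewrite (derive1_eq_on oM fE Mx).
have xn0 : x != 0 by rewrite gt_eqF.
have dw := is_derive_comp (g := w) (is_deriveV' xn0 (is_derive_x x)) (smooth_is_derive sw Vx).
rewrite (is_derive_derive1 (is_deriveM' dw (is_derive1_powR (- sg) x0))).
have -> : - (sg + 1) = - sg - 1 by ring.
by rewrite -(powRm1 (- sg) x0); field.
Qed.

Lemma ER_infty f : realE f -> exists M K : R, [/\ 0 < M, 0 <= K &
  forall x, M < x -> [/\ `|f x| <= K * x `^ (- s),
     `|derive1 f x| <= K * x `^ (- (s + 1)) & `|hypD f x| <= K * x `^ (- s)]].
Proof.
move=> [_ _ _ [w [M0 rw fE]]].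
have [[e3 e30 sw0] _ _] := rw.
have [e0 [K0 [e00 K00 h0]]] := rlim0_bound 0 rw.
have [e1 [K1 [e10 K10 h1]]] := rlim0_bound 1 rw.
have [e2 [K2 [e20 K20 h2]]] := rlim0_bound 2 rw.
(* Beyond M = 1/m the representation by [w] holds and 1/x stays where [w] is smooth and bounded
   together with its first two derivatives; m <= 1 makes x > 1, needed to compare coefficients with
   powers of x. *)
pose m := Num.min (Num.min e0 e1) (Num.min (Num.min e2 1) (Num.min e3 (Num.max M0 1)^-1)).
have Mx0 : 0 < Num.max M0 1 by rewrite lt_max ltr01 orbT.
have m0 : 0 < m by rewrite !lt_min e00 e10 e20 ltr01 e30 invr_gt0 Mx0.
pose M := m^-1; have M0' : 0 < M by rewrite invr_gt0.
have MV : M^-1 = m by rewrite /M invrK.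
have sw : smooth `]0, M^-1[ w.
  apply: smooth_sub sw0 => x; rewrite MV /= !in_itv/= => /andP[-> /=].
  by rewrite /m !lt_min => /and3P[_ _ /andP[]].
have inm x : M < x -> 0 < x^-1 /\ x^-1 < m.
  move=> Mx; have x0 := lt_trans M0' Mx; split; first by rewrite invr_gt0.
  by rewrite -[ltRHS]invrK ltf_pV2 ?posrE// ?invr_gt0.
have fE' x : M < x -> f x = w x^-1 * x `^ (- s).
  move=> Mx; apply: fE; have [xi] := inm x Mx; rewrite /m !lt_min => /and4P[_ _ _ xm].
  have x0 : 0 < x by rewrite -invr_gt0.
  move: xm; rewrite ltf_pV2 ?posrE// gt_max => /andP[]//.
have d1 x : M < x -> derive1 f x = (- x^-1 * derive1 w x^-1 - s * w x^-1) * x `^ (- (s + 1)).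
  exact: derive_decay.
pose w1 y := - y * derive1 w y - s * w y.
have oM : open (`]0, M^-1[%classic : set R) by exact: interval_open.
have si := smooth_id oM; have sc c := smooth_cst (c := c) oM.
have sw' := smooth_derive1 sw.
have sw1 : smooth `]0, M^-1[ w1.
  exact: (smoothB oM (smoothM oM (smoothN oM si) sw') (smoothM oM (sc s) sw)).
have d2 x : M < x -> derive1 (derive1 f) x =
    (- x^-1 * derive1 w1 x^-1 - (s + 1) * w1 x^-1) * x `^ (- (s + 1 + 1)).
  exact: (derive_decay M0' sw1 d1).
have dw1 y : `]0, M^-1[%classic y -> derive1 w1 y =
    - derive1 w y - y * derive1 (derive1 w) y - s * derive1 w y.
  move=> Jy; rewrite (is_derive_derive1 (is_deriveB'
    (is_deriveM' (is_deriveN' (is_derive_x y)) (smooth_is_derive sw' Jy))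
    (is_deriveZ' s (smooth_is_derive sw Jy)))); ring.
pose B0 := K0; pose B1 := K1 + `|s| * K0.
pose B2 := (K1 + K2 + `|s| * K1) + `|s + 1| * B1.
have B10 : 0 <= B1 by rewrite addr_ge0// mulr_ge0.
have B20 : 0 <= B2 by rewrite !addr_ge0// mulr_ge0.
pose L := `|beta + 1| + `|alpha + beta + 2|.
have L0 : 0 <= L by rewrite addr_ge0.
have LB1 : 0 <= L * B1 by rewrite mulr_ge0.
have M1 : 1 <= M.
  have m1 : m <= 1 by rewrite /m !ge_min lexx !orbT.
  by rewrite /M invf_ge1.
have i1 : K0 <= K0 + B1 + B2 + L * B1 by lra.
have i2 : B1 <= K0 + B1 + B2 + L * B1 by lra.
have i3 : B2 + L * B1 <= K0 + B1 + B2 + L * B1 by lra.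
exists M, (K0 + B1 + B2 + L * B1); split; [exact: M0'|exact: le_trans i1|move=> x Mx].
have [xi0 xim] := inm x Mx.
have Jx : `]0, M^-1[%classic x^-1 by rewrite /= in_itv/= MV xi0.
move: (xim); rewrite /m !lt_min => /and4P[/andP[xe0 xe1] /andP[xe2 xi1] xe3 _].
have k0 : `|w x^-1| <= K0 by apply: h0; rewrite xi0.
have k1 : `|derive1 w x^-1| <= K1 by have := h1 x^-1; rewrite derive1n1 xi0 xe1; apply.
have k2 : `|derive1 (derive1 w) x^-1| <= K2.
  by have := h2 x^-1; rewrite derive1nS derive1n1 xi0 xe2; apply.
have ni (A B : R) : `|A| <= B -> `|x^-1 * A| <= B.
  by move=> AB; rewrite normrM gtr0_norm//; apply: le_trans AB; rewrite ler_piMl// ltW.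
have b1 : `|w1 x^-1| <= B1.
  apply: le_trans (ler_normB _ _) _; apply: lerD; first by rewrite mulNr normrN ni.
  by rewrite normrM ler_wpM2l.
have b2 : `|derive1 w1 x^-1| <= K1 + K2 + `|s| * K1.
  rewrite dw1//; apply: le_trans (ler_normB _ _) _; apply: lerD.
    by apply: le_trans (ler_normB _ _) _; apply: lerD; [rewrite normrN|exact: ni].
  by rewrite normrM ler_wpM2l.
have x0 : 0 < x by rewrite -invr_gt0.
have x1 : 1 < x by exact: le_lt_trans Mx.
have f1 : `|derive1 f x| <= B1 * x `^ (- (s + 1)).
  by rewrite d1// normrM (ger0_norm (powR_ge0 _ _)) ler_wpM2r ?powR_ge0.
have f2 : `|derive1 (derive1 f) x| <= B2 * x `^ (- (s + 1 + 1)).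
  rewrite d2// normrM (ger0_norm (powR_ge0 _ _)) ler_wpM2r ?powR_ge0//.
  apply: le_trans (ler_normB _ _) _; apply: lerD; first by rewrite mulNr normrN ni.
  by rewrite normrM ler_wpM2l.
have coef1oo : x `^ (- s) = x * x `^ (- (s + 1)).
  by rewrite opprD powRm1.
have P2 : x `^ (- (s + 1)) = x * x `^ (- (s + 1 + 1)).
  by rewrite [in RHS]opprD powRm1.
have gr (A B y : R) : 0 <= B -> A <= B -> A * x `^ y <= B * x `^ y.
  by move=> _ AB; rewrite ler_wpM2r ?powR_ge0.
split.
- rewrite fE'// normrM (ger0_norm (powR_ge0 _ _)) ler_wpM2r ?powR_ge0//.
  exact: le_trans i1.
- by apply: le_trans f1 _; rewrite ler_wpM2r ?powR_ge0.
- apply: (@le_trans _ _ ((B2 + L * B1) * x `^ (- s))); last first.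
    by rewrite ler_wpM2r ?powR_ge0.
  rewrite [leRHS]mulrDl /hypD; apply: le_trans (ler_normD _ _) _; apply: lerD.
    have -> : B2 * x `^ (- s) = (x * x) * (B2 * x `^ (- (s + 1 + 1))).
      by rewrite coef1oo P2; ring.
    rewrite [leLHS]normrM; apply: ler_pM => //.
    rewrite normrM (gtr0_norm x0) ler_pM2l// ler_norml.
    by rewrite lerDr ler01/= lerBlDr (le_trans (ltW x1))// lerDl ltW.
  have -> : L * B1 * x `^ (- s) = (L * x) * (B1 * x `^ (- (s + 1))).
    by rewrite coef1oo; ring.
  rewrite [leLHS]normrM; apply: ler_pM => //.
  apply: le_trans (ler_normB _ _) _; rewrite /L [leRHS]mulrDl.
  by apply: lerD; [rewrite ler_peMr// ltW|rewrite normrM (gtr0_norm x0)].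
Qed.

End RealDomain.

(** * The divergence form of D and the boundary terms *)

Section Green.
Variable R : realType.
Notation mu := (@lebesgue_measure R).
Implicit Types (D I J : set R) (f g h u v w m : R -> R) (a b c d x K e : R).

Lemma L1_prod D w f g : meas D -> mfun D w -> mfun D f -> mfun D g ->
  (forall x, 0 <= w x) -> L1 D (fun x => w x * f x ^+ 2) ->
  L1 D (fun x => w x * g x ^+ 2) -> L1 D (fun x => w x * (f x * g x)).
Proof.
move=> mD mw mf mg w0 hf hg.
apply: (@L1_le _ _ _ (fun x => w x * f x ^+ 2 + w x * g x ^+ 2)) => //.
- by apply: measurable_funM => //; exact: measurable_funM.
- move=> x _; rewrite normrM (ger0_norm (w0 x)) -mulrDr ler_wpM2l// normrM.
  have h1 := sqr_ge0 (`|f x| - `|g x|).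
  have h2 := sqr_ge0 (`|f x|); have h3 := sqr_ge0 (`|g x|).
  rewrite -(real_normK (num_real (f x))) -(real_normK (num_real (g x))).
  move: h1 h2 h3; rewrite !expr2; lra.
- exact: L1D.
Qed.

Lemma cvg_le0 (B_ a_ : nat -> R) K : a_ n @[n --> \oo] --> 0 ->
  (\forall n \near \oo, `|B_ n| <= K * a_ n) -> B_ n @[n --> \oo] --> 0.
Proof.
move=> a0 BK; apply: norm_cvg0.
have C : K * a_ n @[n --> \oo] --> 0 by rewrite -[X in _ --> X](mulr0 K); apply: cvgMr.
apply: (squeeze_cvgr _ (cvg_cst 0) C).
by apply: filterS BK => n ->; rewrite normr_ge0.
Qed.

Lemma eps_right : eps R n @[n --> \oo] --> 0^'+.
Proof.
move=> A /right0P[e e0 H].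
have := eps_near e0; apply: filterS => n ne; apply: H.
by rewrite eps_gt0.
Qed.

Lemma eps_powR_cvg (p : R) : 0 < p -> eps R n `^ p @[n --> \oo] --> 0.
Proof. by move=> p0; exact: (cvg_comp _ _ eps_right (powR_cvg0 p0)). Qed.

Variables (alpha beta C s : R).
Hypotheses (halpha : -1 < alpha < 1) (hbeta : -1 < beta) (C0 : 0 < C).
Hypothesis hs : 2 * s > alpha + beta + 1.
Notation w0 := (weight01 alpha beta).
Notation w1 := (weight1oo alpha beta).
Notation Dr := (hypD alpha beta).
Notation ER := (realE alpha C s).
Notation L2sq := (weightedL2 alpha beta).

Lemma ER_cont0 f : ER f -> (forall x, @I0 R x -> {for x, continuous f}) /\
  (forall x, @I0 R x -> {for x, continuous (Dr f)}).
Proof.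
move=> /ER_smooth0 sf; split => x Ix; first exact: (smooth_continuous sf).
exact: (Dr_continuous (@I0_open R) sf).
Qed.

Lemma ER_cont1 f : ER f -> (forall x, @I1 R x -> {for x, continuous f}) /\
  (forall x, @I1 R x -> {for x, continuous (Dr f)}).
Proof.
move=> /ER_smooth1 sf; split => x Ix; first exact: (smooth_continuous sf).
exact: (Dr_continuous (@I1_open R) sf).
Qed.

Lemma ER_L2sq f : ER f -> L2sq f /\ L2sq (Dr f).
Proof.
move=> Ef; have [f0 df0] := ER_cont0 Ef; have [f1 df1] := ER_cont1 Ef.
have [ea [Ka [ea0 Ka0 ha]]] := ER_near0 beta Ef.
have [eb [Kb [eb0 Kb0 hl hr]]] := ER_near1 beta C0 Ef.
have [M [Kc [M0 Kc0 hi]]] := ER_infty beta Ef.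
pose e := Num.min ea eb; pose K := Ka + Kb + Kc.
have e0 : 0 < e by rewrite lt_min ea0.
have K0 : 0 <= K by rewrite /K !addr_ge0.
have KaK : Ka <= K by rewrite /K -addrA lerDl addr_ge0.
have KbK : Kb <= K by rewrite /K addrAC lerDr addr_ge0.
have KcK : Kc <= K by rewrite /K lerDr addr_ge0.
have eea : e <= ea by rewrite ge_min lexx.
have eeb : e <= eb by rewrite ge_min lexx orbT.
have q0 (y : R) : 0 <= 1 + y `^ (- alpha) by rewrite addr_ge0// powR_ge0.
have A1 x : 0 < x < e -> `|f x| <= K /\ `|Dr f x| <= K.
  move=> /andP[x0 xe]; have [|k1 _ k2] := ha x; first by rewrite x0 (lt_le_trans xe).
  by split; [exact: le_trans KaK|exact: le_trans KaK].
have A2 x : 1 - e < x < 1 -> `|f x| <= K * (1 + (1 - x) `^ (- alpha)) /\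
    `|Dr f x| <= K * (1 + (1 - x) `^ (- alpha)).
  move=> /andP[xe x1]; have [|k1 k2] := hl x.
    by rewrite x1 (le_lt_trans _ xe)// lerD2l lerN2.
  by split; [apply: (le_trans k1)|apply: (le_trans k2)]; rewrite ler_wpM2r.
have A3 x : 1 < x < 1 + e -> `|f x| <= K * (1 + (x - 1) `^ (- alpha)) /\
    `|Dr f x| <= K * (1 + (x - 1) `^ (- alpha)).
  move=> /andP[x1 xe]; have [|k1 k2] := hr x.
    by rewrite x1 (lt_le_trans xe)// lerD2l.
  by split; [apply: (le_trans k1)|apply: (le_trans k2)]; rewrite ler_wpM2r.
have A4 x : M < x -> `|f x| <= K * x `^ (- s) /\ `|Dr f x| <= K * x `^ (- s).
  move=> /hi[k1 _ k2].
  by split; [apply: (le_trans k1)|apply: (le_trans k2)]; rewrite ler_wpM2r ?powR_ge0.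
split.
- apply: (L2_of_bound halpha hbeta hs e0 K0 f0 f1 (M := M)).
  + by move=> x /A1[].
  + by move=> x /A2[].
  + by move=> x /A3[].
  + by move=> x /A4[].
- apply: (L2_of_bound halpha hbeta hs e0 K0 df0 df1 (M := M)).
  + by move=> x /A1[].
  + by move=> x /A2[].
  + by move=> x /A3[].
  + by move=> x /A4[].
Qed.

(* [D f = (P f')' / w] with this [P] on (0, 1) and the next one on (1, oo), [w] being the
   weight of the inner product. *)
Definition coef01 x := x `^ (beta + 1) * (1 - x) `^ (alpha + 1).
Definition coef1oo x := - (x `^ (beta + 1) * (x - 1) `^ (alpha + 1)).

Lemma powRS a x : 0 < x -> x `^ (a + 1) = x * x `^ a.
Proof. by move=> x0; rewrite -(powRm1 (a + 1) x0) addrK. Qed.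

Lemma P0E x : I0 x -> coef01 x = x * (1 - x) * w0 x.
Proof.
move=> Ix; have x0 := I0gt0 Ix; have x1 : 0 < 1 - x by rewrite subr_gt0 I0lt1.
by rewrite /coef01 /weight01 !powRS//; ring.
Qed.

Lemma P1E x : I1 x -> coef1oo x = x * (1 - x) * w1 x.
Proof.
move=> Ix; have x0 := I1gt0 Ix; have x1 : 0 < x - 1 by rewrite subr_gt0 I1gt1.
by rewrite /coef1oo /weight1oo !powRS//; ring.
Qed.

Lemma is_derive_P0 x : I0 x ->
  is_derive x 1 coef01 (w0 x * (beta + 1 - (alpha + beta + 2) * x)).
Proof.
move=> Ix; have x0 := I0gt0 Ix; have x1 := I0lt1 Ix.
have x1' : 0 < 1 - x by rewrite subr_gt0.
apply: (is_derive_cong (is_deriveM' (is_derive1_powR (beta + 1) x0)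
  (is_derive_1mx (alpha + 1) x1))).
by rewrite !addrK /weight01 !powRS//; ring.
Qed.

Lemma is_derive_P1 x : I1 x ->
  is_derive x 1 coef1oo (w1 x * (beta + 1 - (alpha + beta + 2) * x)).
Proof.
move=> Ix; have x0 := I1gt0 Ix; have x1 := I1gt1 Ix.
have x1' : 0 < x - 1 by rewrite subr_gt0.
apply: (is_derive_cong (is_deriveN' (is_deriveM' (is_derive1_powR (beta + 1) x0)
  (is_derive_xm1 (alpha + 1) x1)))).
by rewrite !addrK /weight1oo !powRS//; ring.
Qed.

Lemma smooth_P0 : smooth (@I0 R) coef01.
Proof.
apply: (smoothM (@I0_open R)).
  by apply: smooth_sub (@smooth_powR R _) => x; exact: I0gt0.
by apply: smooth_sub (@smooth_1mx R _) => x; exact: I0lt1.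
Qed.

Lemma smooth_P1 : smooth (@I1 R) coef1oo.
Proof.
apply: (smoothN (@I1_open R)); apply: (smoothM (@I1_open R)).
  by apply: smooth_sub (@smooth_powR R _) => x; exact: I1gt0.
by apply: smooth_sub (@smooth_xm1 R _) => x; exact: I1gt1.
Qed.

Lemma smooth_w0 : smooth (@I0 R) w0.
Proof.
apply: (smoothM (@I0_open R)).
  by apply: smooth_sub (@smooth_1mx R _) => x; exact: I0lt1.
by apply: smooth_sub (@smooth_powR R _) => x; exact: I0gt0.
Qed.

Lemma smooth_w1 : smooth (@I1 R) w1.
Proof.
apply: (smoothM (@I1_open R)).
  by apply: smooth_sub (@smooth_xm1 R _) => x; exact: I1gt1.
by apply: smooth_sub (@smooth_powR R _) => x; exact: I1gt0.
Qed.

Lemma w0_gt0 x : I0 x -> 0 < w0 x.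
Proof.
by move=> Ix; rewrite mulr_gt0// powR_gt0 ?subr_gt0 ?I0lt1 ?I0gt0.
Qed.

Lemma w1_gt0 x : I1 x -> 0 < w1 x.
Proof.
by move=> Ix; rewrite mulr_gt0// powR_gt0 ?subr_gt0 ?I1gt1 ?I1gt0.
Qed.

Section Side.
Variables (I : set R) (P w : R -> R).
Hypotheses (oI : open I) (iI : is_interval I).
Hypothesis PE : forall x, I x -> P x = x * (1 - x) * w x.
Hypothesis dP : forall x, I x ->
  is_derive x 1 P (w x * (beta + 1 - (alpha + beta + 2) * x)).

Lemma derive_Pd f x : smooth I f -> I x ->
  is_derive x 1 (fun t => P t * derive1 f t) (w x * Dr f x).
Proof.
move=> sf Ix.
apply: (is_derive_cong (is_deriveM' (dP Ix) (smooth_is_derive (smooth_derive1 sf) Ix))).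
rewrite /hypD PE//; move: (derive1 (derive1 f) x) (derive1 f x) (w x) => *; ring.
Qed.

Definition bracket f g x := P x * (derive1 f x * g x - f x * derive1 g x).

Lemma derive_bracket f g x : smooth I f -> smooth I g -> I x ->
  is_derive x 1 (bracket f g) (w x * (Dr f x * g x) - w x * (f x * Dr g x)).
Proof.
move=> sf sg Ix.
have h := is_deriveB' (is_deriveM' (derive_Pd sf Ix) (smooth_is_derive sg Ix))
  (is_deriveM' (smooth_is_derive sf Ix) (derive_Pd sg Ix)).
rewrite (_ : bracket f g = (fun t => P t * derive1 f t * g t - f t * (P t * derive1 g t))).
  apply: (is_derive_cong h).
  move: (Dr f x) (Dr g x) (derive1 f x) (derive1 g x) (w x) (P x) (f x) (g x) => *; ring.
apply/funext => t; rewrite /bracket.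
move: (derive1 f t) (derive1 g t) (P t) (f t) (g t) => *; ring.
Qed.

End Side.
End Green.

(** * Green's formula *)

Section GreenFormula.
Variable R : realType.
Notation mu := (@lebesgue_measure R).
Implicit Types (D I J : set R) (f g h u v w m : R -> R) (a b c d x K e : R).

Variables (alpha beta C s : R).
Hypotheses (halpha : -1 < alpha < 1) (hbeta : -1 < beta) (C0 : 0 < C).
Hypothesis hs : 2 * s > alpha + beta + 1.
Notation w0 := (weight01 alpha beta).
Notation w1 := (weight1oo alpha beta).
Notation Dr := (hypD alpha beta).
Notation ER := (realE alpha C s).
Notation L2sq := (weightedL2 alpha beta).
Notation P0 := (coef01 alpha beta).
Notation P1 := (coef1oo alpha beta).

(** The inner product of H for real functions, C standing for the quotient of sines. *)
Definition wprod f g := rint (@I0 R) (fun x => w0 x * (f x * g x))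
  + C * rint (@I1 R) (fun x => w1 x * (f x * g x)).

Lemma eps_cvg1 (sg : R) : 1 + sg * eps R n @[n --> \oo] --> (1 : R).
Proof.
rewrite -[X in _ --> X]addr0; apply: cvgD; first exact: cvg_cst.
by rewrite -[X in _ --> X](mulr0 sg); apply: cvgMr; exact: eps_cvg.
Qed.

Lemma cont1_cvg (X_ : nat -> R) f : X_ n @[n --> \oo] --> (1 : R) ->
  {for 1, continuous f} -> f (X_ n) @[n --> \oo] --> f 1.
Proof. by move=> X1 cf; exact: (cvg_comp _ _ X1 cf). Qed.

(** The form taken by P (f' g - f g') at distance eps from 1 when f = k u + v m: here k is 1 or C^-1
    and sg is 1 on the left, -1 on the right. As |alpha| < 1, the pure u terms, the mixed derivative
    terms and the pure v terms all carry positive powers of eps; only the terms with m' survive, P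
    m' having a nonzero limit. *)
Lemma bracket_form_cvg (X_ : nat -> R) (sg k : R) (A B E G : R -> R) :
  X_ n @[n --> \oo] --> (1 : R) ->
  {for 1, continuous A} -> {for 1, continuous B} -> {for 1, continuous E} ->
  {for 1, continuous G} ->
  X_ n `^ (beta + 1) * (sg * (k ^+ 2 * (eps R n `^ (alpha + 1) * A (X_ n)) +
    k * (eps R n * B (X_ n)) + eps R n `^ (1 - alpha) * E (X_ n))
    + k * (alpha * G (X_ n))) @[n --> \oo] --> k * (alpha * G 1).
Proof.
move=> X1 cA cB cE cG; have /andP[al au] := halpha.
have l1 : eps R n `^ (alpha + 1) @[n --> \oo] --> 0 by apply: eps_powR_cvg; lra.
have l2 : eps R n `^ (1 - alpha) @[n --> \oo] --> 0 by apply: eps_powR_cvg; lra.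
have l3 := @eps_cvg R.
have p1 : X_ n `^ (beta + 1) @[n --> \oo] --> (1 : R).
  have := cont1_cvg X1 (continuous_powR (a := beta + 1) ltr01).
  by rewrite powR1.
have -> : k * (alpha * G 1) = 1 * (sg * (k ^+ 2 * (0 * A 1) + k * (0 * B 1) + 0 * E 1)
   + k * (alpha * G 1)) by ring.
apply: cvgM p1 _; apply: cvgD; last first.
  by apply: cvgMr; apply: cvgMr; exact: cont1_cvg.
apply: cvgMr; apply: cvgD; [apply: cvgD|].
- by apply: cvgMr; apply: cvgM => //; exact: cont1_cvg.
- by apply: cvgMr; apply: cvgM => //; exact: cont1_cvg.
- by apply: cvgM => //; exact: cont1_cvg.
Qed.

(** P is at most x^(beta + 1), and beta > -1, while f, g and their derivatives stay bounded. *)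
Lemma bracket_zero f g : ER f -> ER g ->
  bracket P0 f g (c0 R n) @[n --> \oo] --> 0.
Proof.
move=> /(ER_near0 beta)[e [K [e0 K0 hf]]] /(ER_near0 beta)[e' [K' [e0' K0' hg]]].
have b1 : 0 < beta + 1 by move: hbeta; lra.
apply: (cvg_le0 (K := 2 * (K * K')) (eps_powR_cvg b1)).
apply: filterS2 (eps_near e0) (eps_near e0') => n ne ne'.
have n0 := eps_gt0 R n; have n1 := eps_lt1 R n.
have [|f0 f1 _] := hf (eps R n); first by rewrite n0.
have [|g0 g1 _] := hg (eps R n); first by rewrite n0.
rewrite /bracket /c0 mulrC normrM; apply: ler_pM => //.
  apply: le_trans (ler_normB _ _) _; rewrite !normrM mulr2n mulrDl mul1r.
  by apply: lerD; [apply: ler_pM|apply: ler_pM].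
rewrite /coef01 ger0_norm ?mulr_ge0 ?powR_ge0// ler_piMr ?powR_ge0//.
have /andP[al _] := halpha.
by apply: powR_le1; [lra|apply/andP; split; lra].
Qed.

(** |P| is at most x^(alpha + beta + 2) and f' g, f g' are of order x^(-2 s - 1): the total exponent
    alpha + beta + 1 - 2 s is negative. *)
Lemma bracket_infty f g : ER f -> ER g ->
  bracket P1 f g (d1 R n) @[n --> \oo] --> 0.
Proof.
move=> /(ER_infty beta)[M [K [M0 K0 hf]]] /(ER_infty beta)[M' [K' [M0' K0' hg]]].
have p0 : 0 < 2 * s - (alpha + beta + 1) by move: hs; lra.
apply: (cvg_le0 (K := 2 * (K * K')) (eps_powR_cvg p0)).
near=> n.
have nM : Num.max M M' < n%:R by near: n; exact: nbhs_infty_gtr.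
have xn : n%:R < d1 R n by rewrite /d1 ltr_nat ltnS leqnSn.
have := lt_trans nM xn; rewrite gt_max => /andP[Mx Mx'].
have [f0 f1 _] := hf _ Mx; have [g0 g1 _] := hg _ Mx'.
have Ix := I1d R n; set x := d1 R n in Mx Mx' f0 f1 g0 g1 Ix *.
have x0 := I1gt0 Ix; have x1 := I1gt1 Ix; have xn0 : x != 0 by rewrite gt_eqF.
have pD p q : x `^ (p + q) = x `^ p * x `^ q by rewrite powRD// xn0 implybT.
have eE : eps R n = x `^ (-1) by rewrite powR_inv1// ltW.
rewrite eE -powRrM.
have -> : -1 * (2 * s - (alpha + beta + 1)) =
  (beta + 1) + (alpha + 1) + (- s + (- (s + 1))) by ring.
rewrite (pD (beta + 1 + (alpha + 1))) (pD (beta + 1)) (pD (- s)).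
rewrite [leRHS](_ : _ = x `^ (beta + 1) * x `^ (alpha + 1) *
  (2 * (K * K') * (x `^ (- s) * x `^ (- (s + 1))))); last by ring.
rewrite /bracket normrM; apply: ler_pM => //.
  rewrite /coef1oo normrN ger0_norm ?mulr_ge0 ?powR_ge0// ler_wpM2l ?powR_ge0//.
  have /andP[al _] := halpha.
  by apply: ge0_ler_powR; rewrite ?nnegrE; lra.
apply: le_trans (ler_normB _ _) _; rewrite !normrM.
rewrite [leRHS](_ : _ = K * x `^ (- (s + 1)) * (K' * x `^ (- s)) +
  K * x `^ (- s) * (K' * x `^ (- (s + 1)))); last by ring.
by apply: lerD; [apply: ler_pM|apply: ler_pM].
Unshelve. all: by end_near. Qed.

Lemma smooth_cont1 u e : 0 < e -> smooth `]1 - e, 1 + e[ u -> {for 1, continuous u}.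
Proof.
by move=> e0 su; apply: (smooth_continuous su); rewrite /= in_itv/= ltrDl e0 ltrBlDr ltrDl e0.
Qed.

(** What survives at 1 is alpha (v u' - u v'), the primed pair belonging to g. It is of degree one
    in the u components, so the factor C^-1 that they carry on the right appears once, and it
    cancels the C in front of the integral over (1, oo). *)
Lemma bracket_one f g : ER f -> ER g -> exists L,
  bracket P0 f g (d0 R n) @[n --> \oo] --> L /\
  bracket P1 f g (c1 R n) @[n --> \oo] --> C^-1 * L.
Proof.
move=> [_ _ [u [v [e e0 [su sv fl fr]]]] _] [_ _ [u' [v' [e' e0' [su' sv' gl gr]]]] _].
have du := smooth_derive1 su; have dv := smooth_derive1 sv.
have du' := smooth_derive1 su'; have dv' := smooth_derive1 sv'.
have cM (p q : R -> R) : {for 1, continuous p} -> {for 1, continuous q} ->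
  {for 1, continuous (fun x => p x * q x)} by move=> cp cq; exact: continuousM.
have cB (p q : R -> R) : {for 1, continuous p} -> {for 1, continuous q} ->
  {for 1, continuous (fun x => p x - q x)} by move=> cp cq; exact: continuousB.
have cD (p q : R -> R) : {for 1, continuous p} -> {for 1, continuous q} ->
  {for 1, continuous (fun x => p x + q x)} by move=> cp cq; exact: continuousD.
have z1 := smooth_cont1 e0 su; have z2 := smooth_cont1 e0 sv.
have z3 := smooth_cont1 e0 du; have z4 := smooth_cont1 e0 dv.
have z1' := smooth_cont1 e0' su'; have z2' := smooth_cont1 e0' sv'.
have z3' := smooth_cont1 e0' du'; have z4' := smooth_cont1 e0' dv'.
pose A x := derive1 u x * u' x - u x * derive1 u' x.
pose B x := (derive1 u x * v' x - u x * derive1 v' x) +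
            (derive1 v x * u' x - v x * derive1 u' x).
pose E x := derive1 v x * v' x - v x * derive1 v' x.
pose G x := v x * u' x - u x * v' x.
have cA : {for 1, continuous A} by apply: cB; exact: cM.
have cB' : {for 1, continuous B} by apply: cD; apply: cB; exact: cM.
have cE : {for 1, continuous E} by apply: cB; exact: cM.
have cG : {for 1, continuous G} by apply: cB; exact: cM.
exists (1 * (alpha * G 1)); split.
- have X1 : d0 R n @[n --> \oo] --> (1 : R).
    have := eps_cvg1 (-1); by under eq_fun do rewrite mulN1r.
  have H := @bracket_form_cvg (d0 R) 1 1 A B E G X1 cA cB' cE cG.
  apply: cvg_trans H; apply: near_eq_cvg; near=> n.
  have ne : eps R n < e by near: n; exact: eps_near.
  have ne' : eps R n < e' by near: n; exact: eps_near.
  have n0 := eps_gt0 R n.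
  set x := d0 R n.
  have tx : 1 - x = eps R n by rewrite /x /d0; ring.
  have x1 : x < 1 by rewrite /x /d0; lra.
  pose J := `]Num.max (1 - e) (1 - e'), 1[%classic : set R.
  have oJ : open J by exact: interval_open.
  have Jx : J x.
    by rewrite /J /= in_itv/= x1 gt_max /x /d0 andbT; apply/andP; split; lra.
  have sub y : J y -> 1 - e < y < 1 /\ 1 - e' < y < 1.
    by rewrite /J /= in_itv/= gt_max => /andP[/andP[-> ->] ->].
  have s1 : J `<=` (`]1 - e, 1 + e[%classic : set R).
    by move=> y /sub[/andP[y1 y2] _]; rewrite /= in_itv/= y1/= (lt_le_trans y2)// lerDl ltW.
  have s2 : J `<=` (`]1 - e', 1 + e'[%classic : set R).
    by move=> y /sub[_ /andP[y1 y2]]; rewrite /= in_itv/= y1/= (lt_le_trans y2)// lerDl ltW.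
  pose m t : R := (1 - t) `^ (- alpha).
  have sm : smooth J m.
    by apply: smooth_sub (@smooth_1mx R (- alpha)) => y /sub[/andP[]].
  have fE y : J y -> f y = 1 * u y + v y * m y by move=> /sub[h _]; rewrite mul1r; exact: fl.
  have gE y : J y -> g y = 1 * u' y + v' y * m y by move=> /sub[_ h]; rewrite mul1r; exact: gl.
  have [f' _] := Dr_local alpha beta oJ (smooth_sub s1 su) (smooth_sub s1 sv) sm fE Jx.
  have [g' _] := Dr_local alpha beta oJ (smooth_sub s2 su') (smooth_sub s2 sv') sm gE Jx.
  have m' : derive1 m x = alpha * (eps R n) `^ (- alpha - 1).
    by rewrite (is_derive_derive1 (is_derive_1mx (- alpha) x1)) opprK tx.
  rewrite /bracket f' g' fE// gE// m' /m /coef01 tx.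
  set t := eps R n in n0 *.
  (* The power in P is inverse to the one in m'; the other powers of eps are expressed through the
     latter, which leaves a rational identity. *)
  have E1 : t `^ (alpha + 1) * t `^ (- alpha - 1) = 1.
    rewrite -powRD ?(gt_eqF n0) ?implybT//.
    by have -> : alpha + 1 + (- alpha - 1) = 0; [ring|rewrite powRr0].
  have E2 : t `^ (- alpha) = t * t `^ (- alpha - 1) by rewrite powRm1.
  have E3 : t `^ (1 - alpha) = t * t * t `^ (- alpha - 1).
    by rewrite -mulrA -E2 -powRS// addrC.
  rewrite E2 E3 /A /B /E /G.
  set T := t `^ (alpha + 1) in E1 *; set S := t `^ (- alpha - 1) in E1 *.
  set X := x `^ (beta + 1).
  move: (derive1 u x) (derive1 v x) (derive1 u' x) (derive1 v' x) (u x) (v x) (u' x) (v' x).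
  move: X T S E1 {f' g' m' E2 E3}; clearbody t => X T S E1 a1 a2 a3 a4 b1 b2 b3 b4.
  have -> : S = T^-1.
    have T0 : T != 0 by apply: contra_eq_neq E1 => ->; rewrite mul0r eq_sym oner_eq0.
    by rewrite -[LHS]mul1r -(mulVf T0) -mulrA E1 mulr1.
  have T0 : T != 0 by apply: contra_eq_neq E1 => ->; rewrite mul0r eq_sym oner_eq0.
  by field.
- have X1 : c1 R n @[n --> \oo] --> (1 : R).
    have := eps_cvg1 1; by under eq_fun do rewrite mul1r.
  have H := @bracket_form_cvg (c1 R) (-1) C^-1 A B E G X1 cA cB' cE cG.
  rewrite mul1r.
  apply: cvg_trans H; apply: near_eq_cvg; near=> n.
  have ne : eps R n < e by near: n; exact: eps_near.
  have ne' : eps R n < e' by near: n; exact: eps_near.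
  have n0 := eps_gt0 R n.
  set x := c1 R n.
  have tx : x - 1 = eps R n by rewrite /x /c1; ring.
  have x1 : 1 < x by rewrite /x /c1; lra.
  pose J := `]1, Num.min (1 + e) (1 + e')[%classic : set R.
  have oJ : open J by exact: interval_open.
  have Jx : J x.
    by rewrite /J /= in_itv/= x1 lt_min /x /c1; apply/andP; split; lra.
  have sub y : J y -> 1 < y < 1 + e /\ 1 < y < 1 + e'.
    by rewrite /J /= in_itv/= lt_min => /andP[-> /andP[-> ->]].
  have s1 : J `<=` (`]1 - e, 1 + e[%classic : set R).
    by move=> y /sub[/andP[y1 y2] _]; rewrite /= in_itv/= y2 andbT (le_lt_trans _ y1)// lerBlDr lerDl ltW.
  have s2 : J `<=` (`]1 - e', 1 + e'[%classic : set R).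
    by move=> y /sub[_ /andP[y1 y2]]; rewrite /= in_itv/= y2 andbT (le_lt_trans _ y1)// lerBlDr lerDl ltW.
  pose m t : R := (t - 1) `^ (- alpha).
  have sm : smooth J m.
    by apply: smooth_sub (@smooth_xm1 R (- alpha)) => y /sub[/andP[]].
  have fE y : J y -> f y = C^-1 * u y + v y * m y by move=> /sub[h _]; exact: fr.
  have gE y : J y -> g y = C^-1 * u' y + v' y * m y by move=> /sub[_ h]; exact: gr.
  have [f' _] := Dr_local alpha beta oJ (smooth_sub s1 su) (smooth_sub s1 sv) sm fE Jx.
  have [g' _] := Dr_local alpha beta oJ (smooth_sub s2 su') (smooth_sub s2 sv') sm gE Jx.
  have m' : derive1 m x = - alpha * (eps R n) `^ (- alpha - 1).
    by rewrite (is_derive_derive1 (is_derive_xm1 (- alpha) x1)) tx.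
  rewrite /bracket f' g' fE// gE// m' /m /coef1oo tx.
  set t := eps R n in n0 *.
  have E1 : t `^ (alpha + 1) * t `^ (- alpha - 1) = 1.
    rewrite -powRD ?(gt_eqF n0) ?implybT//.
    by have -> : alpha + 1 + (- alpha - 1) = 0; [ring|rewrite powRr0].
  have E2 : t `^ (- alpha) = t * t `^ (- alpha - 1) by rewrite powRm1.
  have E3 : t `^ (1 - alpha) = t * t * t `^ (- alpha - 1).
    by rewrite -mulrA -E2 -powRS// addrC.
  rewrite E2 E3 /A /B /E /G.
  set T := t `^ (alpha + 1) in E1 *; set S := t `^ (- alpha - 1) in E1 *.
  set X := x `^ (beta + 1).
  move: (derive1 u x) (derive1 v x) (derive1 u' x) (derive1 v' x) (u x) (v x) (u' x) (v' x).
  move: X T S E1 {f' g' m' E2 E3}; clearbody t => X T S E1 a1 a2 a3 a4 b1 b2 b3 b4.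
  have T0 : T != 0 by apply: contra_eq_neq E1 => ->; rewrite mul0r eq_sym oner_eq0.
  have -> : S = T^-1.
    by rewrite -[LHS]mul1r -(mulVf T0) -mulrA E1 mulr1.
  have C0' : C != 0 by rewrite gt_eqF.
  by field; rewrite T0 C0'.
Unshelve. all: by end_near. Qed.

Lemma L2sq_prod0 f g : L2sq f -> L2sq g -> L1 (@I0 R) (fun x => w0 x * (f x * g x)).
Proof.
move=> [mf _ hf _] [mg _ hg _]; apply: L1_prod => //; first exact: I0_meas.
  exact: measurable_weight01.
exact: weight01_ge0.
Qed.

Lemma L2sq_prod1 f g : L2sq f -> L2sq g -> L1 (@I1 R) (fun x => w1 x * (f x * g x)).
Proof.
move=> [_ mf _ hf] [_ mg _ hg]; apply: L1_prod => //; first exact: I1_meas.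
  exact: measurable_weight1oo.
exact: weight1oo_ge0.
Qed.

Lemma exhaust0 h F l l' : L1 (@I0 R) h -> (forall x, I0 x -> is_derive x 1 F (h x)) ->
  (forall x, I0 x -> {for x, continuous h}) ->
  F (c0 R n) @[n --> \oo] --> l -> F (d0 R n) @[n --> \oo] --> l' ->
  rint (@I0 R) h = l' - l.
Proof.
move=> hh dF ch cl cl'.
have sub n : `[c0 R n, d0 R n]%classic `<=` @I0 R by exact: (itv_sub (@I0_itv R) (I0c R n) (I0d R n)).
have ex x : I0 x -> \forall n \near \oo, c0 R n <= x <= d0 R n.
  by move=> /I0_ex; apply: filterS => n /andP[? ?]; rewrite !ltW.
have H := rint_exhaust (@I0_meas R) hh sub ex.
have H' : rint `[c0 R n, d0 R n] h @[n --> \oo] --> l' - l.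
  apply: cvg_trans (cvgB cl' cl); apply: near_eq_cvg; apply: nearW => n /=.
  apply/esym; apply: (FTC2I (@I0_itv R) (I0c R n) (I0d R n) _ dF ch).
  (* The shift by 2 in [eps] puts the end points in the right order already for n = 0. *)
  have h2 : eps R n <= 2^-1 by rewrite /eps lef_pV2 ?posrE ?ltr0n// ler_nat.
  by rewrite /c0 /d0; lra.
exact: (cvg_unique _ H H').
Qed.

Lemma exhaust1 h F l l' : L1 (@I1 R) h -> (forall x, I1 x -> is_derive x 1 F (h x)) ->
  (forall x, I1 x -> {for x, continuous h}) ->
  F (c1 R n) @[n --> \oo] --> l -> F (d1 R n) @[n --> \oo] --> l' ->
  rint (@I1 R) h = l' - l.
Proof.
move=> hh dF ch cl cl'.
have sub n : `[c1 R n, d1 R n]%classic `<=` @I1 R by exact: (itv_sub (@I1_itv R) (I1c R n) (I1d R n)).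
have ex x : I1 x -> \forall n \near \oo, c1 R n <= x <= d1 R n.
  by move=> /I1_ex; apply: filterS => n /andP[? ?]; rewrite !ltW.
have H := rint_exhaust (@I1_meas R) hh sub ex.
have H' : rint `[c1 R n, d1 R n] h @[n --> \oo] --> l' - l.
  apply: cvg_trans (cvgB cl' cl); apply: near_eq_cvg; apply: nearW => n /=.
  apply/esym; apply: (FTC2I (@I1_itv R) (I1c R n) (I1d R n) _ dF ch).
  have := eps_lt1 R n; rewrite /c1 /d1 => /ltW h1.
  apply: (@le_trans _ _ (1 + 1)); first by rewrite lerD2l.
  by rewrite -(natrD R 1 1) ler_nat.
exact: (cvg_unique _ H H').
Qed.

Theorem green f g : ER f -> ER g -> wprod (Dr f) g = wprod f (Dr g).
Proof.
move=> Ef Eg.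
have [Lf LDf] := ER_L2sq halpha hbeta C0 hs Ef.
have [Lg LDg] := ER_L2sq halpha hbeta C0 hs Eg.
have [L [l0 l1]] := bracket_one Ef Eg.
have [cf0 cdf0] := ER_cont0 beta Ef; have [cg0 cdg0] := ER_cont0 beta Eg.
have [cf1 cdf1] := ER_cont1 beta Ef; have [cg1 cdg1] := ER_cont1 beta Eg.
have sw0 := @smooth_w0 R alpha beta; have sw1 := @smooth_w1 R alpha beta.
have E0 : rint (@I0 R) (fun x => w0 x * (Dr f x * g x) - w0 x * (f x * Dr g x)) = L - 0.
  apply: (exhaust0 _ _ _ (bracket_zero Ef Eg) l0).
  - by apply: L1B; [exact: I0_meas|exact: L2sq_prod0|exact: L2sq_prod0].
  - move=> x Ix; exact: (derive_bracket (@P0E R alpha beta)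
      (@is_derive_P0 R alpha beta) (ER_smooth0 Ef) (ER_smooth0 Eg) Ix).
  - move=> x Ix; have cw := smooth_continuous sw0 Ix.
    exact: (continuousB (continuousM cw (continuousM (cdf0 x Ix) (cg0 x Ix)))
      (continuousM cw (continuousM (cf0 x Ix) (cdg0 x Ix)))).
have E1 : rint (@I1 R) (fun x => w1 x * (Dr f x * g x) - w1 x * (f x * Dr g x)) = 0 - C^-1 * L.
  apply: (exhaust1 _ _ _ l1 (bracket_infty Ef Eg)).
  - by apply: L1B; [exact: I1_meas|exact: L2sq_prod1|exact: L2sq_prod1].
  - move=> x Ix; exact: (derive_bracket (@P1E R alpha beta)
      (@is_derive_P1 R alpha beta) (ER_smooth1 Ef) (ER_smooth1 Eg) Ix).
  - move=> x Ix; have cw := smooth_continuous sw1 Ix.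
    exact: (continuousB (continuousM cw (continuousM (cdf1 x Ix) (cg1 x Ix)))
      (continuousM cw (continuousM (cf1 x Ix) (cdg1 x Ix)))).
move: E0; rewrite rintB; [|exact: I0_meas|exact: L2sq_prod0|exact: L2sq_prod0] => E0.
move: E1; rewrite rintB; [|exact: I1_meas|exact: L2sq_prod1|exact: L2sq_prod1] => E1.
apply/eqP; rewrite -subr_eq0 /wprod; apply/eqP.
rewrite opprD addrACA -mulrBr E0 E1.
have C0' : C != 0 by rewrite gt_eqF.
by field.
Qed.

End GreenFormula.

(** * The deficiency equation on one interval *)

Section EigenSide.
Variable R : realType.
Notation mu := (@lebesgue_measure R).
Implicit Types (D J : set R) (f g h u v m y z phi eta : R -> R) (a b c d x K e : R).

Variables (alpha beta : R).
Notation Dr := (hypD alpha beta).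

(** Both intervals are treated at once: (P, w) is ([coef01], [weight01]) on (0, 1) and ([coef1oo],
    [weight1oo]) on (1, oo). *)
Variables (I : set R) (P w : R -> R).
Hypotheses (oI : open I) (iI : is_interval I).
Variables (c_ d_ : nat -> R).
Hypotheses (Ic : forall n, I (c_ n)) (Id : forall n, I (d_ n)).
Hypothesis exI : forall x, I x -> \forall n \near \oo, c_ n < x < d_ n.
Hypothesis I1n : forall x, I x -> x != 0 /\ x != 1.
Hypothesis PE : forall x, I x -> P x = x * (1 - x) * w x.
Hypothesis dP : forall x, I x ->
  is_derive x 1 P (w x * (beta + 1 - (alpha + beta + 2) * x)).
Hypotheses (sP : smooth I P) (sw : smooth I w).
Hypothesis w0 : forall x, I x -> 0 < w x.
Hypothesis w_ge0 : forall x, 0 <= w x.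

Let mI : meas I. Proof. exact: open_measurable. Qed.

Lemma side_P_neq0 x : I x -> P x != 0.
Proof.
move=> Ix; have [x0 x1] := I1n Ix; rewrite PE// !mulf_neq0//.
  by rewrite subr_eq0 eq_sym.
by rewrite gt_eqF// w0.
Qed.

Lemma side_cont_w x : I x -> {for x, continuous w}.
Proof. by move=> Ix; exact: (smooth_continuous sw). Qed.

Lemma side_mw : mfun I w.
Proof. by apply: cont_meas => // x; exact: side_cont_w. Qed.

Lemma L1loc_wy y : mfun I y -> L1 I (fun x => w x * y x ^+ 2) ->
  L1loc I (fun x => w x * y x).
Proof.
move=> my hy c d hc hd.
have sub := itv_sub iI hc hd.
have mE : meas (`[c, d]%classic : set R) by exact: measurable_itv.
apply: (@L1_le _ _ _ (fun x => w x + w x * y x ^+ 2)) => //.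
- by apply: (measurable_funS mI sub); apply: measurable_funM => //; exact: side_mw.
- move=> x xcd; rewrite normrM (ger0_norm (w_ge0 x)) -{2}[w x]mulr1 -mulrDr ler_wpM2l//.
  rewrite -(real_normK (num_real (y x))).
  have := sqr_ge0 (`|y x| - 1); have := normr_ge0 (y x); rewrite !expr2; nra.
- apply: L1D => //; last exact: (L1S _ _ sub hy).
  by apply: (L1loc_cont iI) => // x; exact: side_cont_w.
Qed.

Lemma L1loc_y y : mfun I y -> L1 I (fun x => w x * y x ^+ 2) -> L1loc I y.
Proof.
move=> my hy c d hc hd.
have sub := itv_sub iI hc hd.
have mE : meas (`[c, d]%classic : set R) by exact: measurable_itv.
have cV x : c <= x <= d -> {for x, continuous (fun t => (w t)^-1)}.
  move=> xcd; have Ix : I x by apply: sub; rewrite /= in_itv.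
  by apply: continuousV; [rewrite gt_eqF// w0|exact: side_cont_w].
have [K K0 hK] := cont_bounded cV.
apply: (@L1_eq _ _ (fun x => (w x)^-1 * (w x * y x))) => //.
  by move=> x xcd; rewrite mulKf// gt_eqF// w0//; exact: sub.
apply: (@L1M _ _ _ _ K) => //; last exact: L1loc_wy.
apply: L1_meas => //; exact: L1_cont.
Qed.

(* [D Y1 = Y2] and [D Y2 = - Y1] as a first order system, with [q_i = P Y_i']. *)
Definition eig (Y1 Y2 q1 q2 : R -> R) := forall x, I x ->
  [/\ is_derive x 1 Y1 (q1 x / P x), is_derive x 1 Y2 (q2 x / P x),
      is_derive x 1 q1 (w x * Y2 x) & is_derive x 1 q2 (- (w x * Y1 x))].

(** The weak form of D y = z on one interval, blind to what happens at its end points. *)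
Definition sweak y z := forall phi, test I phi ->
  rint I (fun x => w x * (Dr phi x * y x)) = rint I (fun x => w x * (phi x * z x)).

Lemma sweak_reg y z : mfun I y -> mfun I z -> L1 I (fun x => w x * y x ^+ 2) ->
  L1 I (fun x => w x * z x ^+ 2) -> sweak y z ->
  exists Y q : R -> R,
    [/\ forall x, I x -> is_derive x 1 Y (q x / P x),
        forall c d, I c -> I d -> c <= d -> q d - q c = rint `[c, d] (fun x => w x * z x),
        forall x, I x -> {for x, continuous q} &
        {ae mu, forall x, I x -> y x = Y x}].
Proof.
move=> my mz hy hz H.
apply: (weak_regularity oI iI Ic Id exI sP side_P_neq0 (L1loc_y my hy) (L1loc_wy mz hz)).
move=> phi tp; have := H phi tp.
have sp : smooth I phi by apply: smooth_sub tp.1.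
rewrite (rint_eq (g := fun x => derive1 (fun t => P t * derive1 phi t) x * y x)); last first.
  by move=> x Ix; rewrite (is_derive_derive1 (derive_Pd PE dP sp Ix)) mulrA.
by move=> ->; apply: rint_eq => x _; ring.
Qed.

Lemma rint_itv_ae y Y c d : I c -> I d -> mfun I y -> (forall x, I x -> {for x, continuous Y}) ->
  {ae mu, forall x, I x -> y x = Y x} ->
  rint `[c, d] (fun x => w x * y x) = rint `[c, d] (fun x => w x * Y x).
Proof.
move=> hc hd my cY ae.
have sub := itv_sub iI hc hd.
have mE : meas (`[c, d]%classic : set R) by exact: measurable_itv.
apply: rint_ae => //.
- by apply: (measurable_funS mI sub); apply: measurable_funM => //; exact: side_mw.
- apply: (measurable_funS mI sub); apply: measurable_funM; first exact: side_mw.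
  exact: cont_meas.
- apply: (@filterS _ _ (ae_filter_ringOfSetsType mu) _ _ _ ae) => x h xcd.
  by rewrite h//; exact: sub.
Qed.

(** Regularity gives continuous representatives Y1, Y2. The increments of each q are integrals of w
    times the other function; with that function replaced by its continuous representative, q
    becomes differentiable everywhere. *)
Lemma eig_exists y1 y2 : mfun I y1 -> mfun I y2 ->
  L1 I (fun x => w x * y1 x ^+ 2) -> L1 I (fun x => w x * y2 x ^+ 2) ->
  sweak y1 y2 -> sweak y2 (fun x => - y1 x) ->
  exists Y1 Y2 q1 q2, [/\ eig Y1 Y2 q1 q2,
    {ae mu, forall x, I x -> y1 x = Y1 x} & {ae mu, forall x, I x -> y2 x = Y2 x}].
Proof.
move=> m1 m2 h1 h2 W1 W2.
have m1' : mfun I (fun x => - y1 x) by exact: measurableT_comp.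
have h1' : L1 I (fun x => w x * (- y1 x) ^+ 2).
  by apply: (L1_eq mI _ h1) => x _; rewrite sqrrN.
have [Y1 [q1 [dY1 Q1 cq1 ae1]]] := sweak_reg m1 m2 h1 h2 W1.
have [Y2 [q2 [dY2 Q2 cq2 ae2]]] := sweak_reg m2 m1' h2 h1' W2.
have cY1 x : I x -> {for x, continuous Y1} by move=> /dY1 /is_derive_continuous.
have cY2 x : I x -> {for x, continuous Y2} by move=> /dY2 /is_derive_continuous.
exists Y1, Y2, q1, q2; split => // x Ix.
have cw := @side_cont_w.
have cwY2 t : I t -> {for t, continuous (fun x => w x * Y2 x)}.
  by move=> It; apply: continuousM; [exact: cw|exact: cY2].
have cwY1 t : I t -> {for t, continuous (fun x => w x * - Y1 x)}.
  move=> It; apply: continuousM; first exact: cw.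
  by apply: continuousN; exact: cY1.
split; [exact: dY1|exact: dY2| |].
- apply: (primL1_derive oI iI (L1loc_cont iI cwY2) _ Ix (cwY2 _ Ix)).
  by move=> c d hc hd cd; rewrite Q1// (rint_itv_ae hc hd m2 cY2 ae2).
- rewrite -mulrN.
  apply: (primL1_derive oI iI (L1loc_cont iI cwY1) _ Ix (cwY1 _ Ix)).
  move=> c d hc hd cd; rewrite Q2// (@rint_itv_ae _ (fun x => - Y1 x) c d hc hd m1')//.
    by move=> t It; apply: continuousN; exact: cY1.
  apply: (@filterS _ _ (ae_filter_ringOfSetsType mu) _ _ _ ae1) => t ht It.
  by rewrite ht.
Qed.

Section EigProps.
Variables (Y1 Y2 q1 q2 : R -> R).
Hypothesis E : eig Y1 Y2 q1 q2.

(** For Y = Y1 + i Y2 and q = q1 + i q2, [wronsk] and [pairing] are the imaginary and the real part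
    of conj(q) Y, and [sqlen] is |Y|^2. Hence [wronsk_sqr]. *)
Definition wronsk x := q1 x * Y2 x - Y1 x * q2 x.
Definition pairing x := q1 x * Y1 x + q2 x * Y2 x.
Definition sqlen x := Y1 x ^+ 2 + Y2 x ^+ 2.

Lemma derive_wronsk x : I x -> is_derive x 1 wronsk (w x * sqlen x).
Proof.
move=> Ix; have [d1 d2 d3 d4] := E Ix; have coef01 := side_P_neq0 Ix.
apply: (is_derive_cong (is_deriveB' (is_deriveM' d3 d2) (is_deriveM' d1 d4))).
by rewrite /sqlen; field.
Qed.

Lemma derive_pairing x : I x ->
  is_derive x 1 pairing ((q1 x ^+ 2 + q2 x ^+ 2) / P x).
Proof.
move=> Ix; have [d1 d2 d3 d4] := E Ix; have coef01 := side_P_neq0 Ix.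
apply: (is_derive_cong (is_deriveD' (is_deriveM' d3 d1) (is_deriveM' d4 d2))).
by field.
Qed.

Lemma derive_sqlen x : I x -> is_derive x 1 sqlen (2 * pairing x / P x).
Proof.
move=> Ix; have [d1 d2 _ _] := E Ix; have coef01 := side_P_neq0 Ix.
apply: (is_derive_cong (is_deriveD' (is_deriveX' 2 d1) (is_deriveX' 2 d2))).
by rewrite /pairing /= !expr1; field.
Qed.

Lemma wronsk_sqr x : wronsk x ^+ 2 <= (q1 x ^+ 2 + q2 x ^+ 2) * sqlen x.
Proof.
rewrite -subr_ge0 [leRHS](_ : _ = pairing x ^+ 2) ?sqr_ge0//.
by rewrite /wronsk /pairing /sqlen; ring.
Qed.

Lemma sqlen_ge0 x : 0 <= sqlen x.
Proof. by rewrite addr_ge0 ?sqr_ge0. Qed.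

Lemma wronsk_nd c d : I c -> I d -> c <= d -> wronsk c <= wronsk d.
Proof.
move=> hc hd; apply: (derive_ge0_nd iI (f := fun x => w x * sqlen x)) => //.
- exact: derive_wronsk.
- by move=> x Ix; rewrite mulr_ge0 ?sqlen_ge0.
Qed.

Lemma eig_cont x : I x -> [/\ {for x, continuous Y1}, {for x, continuous Y2},
  {for x, continuous q1} & {for x, continuous q2}].
Proof.
by move=> /E[/is_derive_continuous ? /is_derive_continuous ?
  /is_derive_continuous ? /is_derive_continuous ?].
Qed.

Lemma cont_wsqlen x : I x -> {for x, continuous (fun t => w t * sqlen t)}.
Proof.
move=> Ix; have [cY1 cY2 _ _] := eig_cont Ix.
apply: continuousM; first exact: side_cont_w.
by apply: continuousD; apply: continuousM.
Qed.

(** An increment of W is an integral of w (y1^2 + y2^2), at most its integral over the whole of [I].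
    This is how square integrability enters. *)
Lemma wronsk_bounded y1 y2 : mfun I y1 -> mfun I y2 ->
  L1 I (fun x => w x * y1 x ^+ 2) -> L1 I (fun x => w x * y2 x ^+ 2) ->
  {ae mu, forall x, I x -> y1 x = Y1 x} -> {ae mu, forall x, I x -> y2 x = Y2 x} ->
  exists2 A : R, 0 <= A & forall c d, I c -> I d -> c <= d -> wronsk d - wronsk c <= A.
Proof.
move=> m1 m2 h1 h2 ae1 ae2.
pose k x := w x * y1 x ^+ 2 + w x * y2 x ^+ 2.
have k0 x : 0 <= k x by rewrite addr_ge0// mulr_ge0// sqr_ge0.
have hk : L1 I k by exact: L1D.
exists (rint I k); first by apply: rint_ge0.
move=> c d hc hd cd; have sub := itv_sub iI hc hd.
have mE : meas (`[c, d]%classic : set R) by exact: measurable_itv.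
rewrite -(FTC2I iI hc hd cd derive_wronsk cont_wsqlen).
have -> : rint `[c, d] (fun x => w x * sqlen x) = rint `[c, d] k.
  apply: rint_ae => //.
  - by apply: (measurable_funS mI sub); apply: cont_meas => // x; exact: cont_wsqlen.
  - by apply: (measurable_funS mI sub); exact: L1_meas hk.
  - apply: (@filterS2 _ _ (ae_filter_ringOfSetsType mu) _ _ _ _ ae1 ae2) => x e1 e2 xcd.
    by rewrite /k /sqlen e1 ?e2 ?mulrDr//; exact: sub.
rewrite -lee_fin -!rint_EFin//; last exact: (L1S _ _ sub hk).
apply: ge0_subset_integral => //.
  by apply/measurable_EFinP; exact: L1_meas hk.
by move=> x _; rewrite lee_fin.
Qed.

Lemma wronsk0_sqlen : (forall x, I x -> wronsk x = 0) -> forall x, I x -> Y1 x = 0 /\ Y2 x = 0.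
Proof.
move=> W0 x Ix.
have h : w x * sqlen x = 0.
  rewrite -(is_derive_derive1 (derive_wronsk Ix)).
  by rewrite (derive1_eq_on oI W0 Ix) (is_derive_derive1 (is_derive_c 0 x)).
have : sqlen x = 0.
  by move/eqP: h; rewrite mulf_eq0 gt_eqF ?w0//= => /eqP.
move/eqP; rewrite paddr_eq0 ?sqr_ge0// !sqrf_eq0.
by move=> /andP[/eqP -> /eqP ->].
Qed.

End EigProps.

(** Green's formula for a member of E against a weak solution. No individual boundary limit is
    assumed to exist; choosing [phi] to vanish near one end isolates the other. *)
Lemma boundary_cvg phi y z Y q Z : smooth I phi -> mfun I phi -> mfun I (Dr phi) ->
  mfun I y -> mfun I z ->
  L1 I (fun x => w x * phi x ^+ 2) -> L1 I (fun x => w x * (Dr phi x) ^+ 2) ->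
  L1 I (fun x => w x * y x ^+ 2) -> L1 I (fun x => w x * z x ^+ 2) ->
  {ae mu, forall x, I x -> y x = Y x} -> {ae mu, forall x, I x -> z x = Z x} ->
  (forall x, I x -> is_derive x 1 Y (q x / P x)) ->
  (forall x, I x -> is_derive x 1 q (w x * Z x)) ->
  (forall x, I x -> {for x, continuous Z}) ->
  let F x := P x * derive1 phi x * Y x - phi x * q x in
  F (d_ n) - F (c_ n) @[n --> \oo] -->
    rint I (fun x => w x * (Dr phi x * y x)) - rint I (fun x => w x * (phi x * z x)).
Proof.
move=> sp mp mDp my mz hp hDp hy hz aey aez dY dq cZ F.
have lp1 := L1_prod mI side_mw mDp my w_ge0 hDp hy.
have lp2 := L1_prod mI side_mw mp mz w_ge0 hp hz.
pose h x := w x * (Dr phi x * Y x) - w x * (phi x * Z x).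
have dF x : I x -> is_derive x 1 F (h x).
  move=> Ix; have coef01 := side_P_neq0 Ix.
  apply: (is_derive_cong (is_deriveB' (is_deriveM' (derive_Pd PE dP sp Ix) (dY x Ix))
    (is_deriveM' (smooth_is_derive sp Ix) (dq x Ix)))).
  rewrite /h; move: (Dr phi x) (derive1 phi x) (w x) (P x) coef01 => *; field.
  by [].
have cY x : I x -> {for x, continuous Y} by move=> /dY /is_derive_continuous.
have ch x : I x -> {for x, continuous h}.
  move=> Ix; have cw := side_cont_w Ix.
  exact: (continuousB
    (continuousM cw (continuousM (Dr_continuous oI sp Ix) (cY x Ix)))
    (continuousM cw (continuousM (smooth_continuous sp Ix) (cZ x Ix)))).
have ae_h : {ae mu, forall x, I x -> w x * (Dr phi x * y x) - w x * (phi x * z x) = h x}.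
  apply: (@filterS2 _ _ (ae_filter_ringOfSetsType mu) _ _ _ _ aey aez) => x e1 e2 Ix.
  by rewrite e1// e2.
have mh := cont_meas oI ch.
have lyz : L1 I (fun x => w x * (Dr phi x * y x) - w x * (phi x * z x)) by exact: L1B.
have hh : L1 I h by exact: (L1_ae mI mh ae_h lyz).
rewrite -rintB// (rint_ae mI (L1_meas mI lyz) mh ae_h).
have sub n : `[c_ n, d_ n]%classic `<=` I by exact: itv_sub.
have ex x : I x -> \forall n \near \oo, c_ n <= x <= d_ n.
  by move=> /exI; apply: filterS => n /andP[? ?]; rewrite !ltW.
have H := rint_exhaust mI hh sub ex.
apply: cvg_trans H; apply: near_eq_cvg.
have := ex _ (Ic 0%N); apply: filterS => n /andP[n1 n2] /=.
apply: (FTC2I iI (Ic n) (Id n) _ dF ch).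
exact: le_trans n2.
Qed.

End EigenSide.

(** * Logarithmic growth against boundedness *)

Section LogContradiction.
Variable R : realType.
Implicit Types (B b : R -> R) (x c A : R).

(** B - c ln is nondecreasing, so B has gained at least A + 1 at x0 exp((A + 1) / c). *)
Lemma log_growth_contra B b x0 c A : 0 < x0 -> 0 < c -> 0 <= A ->
  (forall x, x0 <= x -> is_derive x 1 B (b x)) ->
  (forall x, x0 <= x -> c / x <= b x) ->
  (forall x, x0 <= x -> B x - B x0 <= A) -> False.
Proof.
move=> x00 c0 A0 dB cb BA.
pose J := `[x0, +oo[%classic : set R.
have JE x : J x <-> x0 <= x by rewrite /J /= in_itv/= andbT.
have iJ : is_interval J by exact: interval_is_interval.
have dF x : J x -> is_derive x 1 (fun t => B t - c * ln t) (b x - c * x^-1).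
  move=> /JE xx; have x0' : 0 < x by exact: lt_le_trans xx.
  exact: (is_deriveB' (dB x xx) (is_deriveZ' c (is_derive1_ln x0'))).
have F0 x : J x -> 0 <= b x - c * x^-1 by move=> /JE xx; rewrite subr_ge0 cb.
pose t := (A + 1) / c; pose x := x0 * expR t.
have t0 : 0 <= t by rewrite divr_ge0 ?addr_ge0// ltW.
have xx : x0 <= x.
  have e1 : 1 <= expR t by rewrite (le_trans _ (expR_ge1Dx t))// lerDl.
  by rewrite /x ler_peMr// ltW.
have Jx0 : J x0 by apply/JE.
have Jx : J x by apply/JE.
have := derive_ge0_nd iJ dF F0 Jx0 Jx xx.
rewrite /x lnM ?posrE ?expR_gt0// expRK mulrDr /t (mulrCA c) divff ?gt_eqF// mulr1 => h.
by have := BA x xx; rewrite -/x in h *; lra.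
Qed.

(** The same towards 0: B has dropped by at least A + 1 at x0 exp(- (A + 1) / c). *)
Lemma log_growth_contra0 B b x0 c A : 0 < x0 -> 0 < c -> 0 <= A ->
  (forall x, 0 < x <= x0 -> is_derive x 1 B (b x)) ->
  (forall x, 0 < x <= x0 -> c / x <= b x) ->
  (forall x, 0 < x <= x0 -> B x0 - B x <= A) -> False.
Proof.
move=> x00 c0 A0 dB cb BA.
pose J := `]0, x0]%classic : set R.
have JE x : J x <-> 0 < x <= x0 by rewrite /J /= in_itv/=.
have iJ : is_interval J by exact: interval_is_interval.
have dF x : J x -> is_derive x 1 (fun t => B t - c * ln t) (b x - c * x^-1).
  move=> /JE xx; have /andP[x0' _] := xx.
  exact: (is_deriveB' (dB x xx) (is_deriveZ' c (is_derive1_ln x0'))).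
have F0 x : J x -> 0 <= b x - c * x^-1 by move=> /JE xx; rewrite subr_ge0 cb.
pose t := (A + 1) / c; pose x := x0 * expR (- t).
have t0 : 0 <= t by rewrite divr_ge0 ?addr_ge0// ltW.
have xp : 0 < x by rewrite mulr_gt0 ?expR_gt0.
have xx : x <= x0.
  by rewrite /x ler_piMr ?(ltW x00)// expR_le1 oppr_le0.
have Jx0 : J x0 by apply/JE; rewrite x00 lexx.
have Jx : J x by apply/JE; rewrite xp.
have := derive_ge0_nd iJ dF F0 Jx Jx0 xx.
rewrite {2}/x lnM ?posrE ?expR_gt0// expRK mulrDr mulrN /t (mulrCA c) divff ?gt_eqF// mulr1 => h.
by have := BA x (iffLR (JE x) Jx); lra.
Qed.

End LogContradiction.

(** * The sign of the Wronskian on each interval *)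

Section Signs.
Variable R : realType.
Implicit Types (a b c d x K e : R).
Variables (alpha beta : R).
Hypotheses (halpha : -1 < alpha < 1) (hbeta : -1 < beta).
Notation w0 := (weight01 alpha beta).
Notation w1 := (weight1oo alpha beta).
Notation P0 := (coef01 alpha beta).
Notation P1 := (coef1oo alpha beta).
Variables (Y1 Y2 q1 q2 : R -> R).
Notation W := (wronsk Y1 Y2 q1 q2).
Notation S := (sqlen Y1 Y2).
Notation Ph := (pairing Y1 Y2 q1 q2).

Lemma I0n x : @I0 R x -> x != 0 /\ x != 1.
Proof. by move=> /I0E/andP[x0 x1]; rewrite gt_eqF// lt_eqF. Qed.

Lemma I1n x : @I1 R x -> x != 0 /\ x != 1.
Proof. by move=> /I1E x1; rewrite !gt_eqF// (lt_trans ltr01). Qed.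

Section Infinity.
Hypothesis E : eig (@I1 R) P1 w1 Y1 Y2 q1 q2.
Variable A : R.
Hypothesis A0 : 0 <= A.
Hypothesis WA : forall c d, I1 c -> I1 d -> c <= d -> W d - W c <= A.

Let dW x : I1 x -> is_derive x 1 W (w1 x * S x).
Proof. exact: (derive_wronsk I1n (@P1E R alpha beta) (@w1_gt0 R alpha beta) E). Qed.

Let dPh x : I1 x -> is_derive x 1 Ph ((q1 x ^+ 2 + q2 x ^+ 2) / P1 x).
Proof. exact: (derive_pairing I1n (@P1E R alpha beta) (@w1_gt0 R alpha beta) E). Qed.

Let dS x : I1 x -> is_derive x 1 S (2 * Ph x / P1 x).
Proof. exact: (derive_sqlen I1n (@P1E R alpha beta) (@w1_gt0 R alpha beta) E). Qed.

Let pE x : I1 x -> - P1 x = x * (x - 1) * w1 x.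
Proof. by move=> Ix; rewrite P1E//; ring. Qed.

Let p_gt0 x : I1 x -> 0 < - P1 x.
Proof.
move=> Ix; have x0 := I1gt0 Ix; have x1 := w1_gt0 alpha beta Ix.
have x2 : 0 < x - 1 by rewrite subr_gt0 I1gt1.
by rewrite pE//; apply: mulr_gt0 => //; exact: mulr_gt0.
Qed.

Let I1le x y : @I1 R x -> x <= y -> @I1 R y.
Proof. by move=> /I1E x1 xy; apply/I1E; exact: lt_le_trans xy. Qed.

Let p_nd x y : I1 x -> x <= y -> - P1 x <= - P1 y.
Proof.
move=> Ix xy; have Iy := I1le Ix xy; have x1 := I1gt1 Ix; have x0 := I1gt0 Ix.
have /andP[al _] := halpha; have b1 := hbeta.
rewrite /coef1oo !opprK; apply: ler_pM; rewrite ?powR_ge0//.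
  by apply: ge0_ler_powR; rewrite ?nnegrE//; lra.
by apply: ge0_ler_powR; rewrite ?nnegrE//; lra.
Qed.

Let VP x : I1 x -> (P1 x)^-1 = - (- P1 x)^-1.
Proof. by move=> _; rewrite invrN opprK. Qed.

(** On (1, oo) P is negative, so Ph is nonincreasing. If it were below -c < 0 from some point on, S'
    = 2 Ph / P would be at least 2 c / |P|, S(t) at least c t / |P(t)|, and W' = w S at least c / t,
    against the boundedness of W. *)
Lemma pairing_ge0 x : I1 x -> 0 <= Ph x.
Proof.
move=> Ix0; rewrite leNgt; apply/negP => Ph0; set x0 := x in Ix0 Ph0.
pose c := - Ph x0; have c0 : 0 < c by rewrite oppr_gt0.
have Phx t : x0 <= t -> c <= - Ph t.
  move=> xt; have It := I1le Ix0 xt.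
  apply: (derive_ge0_nd (@I1_itv R) (F := fun t => - Ph t)
    (f := fun t => (q1 t ^+ 2 + q2 t ^+ 2) / - P1 t)) => //.
  - move=> y Iy; apply: (is_derive_cong (is_deriveN' (dPh Iy))).
    by rewrite VP//; ring.
  - by move=> y Iy; rewrite divr_ge0 ?addr_ge0 ?sqr_ge0// ltW// p_gt0.
have x00 := I1gt0 Ix0.
apply: (@log_growth_contra R W (fun t => w1 t * S t) (2 * x0) c A) => //.
- by rewrite mulr_gt0.
- move=> t xt; apply: dW; apply: I1le Ix0 _; apply: le_trans xt.
  by rewrite ler_peMl ?(ltW x00)// ler1n.
- move=> t xt.
  have xt2 : x0 <= t / 2 by rewrite ler_pdivlMr// mulrC.
  have t0 : 0 < t by apply: lt_le_trans xt; rewrite mulr_gt0.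
  have tt : t / 2 <= t by rewrite ler_pdivrMr// ler_peMr ?(ltW t0)// ler1n.
  have It := I1le (I1le Ix0 xt2) tt.
  have pt := p_gt0 It.
  (* |P| is nondecreasing, so on this interval S' is at least its bound [k] at the right end;
     starting at 2 x0 keeps the interval beyond x0. *)
  pose J := `[t / 2, t]%classic : set R.
  have JE y : J y -> t / 2 <= y <= t by rewrite /J /= in_itv/=.
  have iJ : is_interval J by exact: interval_is_interval.
  pose k := 2 * c / - P1 t.
  have dF y : J y -> is_derive y 1 (fun y => S y - k * y) (2 * (- Ph y) / - P1 y - k).
    move=> /JE/andP[y1 y2]; have Iy := I1le (I1le Ix0 xt2) y1.
    apply: (is_derive_cong (is_deriveB' (dS Iy) (is_deriveZ' k (is_derive_x y)))).
    by rewrite VP//; ring.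
  have F0 y : J y -> 0 <= 2 * (- Ph y) / - P1 y - k.
    move=> /JE/andP[y1 y2]; have Iy := I1le (I1le Ix0 xt2) y1.
    rewrite subr_ge0 /k; apply: ler_pM.
    + by rewrite mulr_ge0// ltW.
    + by rewrite invr_ge0 ltW.
    + by rewrite ler_pM2l// Phx// (le_trans xt2).
    + by rewrite lef_pV2 ?posrE ?p_gt0// p_nd.
  have J1 : J (t / 2) by rewrite /J /= in_itv/= lexx.
  have J2 : J t by rewrite /J /= in_itv/= lexx andbT.
  have := derive_ge0_nd iJ dF F0 J1 J2 tt => h.
  have s0 := sqlen_ge0 Y1 Y2 (t / 2).
  have h2 : c * t / - P1 t <= S t.
    have -> : c * t / - P1 t = k * t - k * (t / 2).
      by rewrite /k; move: (- P1 t)^-1 => z; field.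
    by move: h; lra.
  apply: (@le_trans _ _ (w1 t * (c * t / - P1 t))); last first.
    by rewrite ler_wpM2l// weight1oo_ge0.
  have w1t := w1_gt0 alpha beta It; have t1 := I1gt1 It.
  have t1' : 0 < t - 1 by rewrite subr_gt0.
  rewrite pE// [leRHS](_ : _ = c / (t - 1)); last first.
    by field; rewrite !gt_eqF.
  by rewrite ler_pM2l// lef_pV2 ?posrE// lerBlDr lerDl.
- move=> t xt; have xt' : x0 <= 2 * x0 by rewrite ler_peMl ?(ltW x00)// ler1n.
  by apply: WA => //; [exact: I1le xt'|exact: (I1le Ix0 (le_trans xt' xt))].
Qed.

(* Since [W^2 <= (q1^2 + q2^2) S], the AM-GM inequality gives [(W - Ph)' >= 2 W / x]; if
   [W] were positive at a point, [W - Ph] would grow logarithmically, but [W] is bounded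
   and [Ph >= 0]. *)
Lemma wronsk_le0 x : I1 x -> W x <= 0.
Proof.
move=> Ix1; rewrite leNgt; apply/negP => Wb; set x1 := x in Ix1 Wb.
have x10 := I1gt0 Ix1.
apply: (@log_growth_contra R (fun t => W t - Ph t)
  (fun t => w1 t * S t - (q1 t ^+ 2 + q2 t ^+ 2) / P1 t) x1 (2 * W x1) (A + Ph x1)) => //.
- by rewrite mulr_gt0.
- by rewrite addr_ge0// pairing_ge0.
- by move=> t xt; have It := I1le Ix1 xt; exact: (is_deriveB' (dW It) (dPh It)).
- move=> t xt; have It := I1le Ix1 xt.
  have t0 := I1gt0 It; have t1 := I1gt1 It; have w1t := w1_gt0 alpha beta It.
  have t1' : 0 < t - 1 by rewrite subr_gt0.
  have Wt : W x1 <= W t.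
    apply: (wronsk_nd (@I1_itv R) I1n (@P1E R alpha beta) (@w1_gt0 R alpha beta)
     (@weight1oo_ge0 R alpha beta) E) => //.
  rewrite VP// mulrN opprK.
  set a := w1 t * S t; set q := (q1 t ^+ 2 + q2 t ^+ 2).
  have a0 : 0 <= a by rewrite mulr_ge0 ?sqlen_ge0// ltW.
  have q0 : 0 <= q by rewrite addr_ge0 ?sqr_ge0.
  have c'0 : 0 <= q / - P1 t by rewrite divr_ge0// ltW// p_gt0.
  (* w / |P| = 1 / (t (t - 1)) >= 1 / t^2, combined with W^2 <= |q|^2 S and W(t) >= W(x1) > 0. *)
  have key : (W x1 / t) ^+ 2 <= a * (q / - P1 t).
    have -> : a * (q / - P1 t) = (q * S t) / (t * (t - 1)).
      by rewrite pE// /a; field; rewrite !gt_eqF.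
    have h := wronsk_sqr Y1 Y2 q1 q2 t.
    rewrite expr_div_n; apply: ler_pM; rewrite ?sqr_ge0 ?invr_ge0 ?sqr_ge0//.
      by apply: le_trans h; rewrite lerXn2r// nnegrE ltW// (lt_le_trans Wb).
    rewrite lef_pV2 ?posrE ?mulr_gt0 ?exprn_gt0// expr2 ler_pM2l//.
    by rewrite lerBlDr lerDl.
  rewrite -mulrA -(@ler_pXn2r _ 2) ?nnegrE//; first last.
    by rewrite addr_ge0.
    by rewrite mulr_ge0// divr_ge0// ltW.
  move: key; set u := W x1 / t; set v := q / - P1 t => key.
  by move: key (sqr_ge0 (a - v)); rewrite !expr2; lra.
- move=> t xt; have It := I1le Ix1 xt.
  have := WA Ix1 It xt; have := pairing_ge0 It; lra.
Qed.

End Infinity.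

Section Zero.
Hypothesis E : eig (@I0 R) P0 w0 Y1 Y2 q1 q2.
Variable A : R.
Hypothesis A0 : 0 <= A.
Hypothesis WA : forall c d, I0 c -> I0 d -> c <= d -> W d - W c <= A.
Hypothesis q10 : q1 (c0 R n) @[n --> \oo] --> 0.
Hypothesis q20 : q2 (c0 R n) @[n --> \oo] --> 0.

Let dW x : I0 x -> is_derive x 1 W (w0 x * S x).
Proof. exact: (derive_wronsk I0n (@P0E R alpha beta) (@w0_gt0 R alpha beta) E). Qed.

Let half : R := 2^-1.
Let half0 : 0 < half. Proof. by rewrite invr_gt0. Qed.
Let half1 : half < 1. Proof. by rewrite invf_lt1// ltr1n. Qed.

Let I0h x : 0 < x <= half -> I0 x.
Proof. by move=> /andP[x0 xh]; apply/I0E; rewrite x0 (le_lt_trans xh). Qed.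

(** As q tends to 0, Cauchy-Schwarz bounds q(x)^2 by the product of the integrals over (0, x) of w,
    of order x^(beta + 1), and of w Z^2, at most A. The proof uses its differential form: w |Z| <=
    (sg w + w Z^2 / sg) / 2 is bounded by the derivative of the explicit function G, whence q + G
    and G - q are monotone. *)
Lemma q_bound (q Z : R -> R) : q (c0 R n) @[n --> \oo] --> 0 ->
  (forall x, I0 x -> is_derive x 1 q (w0 x * Z x)) ->
  (forall x, Z x ^+ 2 <= S x) ->
  exists2 K, 0 <= K & forall x, 0 < x <= half -> `|q x| <= K * x `^ ((beta + 1) / 2).
Proof.
move=> q0 dq ZS; have b1 : 0 < beta + 1 by move: hbeta; lra.
have [k k0 hk] := @powR_bounded R alpha half 1 half0.
pose K := 2^-1 * (k / (beta + 1) + A).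
have K0 : 0 <= K by rewrite mulr_ge0 ?invr_ge0// addr_ge0// divr_ge0// ltW.
exists K => // x xh; have /andP[x0 xh'] := xh; have Ix := I0h xh.
pose h := x `^ ((beta + 1) / 2); have h0 : 0 < h by exact: powR_gt0.
have hh : h * h = x `^ (beta + 1).
  rewrite /h -powRD; last by rewrite (gt_eqF x0) implybT.
  by congr (_ `^ _); field.
(* The weight that balances the two terms of the inequality: both become multiples of h = x^((beta +
   1) / 2). *)
pose sg := h^-1; have sg0 : 0 < sg by rewrite invr_gt0.
pose J := `]0, half]%classic : set R.
have JE y : J y -> 0 < y <= half by rewrite /J /= in_itv/=.
have iJ : is_interval J by exact: interval_is_interval.
pose G t := 2^-1 * (sg * (k / (beta + 1)) * t `^ (beta + 1) + sg^-1 * W t).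
pose G' t := 2^-1 * (sg * (k / (beta + 1)) * ((beta + 1) * t `^ (beta + 1 - 1)) +
  sg^-1 * (w0 t * S t)).
have dG t : J t -> is_derive t 1 G (G' t).
  move=> /JE th; have /andP[t0 _] := th.
  exact: (is_deriveZ' _ (is_deriveD' (is_deriveZ' _ (is_derive1_powR (beta + 1) t0))
    (is_deriveZ' _ (dW (I0h th))))).
have GZ t : J t -> `|w0 t * Z t| <= G' t.
  move=> /JE th; have /andP[t0 th'] := th; have wt := weight01_ge0 alpha beta t.
  rewrite normrM (ger0_norm wt).
  have wk : w0 t <= k * t `^ beta.
    rewrite /weight01 ler_wpM2r ?powR_ge0// hk// lerBrDl -lerBrDr.
    by rewrite (le_trans th')/=; [rewrite lerBlDr lerDl ltW|rewrite /half; lra].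
  have -> : G' t = 2^-1 * (sg * (k * t `^ beta) + sg^-1 * (w0 t * S t)).
    by rewrite /G' addrK; field; rewrite !gt_eqF.
  apply: (@le_trans _ _ (2^-1 * (sg * w0 t + sg^-1 * (w0 t * Z t ^+ 2)))).
    have -> : 2^-1 * (sg * w0 t + sg^-1 * (w0 t * Z t ^+ 2)) =
      w0 t * (2^-1 * (sg + sg^-1 * `|Z t| ^+ 2)).
      by rewrite real_normK ?num_real//; ring.
    rewrite ler_wpM2l//; have sV : sg * sg^-1 = 1 by rewrite divff// gt_eqF.
    rewrite -subr_ge0 (_ : _ - _ = 2^-1 * (sg^-1 * (sg - `|Z t|) ^+ 2)).
      apply: mulr_ge0; first by rewrite invr_ge0.
      by apply: mulr_ge0; [rewrite invr_ge0 ltW|exact: sqr_ge0].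
    by field; rewrite gt_eqF.
  rewrite ler_pM2l ?invr_gt0//; apply: lerD; first by rewrite ler_pM2l.
  by rewrite ler_pM2l ?invr_gt0// ler_wpM2l.
have Jx : J x by rewrite /J /= in_itv/=.
have bnd y : 0 < y <= x -> `|q x - q y| <= K * h.
  move=> /andP[y0 yx].
  have yh : 0 < y <= half by rewrite y0 (le_trans yx).
  have Iy := I0h yh; have Jy : J y by rewrite /J /= in_itv/=.
  have dqJ t : J t -> is_derive t 1 q (w0 t * Z t) by move=> /JE /I0h; exact: dq.
  have F1 t : J t -> 0 <= G' t - w0 t * Z t.
    by move=> /GZ; rewrite ler_norml => /andP[_]; rewrite subr_ge0.
  have F2 t : J t -> 0 <= G' t + w0 t * Z t.
    by move=> /GZ; rewrite ler_norml => /andP[+ _]; rewrite -subr_ge0 opprK addrC.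
  have h1 : G y - q y <= G x - q x :=
    derive_ge0_nd iJ (fun t Jt => is_deriveB' (dG t Jt) (dqJ t Jt)) F1 Jy Jx yx.
  have h2 : G y + q y <= G x + q x :=
    derive_ge0_nd iJ (fun t Jt => is_deriveD' (dG t Jt) (dqJ t Jt)) F2 Jy Jx yx.
  have GG : G x - G y <= K * h.
    have -> : K * h = 2^-1 * (sg * (k / (beta + 1)) * x `^ (beta + 1) + sg^-1 * A).
      by rewrite /K /sg -hh; field; rewrite !gt_eqF.
    rewrite /G -mulrBr ler_pM2l ?invr_gt0//.
    have := WA Iy Ix yx => WAx.
    have t1 : 0 <= sg * (k / (beta + 1)) * y `^ (beta + 1).
      by rewrite !mulr_ge0 ?powR_ge0 ?invr_ge0// ltW.
    have t2 : sg^-1 * (W x - W y) <= sg^-1 * A by rewrite ler_pM2l ?invr_gt0.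
    by move: t2; rewrite mulrBr; lra.
  by rewrite ler_norml; apply/andP; split; lra.
have C : `|q x - q (c0 R n)| @[n --> \oo] --> `|q x - 0|.
  by apply: cvg_norm; apply: cvgB => //; exact: cvg_cst.
rewrite -[q x]subr0.
apply: (ler_cvg_to C (cvg_cst _)).
have := eps_near x0; apply: filterS => n nx; apply: bnd.
by rewrite /c0 eps_gt0 ltW.
Qed.

(* Near 0, [W^2 <= (q1^2 + q2^2) S <= K x^(beta + 1) S]; if [W] were negative at a point,
   [W' = w S] would dominate [c / x], against the boundedness of [W]. *)
Lemma wronsk_ge0 x : I0 x -> 0 <= W x.
Proof.
move=> Ix1; rewrite leNgt; apply/negP => Wb; set x1 := x in Ix1 Wb.
have b1 : 0 < beta + 1 by move: hbeta; lra.
have SE t : S t = Y1 t ^+ 2 + Y2 t ^+ 2 by [].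
have [K1 K10 h1] : exists2 K, 0 <= K & forall x, 0 < x <= half -> `|q1 x| <= K * x `^ ((beta + 1) / 2).
  apply: (q_bound (Z := Y2) q10); first by move=> t /E[].
  by move=> t; rewrite SE lerDr sqr_ge0.
have [K2 K20 h2] : exists2 K, 0 <= K & forall x, 0 < x <= half -> `|q2 x| <= K * x `^ ((beta + 1) / 2).
  apply: (q_bound (Z := fun t => - Y1 t) q20).
    by move=> t /E[_ _ _ d]; rewrite mulrN.
  by move=> t; rewrite sqrrN SE lerDl sqr_ge0.
pose K := K1 ^+ 2 + K2 ^+ 2 + 1.
have K0 : 0 < K by rewrite ltr_wpDl// addr_ge0 ?sqr_ge0.
have hq t : 0 < t <= half -> q1 t ^+ 2 + q2 t ^+ 2 <= K * (t * t `^ beta).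
  move=> th; have /andP[t0 _] := th.
  have -> : t * t `^ beta = (t `^ ((beta + 1) / 2)) ^+ 2.
    rewrite -powRS// expr2 -powRD; last by rewrite (gt_eqF t0) implybT.
    by congr (_ `^ _); field.
  have := sqr_norm_le (h1 t th); have := sqr_norm_le (h2 t th).
  rewrite !exprMn; have := sqr_ge0 (t `^ ((beta + 1) / 2)); rewrite /K.
  by move: (K1 ^+ 2) (K2 ^+ 2) => u v; lra.
have [k k0 hk] := @powR_bounded R (- alpha) half 1 half0.
have k1 : 0 < k + 1 by lra.
pose b := - W x1; have b0 : 0 < b by rewrite oppr_gt0.
pose x2 := Num.min x1 half.
have x20 : 0 < x2 by rewrite lt_min half0 (I0gt0 Ix1).
have x2h t : 0 < t <= x2 -> 0 < t <= half.
  by move=> /andP[-> /=]; rewrite le_min => /andP[].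
(* From b^2 <= W^2 <= K t^(beta + 1) S one gets w S >= (1 - t)^alpha b^2 / (K t), and (1 -
   t)^(-alpha) is at most k + 1. *)
pose c := b ^+ 2 / (K * (k + 1)).
have c0 : 0 < c by rewrite divr_gt0 ?exprn_gt0// mulr_gt0.
have wk t : 0 < t <= half -> 1 <= (1 - t) `^ alpha * (k + 1).
  move=> /andP[t0 th]; have t1 : 0 < 1 - t by rewrite subr_gt0 (le_lt_trans th).
  have hkt : (1 - t) `^ (- alpha) <= k.
    apply: hk; apply/andP; split; last by rewrite lerBlDr lerDl ltW.
    by move: th; rewrite /half; lra.
  have pp : 0 < (1 - t) `^ alpha by rewrite powR_gt0.
  rewrite -(@ler_pM2l _ ((1 - t) `^ alpha)^-1) ?invr_gt0//.
  by rewrite mulr1 mulKf ?gt_eqF// -powRN; lra.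
apply: (@log_growth_contra0 R W (fun t => w0 t * S t) x2 c A) => //.
- by move=> t /x2h th; exact: (dW (I0h th)).
- move=> t tx2; have th := x2h _ tx2; have /andP[t0 tx] := tx2; have It := I0h th.
  have tx1 : t <= x1 by move: tx; rewrite le_min => /andP[].
  have Wt : W t <= W x1.
    by apply: (wronsk_nd (@I0_itv R) I0n (@P0E R alpha beta) (@w0_gt0 R alpha beta)
     (@weight01_ge0 R alpha beta) E).
  have bW : b ^+ 2 <= W t ^+ 2.
    rewrite -(sqrrN (W t)) /b lerXn2r ?nnegrE ?lerN2//; first exact: ltW.
    by rewrite (le_trans (ltW b0))// lerN2.
  have h3 : b ^+ 2 <= K * (t * t `^ beta) * S t.
    apply: (le_trans bW); apply: le_trans (wronsk_sqr Y1 Y2 q1 q2 t) _.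
    by rewrite ler_wpM2r ?sqlen_ge0// hq.
  rewrite /c /weight01 ler_pdivrMr// ler_pdivrMr ?mulr_gt0//.
  apply: (le_trans h3).
  have g0 : 0 <= K * (t * t `^ beta) * S t.
    by rewrite !mulr_ge0 ?sqlen_ge0 ?powR_ge0// ltW.
  have := ler_wpM2l g0 (wk t th); rewrite mulr1 => /le_trans; apply.
  by rewrite le_eqVlt; apply/orP; left; apply/eqP; ring.
- move=> t tx2; have /andP[_ tx] := tx2.
  have Ix2 : I0 x2 by apply: I0h; rewrite x20 ge_min lexx orbT.
  exact: (WA (I0h (x2h _ tx2)) Ix2 tx).
Qed.

End Zero.
End Signs.

(** * The transmission condition at 1 *)

Section Deficiency.
Variable R : realType.
Notation mu := (@lebesgue_measure R).
Implicit Types (D J : set R) (f g h u v m y z phi eta : R -> R) (a b c d x K e : R).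
Variables (alpha beta C s : R).
Hypotheses (halpha : -1 < alpha < 1) (halpha0 : alpha != 0).
Hypotheses (hbeta : -1 < beta) (C0 : 0 < C).
Hypothesis hs : 2 * s > alpha + beta + 1.
Notation w0 := (weight01 alpha beta).
Notation w1 := (weight1oo alpha beta).
Notation Dr := (hypD alpha beta).
Notation ER := (realE alpha C s).
Notation L2sq := (weightedL2 alpha beta).
Notation P0 := (coef01 alpha beta).
Notation P1 := (coef1oo alpha beta).
Notation rin := (wprod alpha beta C).

Lemma derive1n_cst n k : derive1n n (fun=> k : R) = (fun=> if n is 0 then k else 0).
Proof.
elim: n k => [|n IH] k; first by rewrite derive1n0.
rewrite derive1Sn (_ : derive1 (fun=> k) = fun=> 0); first by rewrite IH; case: n {IH}.
by apply/funext => x; exact: (is_derive_derive1 (is_derive_c k x)).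
Qed.

Lemma rlim0_cst_near f k e : 0 < e -> smooth `]0, e[ f ->
  (forall x, x < e -> f x = k) -> rlim0 f.
Proof.
move=> e0 sf fk; have oe : open [set x : R | x < e] by exact: open_lt.
have h n x : x < e -> derive1n n f x = if n is 0 then k else 0.
  move=> xe; rewrite (derive1n_eq_on (g := fun=> k) oe)//; first by rewrite derive1n_cst.
split; first by exists e.
  move=> n; exists (if n is 0 then k else 0); apply: cvg_near_cst.
  by apply/right0P; exists e => // x /andP[_ xe]; exact: h.
apply: cvg_near_cst; apply/right0P; exists e => // x /andP[_ xe].
by rewrite !fk.
Qed.

(** Every explicit member of E used below has this form: u and v are constant near 1 and w is
    zero. *)
Lemma ER_glue phi k k1 k2 e M : 0 < e -> smooth (@I0 R) phi -> smooth (@I1 R) phi ->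
  (forall x, x < e -> phi x = k) ->
  (forall x, 1 - e < x < 1 -> phi x = k1 + k2 * (1 - x) `^ (- alpha)) ->
  (forall x, 1 < x < 1 + e -> phi x = C^-1 * k1 + k2 * (x - 1) `^ (- alpha)) ->
  (forall x, M < x -> phi x = 0) -> ER phi.
Proof.
move=> e0 s0 s1 h0 hl hr hM.
have oJ : open (`]1 - e, 1 + e[%classic : set R) by exact: interval_open.
split.
- by move=> n x [/s0|/s1]; exact.
- have m0 : 0 < Num.min e 1 by rewrite lt_min e0 ltr01.
  apply: (@rlim0_cst_near _ k _ m0).
    apply: smooth_sub s0 => x; rewrite /= in_itv/= lt_min => /andP[x0 /andP[_ x1]].
    by apply/I0E; rewrite x0.
  by move=> x; rewrite lt_min => /andP[/h0].
- exists (fun=> k1), (fun=> k2), e => //; split => //; exact: smooth_cst.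
- exists (fun=> 0), M.
    apply: (@rlim0_cst_near (fun=> 0) 0 1 ltr01 _ (fun _ _ => erefl)).
    by apply: smooth_cst; exact: interval_open.
  by move=> x /hM ->; rewrite mul0r.
Qed.

Lemma test0_ER phi : test (@I0 R) phi -> ER phi.
Proof.
move=> [sp [c [d [/I0E/andP[c0 c1] /I0E/andP[d0 d1] cd supp_phi]]]].
apply: (@ER_glue _ 0 0 0 (Num.min c (1 - d)) 1).
- by rewrite lt_min c0 subr_gt0.
- exact: (smooth_sub _ sp).
- exact: (smooth_sub _ sp).
- by move=> x; rewrite lt_min => /andP[xc _]; apply: (supp_left supp_phi); exact: ltW.
- move=> x /andP[xl x1]; rewrite mul0r addr0; apply: (supp_right supp_phi).
  by apply/ltW/(le_lt_trans _ xl); rewrite lerBrDr -lerBrDl ge_min lexx orbT.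
- move=> x /andP[x1 _]; rewrite mul0r addr0 mulr0; apply: (supp_right supp_phi).
  by rewrite ltW// (lt_trans d1).
- by move=> x x1; apply: (supp_right supp_phi); rewrite ltW// (lt_trans d1).
Qed.

Lemma test1_ER phi : test (@I1 R) phi -> ER phi.
Proof.
move=> [sp [c [d [/I1E c1 /I1E d1 cd supp_phi]]]].
apply: (@ER_glue _ 0 0 0 (Num.min 1 (c - 1)) d).
- by rewrite lt_min ltr01 subr_gt0.
- exact: (smooth_sub _ sp).
- exact: (smooth_sub _ sp).
- move=> x; rewrite lt_min => /andP[xc _]; apply: (supp_left supp_phi).
  by rewrite ltW// (lt_trans xc).
- move=> x /andP[xl x1]; rewrite mul0r addr0; apply: (supp_left supp_phi).
  by rewrite ltW// (lt_trans x1).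
- move=> x /andP[x1 xr]; rewrite mul0r addr0 mulr0; apply: (supp_left supp_phi).
  by apply/ltW/(lt_le_trans xr); rewrite -lerBrDl ge_min lexx orbT.
- by move=> x x1; apply: (supp_right supp_phi); exact: ltW.
Qed.

Lemma Dr_cst k x : Dr (fun=> k) x = 0.
Proof.
rewrite /hypD (_ : derive1 (fun=> k) = fun=> 0); last first.
  by apply/funext => y; exact: (is_derive_derive1 (is_derive_c k y)).
by rewrite (is_derive_derive1 (is_derive_c 0 x)) !mulr0 addr0.
Qed.

Lemma rint_eq0 D h : (forall x, D x -> h x = 0) -> rint D h = 0.
Proof. by move=> h0; rewrite (rint_eq (g := fun=> 0))// rint0. Qed.

Lemma rin_supp0 phi y z : (forall x, @I1 R x -> phi x = 0) ->
  rin (Dr phi) y = rint (@I0 R) (fun x => w0 x * (Dr phi x * y x)) /\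
  rin phi z = rint (@I0 R) (fun x => w0 x * (phi x * z x)).
Proof.
move=> p0; rewrite /wprod !(rint_eq0 (D := @I1 R)) ?mulr0 ?addr0//.
  by move=> x Ix; rewrite p0// mul0r mulr0.
move=> x Ix; rewrite (@Dr_eq_on _ alpha beta (@I1 R) phi (fun=> 0) (@I1_open R))//.
by rewrite Dr_cst mul0r mulr0.
Qed.

Lemma rin_supp1 phi y z : (forall x, @I0 R x -> phi x = 0) ->
  rin (Dr phi) y = C * rint (@I1 R) (fun x => w1 x * (Dr phi x * y x)) /\
  rin phi z = C * rint (@I1 R) (fun x => w1 x * (phi x * z x)).
Proof.
move=> p0; rewrite /wprod !(rint_eq0 (D := @I0 R)) ?add0r//.
  by move=> x Ix; rewrite p0// mul0r mulr0.
move=> x Ix; rewrite (@Dr_eq_on _ alpha beta (@I0 R) phi (fun=> 0) (@I0_open R))//.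
by rewrite Dr_cst mul0r mulr0.
Qed.

(** In real terms, (y, z) lies in the graph of the adjoint of D. *)
Definition weak_pair y z := forall phi, ER phi -> rin (Dr phi) y = rin phi z.

Lemma WP_sweak0 y z : weak_pair y z -> sweak alpha beta (@I0 R) w0 y z.
Proof.
move=> H phi tp; have := H phi (test0_ER tp).
have [|-> ->//] := @rin_supp0 phi y z.
move=> x /I1E x1; have [_ [c [d [_ /I0E/andP[_ d1] _ sp]]]] := tp.
by apply: (supp_right sp); rewrite ltW// (lt_trans d1).
Qed.

Lemma WP_sweak1 y z : weak_pair y z -> sweak alpha beta (@I1 R) w1 y z.
Proof.
move=> H phi tp; have := H phi (test1_ER tp).
have [|-> ->] := @rin_supp1 phi y z.
  move=> x /I0E/andP[_ x1]; have [_ [c [d [/I1E c1 _ _ sp]]]] := tp.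
  by apply: (supp_left sp); rewrite ltW// (lt_trans x1).
by apply: mulfI; rewrite gt_eqF.
Qed.

(** With slope 4 the transitions take place on [1/4, 1/2] here, and on [1/2, 3/4] and [5/4, 3/2] for
    [cut_one]: the former probes the end 0 and the latter the point 1, separately. *)
Definition cut_zero x : R := 1 - step (4 * (x - 4^-1)).
Definition cut_one x : R := bump 4 2^-1 (3 / 2) x.
Definition plateau_test x : R := if x < 1 then cut_one x else C^-1 * cut_one x.
Definition singular_test x : R :=
  cut_one x * (if x < 1 then (1 - x) `^ (- alpha) else (x - 1) `^ (- alpha)).

Lemma cut0_1 x : x < 4^-1 -> cut_zero x = 1.
Proof.
by move=> x4; rewrite /cut_zero step_le0 ?subr0// mulr_ge0_le0// subr_le0 ltW.
Qed.

Lemma cut0_0 x : 2^-1 <= x -> cut_zero x = 0.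
Proof. by move=> x2; rewrite /cut_zero step_ge1 ?subrr//; lra. Qed.

Lemma smooth_cut0 : smooth setT cut_zero.
Proof.
apply: (smoothB (@openT R)); first exact: (smooth_cst (@openT R)).
apply: (@smooth_comp _ setT setT (fun x => 4 * (x - 4^-1)) (@step R)) => //;
  do ?exact: openT.
  apply: (smoothZ (@openT R)); apply: (smoothB (@openT R)).
    exact: (smooth_id (@openT R)).
  exact: (smooth_cst (@openT R)).
exact: smooth_step.
Qed.

Lemma chi_1 x : 3 / 4 <= x <= 5 / 4 -> cut_one x = 1.
Proof.
move=> /andP[x1 x2]; rewrite /cut_one /bump !step_ge1 ?mulr1//; lra.
Qed.

Lemma chi_0 x : x <= 2^-1 \/ 3 / 2 <= x -> cut_one x = 0.
Proof.
by move=> [h|h]; [apply: (supp_left (@bump_supp R 4 _ _)) h|apply: (supp_right (@bump_supp R 4 _ _)) h].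
Qed.

Lemma smooth_chi J : smooth J cut_one.
Proof. by apply: smooth_sub (@smooth_bump R 4 2^-1 (3 / 2)). Qed.

Lemma ER_cut0 : ER cut_zero.
Proof.
apply: (@ER_glue _ 1 0 0 4^-1 1).
- by rewrite invr_gt0.
- exact: (smooth_sub _ smooth_cut0).
- exact: (smooth_sub _ smooth_cut0).
- by move=> x; exact: cut0_1.
- by move=> x /andP[x1 _]; rewrite mul0r addr0 cut0_0//; lra.
- by move=> x /andP[x1 _]; rewrite mul0r mulr0 addr0 cut0_0//; lra.
- by move=> x x1; rewrite cut0_0//; lra.
Qed.

Lemma plateau_left x : x < 1 -> plateau_test x = cut_one x.
Proof. by rewrite /plateau_test => ->. Qed.

Lemma plateau_right x : 1 < x -> plateau_test x = C^-1 * cut_one x.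
Proof. by move=> x1; rewrite /plateau_test ltNge ltW. Qed.

Lemma singular_left x : x < 1 -> singular_test x = cut_one x * (1 - x) `^ (- alpha).
Proof. by rewrite /singular_test => ->. Qed.

Lemma singular_right x : 1 < x -> singular_test x = cut_one x * (x - 1) `^ (- alpha).
Proof. by move=> x1; rewrite /singular_test ltNge ltW. Qed.

Lemma ER_plateau : ER plateau_test.
Proof.
apply: (@ER_glue _ 0 1 0 4^-1 2).
- by rewrite invr_gt0.
- apply: (smooth_eq (@I0_open R) _ (@smooth_chi (@I0 R))) => x /I0lt1 x1.
  by rewrite plateau_left.
- apply: (smooth_eq (@I1_open R) _ (smoothZ (@I1_open R) (@smooth_chi (@I1 R)))) => x /I1gt1 x1.
  by rewrite plateau_right.
- by move=> x x4; rewrite plateau_left ?chi_0//; [left|]; lra.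
- by move=> x /andP[xl x1]; rewrite plateau_left// mul0r addr0 chi_1//; apply/andP; split; lra.
- by move=> x /andP[x1 xr]; rewrite plateau_right// mul0r addr0 chi_1//; apply/andP; split; lra.
- by move=> x x2; rewrite plateau_right ?chi_0 ?mulr0//; [right|]; lra.
Qed.

Lemma ER_singular : ER singular_test.
Proof.
apply: (@ER_glue _ 0 0 1 4^-1 2).
- by rewrite invr_gt0.
- have sm := smooth_sub (@I0lt1 R) (@smooth_1mx R (- alpha)).
  apply: (smooth_eq (@I0_open R) _ (smoothM (@I0_open R) (@smooth_chi (@I0 R)) sm)) => x /I0lt1 x1.
  by rewrite singular_left.
- have sm := smooth_sub (@I1gt1 R) (@smooth_xm1 R (- alpha)).
  apply: (smooth_eq (@I1_open R) _ (smoothM (@I1_open R) (@smooth_chi (@I1 R)) sm)) => x /I1gt1 x1.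
  by rewrite singular_right.
- by move=> x x4; rewrite singular_left ?chi_0 ?mul0r//; [left|]; lra.
- by move=> x /andP[xl x1]; rewrite singular_left// add0r chi_1//; apply/andP; split; lra.
- by move=> x /andP[x1 xr]; rewrite singular_right// mulr0 add0r chi_1//; apply/andP; split; lra.
- by move=> x x2; rewrite singular_right ?chi_0 ?mul0r//; [right|]; lra.
Qed.

End Deficiency.

(** * Boundary data of weak solutions, and vanishing of the deficiency spaces *)

Section DeficiencyMain.
Variable R : realType.
Notation mu := (@lebesgue_measure R).
Implicit Types (D J : set R) (f g h u v m y z phi eta Y Z q p : R -> R) (a b c d x K e : R).
Variables (alpha beta C s : R).
Hypotheses (halpha : -1 < alpha < 1) (halpha0 : alpha != 0).
Hypotheses (hbeta : -1 < beta) (C0 : 0 < C).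
Hypothesis hs : 2 * s > alpha + beta + 1.
Notation w0 := (weight01 alpha beta).
Notation w1 := (weight1oo alpha beta).
Notation Dr := (hypD alpha beta).
Notation ER := (realE alpha C s).
Notation L2sq := (weightedL2 alpha beta).
Notation P0 := (coef01 alpha beta).
Notation P1 := (coef1oo alpha beta).
Notation rin := (wprod alpha beta C).
Notation WP := (weak_pair alpha beta C s).
Notation singular := (singular_test alpha).
Notation plateau := (plateau_test C).
Notation chi := (@cut_one R).
Notation cut0 := (@cut_zero R).

Lemma derive1_local_cst phi k J x : open J -> (forall t, J t -> phi t = k) ->
  J x -> derive1 phi x = 0.
Proof.
move=> oJ h Jx; rewrite (derive1_eq_on oJ h Jx).
exact: (is_derive_derive1 (is_derive_c k x)).
Qed.

Definition bdry (P : R -> R) phi Y q x := P x * derive1 phi x * Y x - phi x * q x.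

(** The failure of Green's formula on each interval separately. For a weak pair the two compensate
    with weight C ([WP_ldef]), and this is what carries boundary data across 1. *)
Definition ldef0 phi y z := rint (@I0 R) (fun x => w0 x * (Dr phi x * y x))
  - rint (@I0 R) (fun x => w0 x * (phi x * z x)).
Definition ldef1 phi y z := rint (@I1 R) (fun x => w1 x * (Dr phi x * y x))
  - rint (@I1 R) (fun x => w1 x * (phi x * z x)).

Lemma WP_ldef phi y z : WP y z -> ER phi -> ldef0 phi y z + C * ldef1 phi y z = 0.
Proof.
move=> H Ep; have := H phi Ep; rewrite /wprod /ldef0 /ldef1 => /eqP.
by rewrite -subr_eq0 => /eqP <-; rewrite mulrBr addrACA opprD.
Qed.

Section Pair.
Variables (y z Y0 q0 Z0 Y1 q1 Z1 : R -> R).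
Hypotheses (Ly : L2sq y) (Lz : L2sq z) (H : WP y z).
Hypothesis aey0 : {ae mu, forall x, I0 x -> y x = Y0 x}.
Hypothesis aez0 : {ae mu, forall x, I0 x -> z x = Z0 x}.
Hypothesis dY0 : forall x, I0 x -> is_derive x 1 Y0 (q0 x / P0 x).
Hypothesis dq0 : forall x, I0 x -> is_derive x 1 q0 (w0 x * Z0 x).
Hypothesis cZ0 : forall x, I0 x -> {for x, continuous Z0}.
Hypothesis aey1 : {ae mu, forall x, I1 x -> y x = Y1 x}.
Hypothesis aez1 : {ae mu, forall x, I1 x -> z x = Z1 x}.
Hypothesis dY1 : forall x, I1 x -> is_derive x 1 Y1 (q1 x / P1 x).
Hypothesis dq1 : forall x, I1 x -> is_derive x 1 q1 (w1 x * Z1 x).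
Hypothesis cZ1 : forall x, I1 x -> {for x, continuous Z1}.

Lemma bdry0_cvg phi : ER phi ->
  bdry P0 phi Y0 q0 (d0 R n) - bdry P0 phi Y0 q0 (c0 R n) @[n --> \oo] --> ldef0 phi y z.
Proof.
move=> Ep; have [Lp LDp] := ER_L2sq halpha hbeta C0 hs Ep.
have [my _ hy _] := Ly; have [mz _ hz _] := Lz.
have [mp _ hp _] := Lp; have [mDp _ hDp _] := LDp.
exact: (boundary_cvg (@I0_open R) (@I0_itv R) (@I0c R) (@I0d R) (@I0_ex R) (@I0n R)
  (@P0E R alpha beta) (@is_derive_P0 R alpha beta)
  (@smooth_w0 R alpha beta) (@w0_gt0 R alpha beta) (@weight01_ge0 R alpha beta)
  (ER_smooth0 Ep) mp mDp my mz hp hDp hy hz aey0 aez0 dY0 dq0 cZ0).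
Qed.

Lemma bdry1_cvg phi : ER phi ->
  bdry P1 phi Y1 q1 (d1 R n) - bdry P1 phi Y1 q1 (c1 R n) @[n --> \oo] --> ldef1 phi y z.
Proof.
move=> Ep; have [Lp LDp] := ER_L2sq halpha hbeta C0 hs Ep.
have [_ my _ hy] := Ly; have [_ mz _ hz] := Lz.
have [_ mp _ hp] := Lp; have [_ mDp _ hDp] := LDp.
exact: (boundary_cvg (@I1_open R) (@I1_itv R) (@I1c R) (@I1d R) (@I1_ex R) (@I1n R)
  (@P1E R alpha beta) (@is_derive_P1 R alpha beta)
  (@smooth_w1 R alpha beta) (@w1_gt0 R alpha beta) (@weight1oo_ge0 R alpha beta)
  (ER_smooth1 Ep) mp mDp my mz hp hDp hy hz aey1 aez1 dY1 dq1 cZ1).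
Qed.

Let q4 : (0 : R) < 4^-1. Proof. by rewrite invr_gt0. Qed.

Lemma eps_small : \forall n \near \oo, eps R n < 4^-1.
Proof. exact: eps_near. Qed.

(** Testing with [cut_zero], which vanishes near 1 and beyond: the whole defect on (0, 1) is zero,
    and q at 0 is its only boundary term. *)
Lemma q_zero : q0 (c0 R n) @[n --> \oo] --> 0.
Proof.
have Ec := ER_cut0 alpha C s.
have c1_0 x : I1 x -> cut0 x = 0 by move=> /I1E x1; rewrite cut0_0//; lra.
have l0 : ldef0 cut0 y z = 0.
  have [h1 h2] := rin_supp0 alpha beta C y z c1_0.
  by rewrite /ldef0 -h1 -h2 (H Ec) subrr.
have := bdry0_cvg Ec; rewrite l0; apply: cvg_trans; apply: near_eq_cvg.
near=> n.
have ne : eps R n < 4^-1 by near: n; exact: eps_small.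
have n0 := eps_gt0 R n.
have h1 : bdry P0 cut0 Y0 q0 (d0 R n) = 0.
  have x2 : 2^-1 < d0 R n by rewrite /d0; lra.
  rewrite /bdry (@derive1_local_cst cut0 0 [set x | 2^-1 < x])//.
  - by rewrite cut0_0 ?ltW// mulr0 !mul0r subrr.
  - by move=> t /= ?; rewrite cut0_0// ltW.
have h2 : bdry P0 cut0 Y0 q0 (c0 R n) = - q0 (c0 R n).
  have x2 : c0 R n < 4^-1 by [].
  rewrite /bdry (@derive1_local_cst cut0 1 [set x | x < 4^-1])//.
  - by rewrite cut0_1// mulr0 mul0r sub0r mul1r.
  - by move=> t /= ?; rewrite cut0_1.
by rewrite h1 h2 sub0r opprK.
Unshelve. all: by end_near. Qed.

Lemma chi_loc1 x : 3 / 4 < x < 5 / 4 -> chi x = 1 /\ derive1 chi x = 0.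
Proof.
move=> xx; have h t : `]3 / 4, 5 / 4[%classic t -> chi t = 1.
  by rewrite /= in_itv/= => /andP[t1 t2]; rewrite chi_1// !ltW.
split; first by apply: h; rewrite /= in_itv.
by apply: (derive1_local_cst _ h); [exact: interval_open|rewrite /= in_itv].
Qed.

Lemma bdry_left phi x : x < 2^-1 -> (forall t, t < 2^-1 -> phi t = 0) ->
  bdry P0 phi Y0 q0 x = 0.
Proof.
move=> x2 h; rewrite /bdry (@derive1_local_cst phi 0 [set t | t < 2^-1])//.
by rewrite h// mulr0 !mul0r subrr.
Qed.

Lemma bdry_right phi x : 3 / 2 < x -> (forall t, 3 / 2 < t -> phi t = 0) ->
  bdry P1 phi Y1 q1 x = 0.
Proof.
move=> x2 h; rewrite /bdry (@derive1_local_cst phi 0 [set t | 3 / 2 < t])//.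
by rewrite h// mulr0 !mul0r subrr.
Qed.

Lemma plateau_zeros : (forall t, t < 2^-1 -> plateau t = 0) /\
  (forall t, 3 / 2 < t -> plateau t = 0).
Proof.
split=> t ht.
  by rewrite plateau_left ?chi_0//; [left; exact: ltW|lra].
by rewrite plateau_right ?chi_0 ?mulr0//; [right; exact: ltW|lra].
Qed.

Lemma singular_zeros : (forall t, t < 2^-1 -> singular t = 0) /\
  (forall t, 3 / 2 < t -> singular t = 0).
Proof.
split=> t ht.
  by rewrite singular_left ?chi_0 ?mul0r//; [left; exact: ltW|lra].
by rewrite singular_right ?chi_0 ?mul0r//; [right; exact: ltW|lra].
Qed.

Lemma d1_gt n : 3 / 2 < d1 R n.
Proof.
have : (2 : R) <= d1 R n by rewrite /d1 (ler_nat R 2 n.+2).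
lra.
Qed.

(** Testing with [plateau_test]: the boundary terms at 1 are -q0 on the left and, with the sign of a
    lower end, C^-1 q1 on the right; the weight C in the compensation makes the limits equal. *)
Lemma q_one : exists a, q0 (d0 R n) @[n --> \oo] --> a /\ q1 (c1 R n) @[n --> \oo] --> a.
Proof.
have Ep := ER_plateau alpha C s; have [pz0 pz1] := plateau_zeros.
have l01 := WP_ldef H Ep; have b0 := bdry0_cvg Ep; have b1 := bdry1_cvg Ep.
exists (- ldef0 plateau y z); split.
- have b0' : - (bdry P0 plateau Y0 q0 (d0 R n) - bdry P0 plateau Y0 q0 (c0 R n))
      @[n --> \oo] --> - ldef0 plateau y z by exact: cvgN b0.
  apply: cvg_trans b0'; apply: near_eq_cvg; near=> n.
  have ne : eps R n < 4^-1 by near: n; exact: eps_small.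
  have n0 := eps_gt0 R n.
  have -> : bdry P0 plateau Y0 q0 (c0 R n) = 0 by apply: bdry_left => //; rewrite /c0; lra.
  have x1 : d0 R n < 1 by rewrite /d0; lra.
  have xx : 3 / 4 < d0 R n < 5 / 4 by rewrite /d0; apply/andP; split; lra.
  have [h1 h2] := chi_loc1 xx.
  have o1 : open [set t : R | t < 1] by exact: open_lt.
  rewrite /bdry (derive1_eq_on o1 (@plateau_left R C) x1) h2 plateau_left// h1.
  by rewrite mulr0 mul0r sub0r mul1r subr0 opprK.
- have -> : - ldef0 plateau y z = C * ldef1 plateau y z.
    by apply/eqP; rewrite eq_sym -addr_eq0 addrC l01.
  have b1' : C * (bdry P1 plateau Y1 q1 (d1 R n) - bdry P1 plateau Y1 q1 (c1 R n))
      @[n --> \oo] --> C * ldef1 plateau y z by exact: cvgMr.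
  apply: cvg_trans b1'; apply: near_eq_cvg; near=> n.
  have ne : eps R n < 4^-1 by near: n; exact: eps_small.
  have n0 := eps_gt0 R n.
  have -> : bdry P1 plateau Y1 q1 (d1 R n) = 0 by apply: bdry_right => //; exact: d1_gt.
  have x1 : 1 < c1 R n by rewrite /c1; lra.
  have xx : 3 / 4 < c1 R n < 5 / 4 by rewrite /c1; apply/andP; split; lra.
  have [h1 h2] := chi_loc1 xx.
  have o1 : open [set t : R | 1 < t] by exact: open_gt.
  have dr : derive1 plateau (c1 R n) = 0.
    rewrite (derive1_eq_on o1 (@plateau_right R C) x1).
    rewrite (is_derive_derive1 (is_deriveZ' C^-1 (smooth_is_derive (@smooth_chi R setT) Logic.I))).
    by rewrite h2 mulr0.
  rewrite /bdry dr plateau_right// h1 mulr0 mul0r !sub0r opprK mulr1 mulrA.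
  by rewrite divff ?mul1r// gt_eqF.
Unshelve. all: by end_near. Qed.

(** Testing with [singular_test], for which P phi' is alpha x^(beta + 1) near 1 on both sides. For
    alpha > 0 neither term of the expression need converge by itself; the combination is the second
    boundary datum at 1, besides q. *)
Lemma flux_one : exists k,
  alpha * d0 R n `^ (beta + 1) * Y0 (d0 R n) - eps R n `^ (- alpha) * q0 (d0 R n)
    @[n --> \oo] --> k /\
  alpha * c1 R n `^ (beta + 1) * Y1 (c1 R n) - eps R n `^ (- alpha) * q1 (c1 R n)
    @[n --> \oo] --> C^-1 * k.
Proof.
have Ep := ER_singular alpha C s; have [pz0 pz1] := singular_zeros.
have l01 := WP_ldef H Ep; have b0 := bdry0_cvg Ep; have b1 := bdry1_cvg Ep.
have TT t : 0 < t -> t `^ (alpha + 1) * t `^ (- alpha - 1) = 1.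
  move=> t0; rewrite -powRD ?(gt_eqF t0) ?implybT//.
  by have -> : alpha + 1 + (- alpha - 1) = 0; [ring|rewrite powRr0].
exists (ldef0 singular y z); split.
- apply: cvg_trans b0; apply: near_eq_cvg; near=> n.
  have ne : eps R n < 4^-1 by near: n; exact: eps_small.
  have n0 := eps_gt0 R n.
  have -> : bdry P0 singular Y0 q0 (c0 R n) = 0 by apply: bdry_left => //; rewrite /c0; lra.
  have x1 : d0 R n < 1 by rewrite /d0; lra.
  have xx : 3 / 4 < d0 R n < 5 / 4 by rewrite /d0; apply/andP; split; lra.
  have [h1 h2] := chi_loc1 xx.
  have tE : 1 - d0 R n = eps R n by rewrite /d0; ring.
  have o1 : open [set t : R | t < 1] by exact: open_lt.
  rewrite /bdry (derive1_eq_on o1 (@singular_left R alpha) x1) singular_left//.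
  rewrite (is_derive_derive1 (is_deriveM' (smooth_is_derive (@smooth_chi R setT) Logic.I)
    (is_derive_1mx (- alpha) x1))).
  rewrite h1 h2 tE /coef01 tE; have T := TT _ n0.
  move: T; set u := eps R n `^ (alpha + 1); set v := eps R n `^ (- alpha - 1) => T.
  rewrite mul0r add0r opprK !mul1r subr0.
  have -> : d0 R n `^ (beta + 1) * u * (alpha * v) = alpha * d0 R n `^ (beta + 1) * (u * v) by ring.
  by rewrite T mulr1.
- have -> : C^-1 * ldef0 singular y z = - ldef1 singular y z.
    have C0' : C != 0 by rewrite gt_eqF.
    by move/eqP: l01; rewrite addr_eq0 => /eqP ->; field.
  have b1' : - (bdry P1 singular Y1 q1 (d1 R n) - bdry P1 singular Y1 q1 (c1 R n))
      @[n --> \oo] --> - ldef1 singular y z by exact: cvgN b1.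
  apply: cvg_trans b1'; apply: near_eq_cvg; near=> n.
  have ne : eps R n < 4^-1 by near: n; exact: eps_small.
  have n0 := eps_gt0 R n.
  have -> : bdry P1 singular Y1 q1 (d1 R n) = 0 by apply: bdry_right => //; exact: d1_gt.
  have x1 : 1 < c1 R n by rewrite /c1; lra.
  have xx : 3 / 4 < c1 R n < 5 / 4 by rewrite /c1; apply/andP; split; lra.
  have [h1 h2] := chi_loc1 xx.
  have tE : c1 R n - 1 = eps R n by rewrite /c1; ring.
  have o1 : open [set t : R | 1 < t] by exact: open_gt.
  rewrite /bdry (derive1_eq_on o1 (@singular_right R alpha) x1) singular_right//.
  rewrite (is_derive_derive1 (is_deriveM' (smooth_is_derive (@smooth_chi R setT) Logic.I)
    (is_derive_xm1 (- alpha) x1))).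
  rewrite h1 h2 tE /coef1oo tE; have T := TT _ n0.
  move: T; set u := eps R n `^ (alpha + 1); set v := eps R n `^ (- alpha - 1) => T.
  rewrite mul0r !add0r opprK !mul1r.
  have -> : - (c1 R n `^ (beta + 1) * u) * (- alpha * v) = alpha * c1 R n `^ (beta + 1) * (u * v) by ring.
  by rewrite T mulr1.
Unshelve. all: by end_near. Qed.

End Pair.

(* The Wronskian is nondecreasing on both intervals, nonnegative on (0, 1), nonpositive on
   (1, oo), and its one-sided limits at 1 differ by the factor [C] > 0; so it vanishes, and
   so does its derivative [w (Y1^2 + Y2^2)]. *)
Theorem deficiency y1 y2 : L2sq y1 -> L2sq y2 -> WP y1 y2 -> WP y2 (fun x => - y1 x) ->
  {ae mu, forall x, I0 x \/ I1 x -> y1 x = 0 /\ y2 x = 0}.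
Proof.
move=> L1' L2' H1 H2.
have [m10 m11 h10 h11] := L1'; have [m20 m21 h20 h21] := L2'.
have Ln1 : L2sq (fun x => - y1 x).
  split; [exact: measurableT_comp|exact: measurableT_comp| |].
    by apply: (L1_eq (@I0_meas R) _ h10) => x _; rewrite sqrrN.
  by apply: (L1_eq (@I1_meas R) _ h11) => x _; rewrite sqrrN.
have [Y1 [Y2 [q1 [q2 [E0 a1 a2]]]]] := eig_exists (@I0_open R) (@I0_itv R) (@I0c R) (@I0d R) (@I0_ex R) (@I0n R)
  (@P0E R alpha beta) (@is_derive_P0 R alpha beta) (@smooth_P0 R alpha beta)
  (@smooth_w0 R alpha beta) (@w0_gt0 R alpha beta) (@weight01_ge0 R alpha beta)
  m10 m20 h10 h20 (WP_sweak0 H1) (WP_sweak0 H2).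
have [Z1 [Z2 [p1 [p2 [E1 b1 b2]]]]] := eig_exists (@I1_open R) (@I1_itv R) (@I1c R) (@I1d R) (@I1_ex R) (@I1n R)
  (@P1E R alpha beta) (@is_derive_P1 R alpha beta) (@smooth_P1 R alpha beta)
  (@smooth_w1 R alpha beta) (@w1_gt0 R alpha beta) (@weight1oo_ge0 R alpha beta)
  m11 m21 h11 h21 (WP_sweak1 C0 H1) (WP_sweak1 C0 H2).
have [A A0 WA] := wronsk_bounded (@I0_open R) (@I0_itv R) (@I0n R)
  (@P0E R alpha beta) (@smooth_w0 R alpha beta) (@w0_gt0 R alpha beta)
  (@weight01_ge0 R alpha beta) E0 m10 m20 h10 h20 a1 a2.
have [A' A0' WA'] := wronsk_bounded (@I1_open R) (@I1_itv R) (@I1n R)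
  (@P1E R alpha beta) (@smooth_w1 R alpha beta) (@w1_gt0 R alpha beta)
  (@weight1oo_ge0 R alpha beta) E1 m11 m21 h11 h21 b1 b2.
have a1n : {ae mu, forall x, I0 x -> - y1 x = - Y1 x}.
  by apply: (@filterS _ _ (ae_filter_ringOfSetsType mu) _ _ _ a1) => x h Ix; rewrite h.
have b1n : {ae mu, forall x, I1 x -> - y1 x = - Z1 x}.
  by apply: (@filterS _ _ (ae_filter_ringOfSetsType mu) _ _ _ b1) => x h Ix; rewrite h.
have dY1 x : I0 x -> is_derive x 1 Y1 (q1 x / P0 x) by move=> /E0[].
have dY2 x : I0 x -> is_derive x 1 Y2 (q2 x / P0 x) by move=> /E0[].
have dq1 x : I0 x -> is_derive x 1 q1 (w0 x * Y2 x) by move=> /E0[].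
have dq2 x : I0 x -> is_derive x 1 q2 (w0 x * - Y1 x) by move=> /E0[_ _ _]; rewrite mulrN.
have dZ1 x : I1 x -> is_derive x 1 Z1 (p1 x / P1 x) by move=> /E1[].
have dZ2 x : I1 x -> is_derive x 1 Z2 (p2 x / P1 x) by move=> /E1[].
have dp1 x : I1 x -> is_derive x 1 p1 (w1 x * Z2 x) by move=> /E1[].
have dp2 x : I1 x -> is_derive x 1 p2 (w1 x * - Z1 x) by move=> /E1[_ _ _]; rewrite mulrN.
have cY2 x : I0 x -> {for x, continuous Y2} by move=> /dY2 /is_derive_continuous.
have cY1 x : I0 x -> {for x, continuous (fun t => - Y1 t)}.
  by move=> Ix; apply: continuousN; exact: (is_derive_continuous (dY1 x Ix)).
have cZ2 x : I1 x -> {for x, continuous Z2} by move=> /dZ2 /is_derive_continuous.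
have cZ1 x : I1 x -> {for x, continuous (fun t => - Z1 t)}.
  by move=> Ix; apply: continuousN; exact: (is_derive_continuous (dZ1 x Ix)).
have q10 := q_zero L1' L2' H1 a1 a2 dY1 dq1 cY2.
have q20 := q_zero L2' Ln1 H2 a2 a1n dY2 dq2 cY1.
have [r1 [r1l r1r]] := q_one L1' L2' H1 a1 a2 dY1 dq1 cY2 b1 b2 dZ1 dp1 cZ2.
have [r2 [r2l r2r]] := q_one L2' Ln1 H2 a2 a1n dY2 dq2 cY1 b2 b1n dZ2 dp2 cZ1.
have [k1 [k1l k1r]] := flux_one L1' L2' H1 a1 a2 dY1 dq1 cY2 b1 b2 dZ1 dp1 cZ2.
have [k2 [k2l k2r]] := flux_one L2' Ln1 H2 a2 a1n dY2 dq2 cY1 b2 b1n dZ2 dp2 cZ1.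
pose W := wronsk Y1 Y2 q1 q2; pose V := wronsk Z1 Z2 p1 p2.
have Wpos x : I0 x -> 0 <= W x by exact: (wronsk_ge0 hbeta E0 A0 WA q10 q20).
have Vneg x : I1 x -> V x <= 0 by exact: (wronsk_le0 halpha hbeta E1 A0' WA').
(* q1 times the flux of (Y2, q2) minus the flux of (Y1, q1) times q2 equals alpha x^(beta + 1) W,
   the terms eps^(-alpha) q1 q2 cancelling. So W has limits at 1 although Y1 and Y2 need not;
   dividing by alpha requires alpha to be nonzero. *)
pose L := r1 * k2 - k1 * r2.
have X0 : d0 R n `^ (beta + 1) @[n --> \oo] --> (1 : R).
  have X : d0 R n @[n --> \oo] --> (1 : R) by have := @eps_cvg1 R (-1); under eq_fun do rewrite mulN1r.
  by have := cont1_cvg X (continuous_powR (a := beta + 1) ltr01); rewrite powR1.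
have X1 : c1 R n `^ (beta + 1) @[n --> \oo] --> (1 : R).
  have X : c1 R n @[n --> \oo] --> (1 : R) by have := @eps_cvg1 R 1; under eq_fun do rewrite mul1r.
  by have := cont1_cvg X (continuous_powR (a := beta + 1) ltr01); rewrite powR1.
have WL : W (d0 R n) @[n --> \oo] --> alpha^-1 * L.
  pose GL Y q n := alpha * d0 R n `^ (beta + 1) * Y (d0 R n) - eps R n `^ (- alpha) * q (d0 R n).
  have C1 : q1 (d0 R n) * GL Y2 q2 n - GL Y1 q1 n * q2 (d0 R n) @[n --> \oo] --> L.
    exact: cvgB (cvgM r1l k2l) (cvgM k1l r2l).
  have C2 : (d0 R n `^ (beta + 1))^-1 @[n --> \oo] --> (1 : R).
    by rewrite -[X in _ --> X]invr1; apply: cvgV; rewrite ?oner_neq0.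
  have C3 : alpha^-1 * ((d0 R n `^ (beta + 1))^-1 *
      (q1 (d0 R n) * GL Y2 q2 n - GL Y1 q1 n * q2 (d0 R n))) @[n --> \oo] --> alpha^-1 * (1 * L).
    by apply: cvgMr; exact: cvgM.
  rewrite mul1r in C3; apply: cvg_trans C3.
  apply: near_eq_cvg; apply: nearW => n /=; rewrite /GL.
  have X0' : d0 R n `^ (beta + 1) != 0 by rewrite gt_eqF// powR_gt0// (I0gt0 (I0d R n)).
  by rewrite /W /wronsk; field; rewrite X0' halpha0.
have VL : V (c1 R n) @[n --> \oo] --> alpha^-1 * (C^-1 * L).
  pose GR Y q n := alpha * c1 R n `^ (beta + 1) * Y (c1 R n) - eps R n `^ (- alpha) * q (c1 R n).
  have C1 : p1 (c1 R n) * GR Z2 p2 n - GR Z1 p1 n * p2 (c1 R n) @[n --> \oo]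
      --> r1 * (C^-1 * k2) - C^-1 * k1 * r2.
    exact: cvgB (cvgM r1r k2r) (cvgM k1r r2r).
  have C2 : (c1 R n `^ (beta + 1))^-1 @[n --> \oo] --> (1 : R).
    by rewrite -[X in _ --> X]invr1; apply: cvgV; rewrite ?oner_neq0.
  have -> : C^-1 * L = r1 * (C^-1 * k2) - C^-1 * k1 * r2 by rewrite /L; ring.
  have C3 : alpha^-1 * ((c1 R n `^ (beta + 1))^-1 *
      (p1 (c1 R n) * GR Z2 p2 n - GR Z1 p1 n * p2 (c1 R n))) @[n --> \oo]
      --> alpha^-1 * (1 * (r1 * (C^-1 * k2) - C^-1 * k1 * r2)).
    by apply: cvgMr; exact: cvgM.
  rewrite mul1r in C3; apply: cvg_trans C3.
  apply: near_eq_cvg; apply: nearW => n /=; rewrite /GR.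
  have X1' : c1 R n `^ (beta + 1) != 0 by rewrite gt_eqF// powR_gt0// (I1gt0 (I1c R n)).
  by rewrite /V /wronsk; field; rewrite X1' halpha0.
have L0 : alpha^-1 * L = 0.
  apply/eqP; rewrite eq_le; apply/andP; split; last first.
    by apply: (ler_cvg_to (cvg_cst 0) WL); apply: nearW => n; apply: Wpos; exact: I0d.
  have h : alpha^-1 * (C^-1 * L) <= 0.
    by apply: (ler_cvg_to VL (cvg_cst 0)); apply: nearW => n; apply: Vneg; exact: I1c.
  by move: h; rewrite mulrCA pmulr_rle0// invr_gt0.
have W0 x : I0 x -> W x = 0.
  move=> Ix; apply/eqP; rewrite eq_le Wpos// andbT.
  rewrite L0 in WL; apply: (ler_cvg_to (cvg_cst (W x)) WL).
  have := I0_ex Ix; apply: filterS => n /andP[_ xd].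
  apply: (wronsk_nd (@I0_itv R) (@I0n R) (@P0E R alpha beta) (@w0_gt0 R alpha beta)
    (@weight01_ge0 R alpha beta) E0 Ix (I0d R n)); exact: ltW.
have V0 x : I1 x -> V x = 0.
  move=> Ix; apply/eqP; rewrite eq_le Vneg//=.
  rewrite mulrCA L0 mulr0 in VL; apply: (ler_cvg_to VL (cvg_cst (V x))).
  have := I1_ex Ix; apply: filterS => n /andP[xd _].
  apply: (wronsk_nd (@I1_itv R) (@I1n R) (@P1E R alpha beta) (@w1_gt0 R alpha beta)
    (@weight1oo_ge0 R alpha beta) E1 (I1c R n) Ix); exact: ltW.
have Y0 := wronsk0_sqlen (@I0_open R) (@I0n R) (@P0E R alpha beta) (@w0_gt0 R alpha beta) E0 W0.
have Z0 := wronsk0_sqlen (@I1_open R) (@I1n R) (@P1E R alpha beta) (@w1_gt0 R alpha beta) E1 V0.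
have ae0 : {ae mu, forall x, I0 x -> y1 x = 0 /\ y2 x = 0}.
  apply: (@filterS2 _ _ (ae_filter_ringOfSetsType mu) _ _ _ _ a1 a2) => x e1 e2 Ix.
  by have [z1 z2] := Y0 x Ix; rewrite e1// e2.
have ae1 : {ae mu, forall x, I1 x -> y1 x = 0 /\ y2 x = 0}.
  apply: (@filterS2 _ _ (ae_filter_ringOfSetsType mu) _ _ _ _ b1 b2) => x e1 e2 Ix.
  by have [z1 z2] := Z0 x Ix; rewrite e1// e2.
apply: (@filterS2 _ _ (ae_filter_ringOfSetsType mu) _ _ _ _ ae0 ae1) => x e1 e2.
by move=> [/e1|/e2].
Qed.

End DeficiencyMain.

Local Open Scope complex_scope.

(** * Essential self-adjointness by dense ranges *)

Section HilbertCriterion.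
Variables (R : realType) (V : lmodType R[i]) (ip : V -> V -> R[i]).
Implicit Types (x y z h k m u v : V) (c e t : R) (T : set (V * V)) (M : set V).
Hypothesis ip_linear : forall (a : R[i]) x y z, ip (a *: x + y) z = a * ip x z + ip y z.
Hypothesis ip_herm : forall x y, ip y x = (ip x y)^*.
Hypothesis ip_ge0 : forall x, 0 <= complex.Re (ip x x).
(** Completeness only for fast sequences: the minimising sequence of [dense_of_orth] can be chosen
    this fast, and the rate leaves room for the factor 4^n in [weighted_L2_complete]. *)
Hypothesis ip_complete : forall u : nat -> V,
  (forall n, complex.Re (ip (u n.+1 - u n) (u n.+1 - u n)) <= 8^-1 ^+ n) ->
  exists l, forall e : R, 0 < e -> exists N : nat, forall n, (N <= n)%N ->
    complex.Re (ip (l - u n) (l - u n)) < e.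

(** The underlying real inner product, in which all estimates are made; complex identities are
    recovered from it by also replacing x with i x ([ip_eq]). *)
Definition rip x y : R := complex.Re (ip x y).
Notation nsq x := (rip x x).
Notation "'J' x" := ('i *: x) (at level 10, x at next level).

Lemma ReD (a b : R[i]) : complex.Re (a + b) = complex.Re a + complex.Re b.
Proof. by case: a b => [? ?] [? ?]. Qed.

Lemma ImD (a b : R[i]) : complex.Im (a + b) = complex.Im a + complex.Im b.
Proof. by case: a b => [? ?] [? ?]. Qed.

Lemma ReJ (a : R[i]) : complex.Re ('i * a) = - complex.Im a.
Proof. by case: a => a b /=; rewrite mul0r mul1r sub0r. Qed.

Lemma ReC (c : R) (a : R[i]) : complex.Re (c%:C * a) = c * complex.Re a.
Proof. by case: a => a b /=; rewrite mul0r subr0. Qed.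

Lemma ripD x y z : rip (x + y) z = rip x z + rip y z.
Proof. by rewrite /rip -[x]scale1r ip_linear scale1r mul1r ReD. Qed.

Lemma ipDl x y z : ip (x + y) z = ip x z + ip y z.
Proof. by rewrite -[x]scale1r ip_linear scale1r mul1r. Qed.

Lemma ip0l z : ip 0 z = 0.
Proof. by apply: (addrI (ip 0 z)); rewrite -ipDl !addr0. Qed.

Lemma ipZl (a : R[i]) x z : ip (a *: x) z = a * ip x z.
Proof. by rewrite -[a *: x]addr0 ip_linear ip0l addr0. Qed.

Lemma ripC x y : rip x y = rip y x.
Proof. by rewrite /rip (ip_herm y x); case: (ip y x). Qed.

Lemma ripZ (c : R) x z : rip (c%:C *: x) z = c * rip x z.
Proof. by rewrite /rip ipZl ReC. Qed.


Lemma rip0 z : rip 0 z = 0.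
Proof. by rewrite /rip ip0l. Qed.

Lemma ripN x z : rip (- x) z = - rip x z.
Proof. by apply: (addIr (rip x z)); rewrite -ripD !addNr rip0. Qed.

Lemma ripB x y z : rip (x - y) z = rip x z - rip y z.
Proof. by rewrite ripD ripN. Qed.

Lemma ripDr x y z : rip x (y + z) = rip x y + rip x z.
Proof. by rewrite ripC ripD !(ripC x). Qed.

Lemma ripNr x y : rip x (- y) = - rip x y.
Proof. by rewrite ripC ripN (ripC x). Qed.

Lemma ripBr x y z : rip x (y - z) = rip x y - rip x z.
Proof. by rewrite ripDr ripNr. Qed.

Lemma ripZr (c : R) x y : rip x (c%:C *: y) = c * rip x y.
Proof. by rewrite ripC ripZ ripC. Qed.

Lemma JJ x : J (J x) = - x.
Proof. by rewrite scalerA -expr2 sqr_i scaleN1r. Qed.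

Lemma ipZr (a : R[i]) x y : ip x (a *: y) = a^* * ip x y.
Proof. by rewrite (ip_herm (a *: y)) ipZl rmorphM/= -ip_herm. Qed.

Lemma ipDr x y z : ip x (y + z) = ip x y + ip x z.
Proof. by rewrite (ip_herm (y + z)) ipDl rmorphD/= -!ip_herm. Qed.

Lemma ripJJ x y : rip (J x) (J y) = rip x y.
Proof.
rewrite /rip ipZl ipZr mulrA; case: (ip x y) => a b /=; ring.
Qed.

Lemma ripJr x y : rip x (J y) = - rip (J x) y.
Proof. by rewrite -ripJJ JJ ripNr. Qed.

Lemma ripJl x y : rip (J x) y = - complex.Im (ip x y).
Proof. by rewrite /rip ipZl ReJ. Qed.

Lemma ip_eq x y x' y' : rip x y = rip x' y' -> rip (J x) y = rip (J x') y' ->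
  ip x y = ip x' y'.
Proof.
rewrite !ripJl /rip; case: (ip x y) (ip x' y') => [a b] [a' b'] /= -> /oppr_inj ->.
by [].
Qed.

Lemma nsqD x y : nsq (x + y) = nsq x + 2 * rip x y + nsq y.
Proof. by rewrite !(ripD, ripDr) (ripC y x); ring. Qed.

Lemma nsqN x : nsq (- x) = nsq x.
Proof. by rewrite ripN ripNr opprK. Qed.

Lemma nsqB x y : nsq (x - y) = nsq x - 2 * rip x y + nsq y.
Proof. by rewrite nsqD nsqN ripNr; ring. Qed.

(** The expansion of |c x - y|^2 >= 0. It replaces Cauchy-Schwarz throughout and avoids square
    roots. *)
Lemma amgm c x y : 0 < c -> 2 * rip x y <= c * nsq x + c^-1 * nsq y.
Proof.
move=> c0; have := ip_ge0 (c%:C *: x - y); rewrite -/(rip _ _) nsqB ripZ ripZr ripZ => h.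
rewrite -(ler_pM2l c0) mulrDr !mulrA divff ?gt_eqF// mul1r.
by move: h; rewrite !mulrA; move: (rip x x) (rip x y) (rip y y) => *; nra.
Qed.

Lemma nsqD_le x y : nsq (x + y) <= 2 * nsq x + 2 * nsq y.
Proof.
rewrite nsqD; have := amgm x y (@ltr01 R); rewrite invr1 !mul1r.
by move: (rip x x) (rip x y) (rip y y) => *; lra.
Qed.

Lemma rip_small x e : 0 < e -> exists2 d : R, 0 < d & forall y, nsq y < d -> rip x y < e.
Proof.
move=> e0; have n0 : 0 <= nsq x := ip_ge0 x.
have c0 : 0 < e / (nsq x + 1) by rewrite divr_gt0// ltr_wpDl.
exists (e * (e / (nsq x + 1))); first exact: mulr_gt0.
move=> y yd; have h := amgm x y c0.
have h1 : e / (nsq x + 1) * nsq x <= e.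
  by rewrite mulrAC ler_pdivrMr ?ltr_wpDl// ler_pM2l// lerDl.
have h2 : (e / (nsq x + 1))^-1 * nsq y < e.
  by rewrite mulrC ltr_pdivrMr.
by move: h h1 h2; move: (_ * nsq x) (_^-1 * nsq y) (rip x y) => *; lra.
Qed.

Lemma hnorm_lt x e : 0 < e -> (hnorm ip x < e) = (nsq x < e ^+ 2).
Proof.
move=> e0; have -> : nsq x = hnorm ip x ^+ 2 by rewrite sqr_sqrtr.
by rewrite ltr_sqr// nnegrE ?sqrtr_ge0// ltW.
Qed.

Lemma op_closureP T p : op_closure ip T p <-> forall e, 0 < e ->
  exists x y, [/\ T (x, y), nsq (p.1 - x) < e & nsq (p.2 - y) < e].
Proof.
split=> [h e e0|h e e0].
  have se : 0 < Num.sqrt e by rewrite sqrtr_gt0.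
  have [x [y [Txy]]] := h _ se; rewrite !hnorm_lt// sqr_sqrtr ?(ltW e0)// => ? ?.
  by exists x, y.
have [|x [y [Txy ? ?]]] := h (e ^+ 2); first by rewrite exprn_gt0.
by exists x, y; rewrite !hnorm_lt.
Qed.

Definition subspace M := M 0 /\ forall (a : R[i]) x y, M x -> M y -> M (a *: x + y).

Lemma rip_orth k m : (forall t, 2 * t * rip k m <= t ^+ 2 * nsq m) -> rip k m = 0.
Proof.
move=> h; have n0 : 0 <= nsq m := ip_ge0 m.
have p : 0 < nsq m + 1 by rewrite ltr_wpDl.
have q : 0 < (nsq m + 1)^-1 by rewrite invr_gt0.
(* The minimiser would be t = rip k m / nsq m; the added 1 allows nsq m = 0. *)
have := h (rip k m * (nsq m + 1)^-1).
have : (nsq m + 1)^-1 * nsq m = 1 - (nsq m + 1)^-1.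
  by field; rewrite gt_eqF.
move: q; set q := (nsq m + 1)^-1; move: q (nsq m) (rip k m) => q n r q0 qn.
have -> : (r * q) ^+ 2 * n = r ^+ 2 * q * (q * n) by ring.
rewrite qn => h1.
have s0 : r ^+ 2 * q <= 0.
  have h2 : 0 <= r ^+ 2 * q * q.
    exact: (mulr_ge0 (mulr_ge0 (sqr_ge0 r) (ltW q0)) (ltW q0)).
  have e1 : 2 * (r * q) * r = 2 * (r ^+ 2 * q) by ring.
  have e2 : r ^+ 2 * q * (1 - q) = r ^+ 2 * q - r ^+ 2 * q * q by ring.
  by move: h1 h2; rewrite e1 e2; move: (r ^+ 2 * q * q) (r ^+ 2 * q) => *; lra.
move: s0; rewrite pmulr_lle0// => s0; apply/eqP; rewrite -sqrf_eq0 eq_le s0/=.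
exact: sqr_ge0.
Qed.

(** The projection theorem without closing M: a minimising sequence for the distance from h to M
    converges, by the parallelogram law, to some l; h - l is orthogonal to M, hence zero, so the
    sequence approximates h. *)
Lemma dense_of_orth M h e : subspace M ->
  (forall y, (forall m, M m -> ip m y = 0) -> y = 0) -> 0 < e ->
  exists2 m, M m & nsq (h - m) < e.
Proof.
move=> [M0 ML] orth e0.
pose S := [set nsq (h - m) | m in M].
have Sinf : has_inf S.
  split; first by exists (nsq (h - 0)), 0.
  by exists 0 => _ [m _ <-]; exact: ip_ge0.
pose d := inf S.
have dlb m : M m -> d <= nsq (h - m).
  by move=> Mm; apply: ge_inf; [exact: Sinf.2|exists m].
(* In the parallelogram estimate [para] two consecutive errors of this size add up to (1/2 + 1/16)
   8^-n, below the required 8^-n. *)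
have ex (n : nat) : exists m, M m /\ nsq (h - m) < d + 8^-1 ^+ n / 4.
  have [|_ [m Mm <-] hm] := @inf_adherent _ S (8^-1 ^+ n / 4) _ Sinf.
    by rewrite divr_gt0// exprn_gt0.
  by exists m.
pose u n := xget 0 [set m | M m /\ nsq (h - m) < d + 8^-1 ^+ n / 4].
have uP n : M (u n) /\ nsq (h - u n) < d + 8^-1 ^+ n / 4.
  by rewrite /u; case: xgetP => [m _ //|/(_ _)]; have [m hm] := ex n => /(_ m)/(_ hm).
have Mhalf x y : M x -> M y -> M (2^-1%:C *: (x + y)).
  move=> Mx My; have : M (1 *: x + y) by exact: ML.
  by rewrite scale1r => Mxy; have := ML (2^-1%:C) _ _ Mxy M0; rewrite addr0.
have para x y : M x -> M y ->
    nsq (y - x) <= 2 * nsq (h - x) + 2 * nsq (h - y) - 4 * d.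
  move=> Mx My; have := dlb _ (Mhalf _ _ Mx My).
  rewrite !nsqB ripZ ripZr ripZr nsqD ripDr (ripC y x).
  by move: (nsq h) (nsq x) (nsq y) (rip h x) (rip h y) (rip x y) => *; lra.
have [l ul] : exists l, forall e : R, 0 < e -> exists N : nat, forall n, (N <= n)%N ->
    nsq (l - u n) < e.
  apply: ip_complete => n; rewrite -/(rip _ _).
  have [M1 h1] := uP n; have [M2 h2] := uP n.+1.
  have p : 0 < (8^-1 : R) ^+ n by rewrite exprn_gt0.
  have := para _ _ M1 M2; move: h1 h2; rewrite exprS; move: p.
  by move: ((8^-1 : R) ^+ n) (nsq (h - u n)) (nsq (h - u n.+1)) (nsq (u n.+1 - u n)) => *; lra.
have small (eps : R) : 0 < eps -> exists n, nsq (l - u n) < eps /\ nsq (h - u n) < d + eps.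
  move=> eps0; have [N hN] := ul _ eps0.
  have /cvgrPdist_lt/(_ _ eps0)[K _ hK] : (8^-1 : R) ^+ n @[n --> \oo] --> (0 : R).
    by apply: cvg_expr; rewrite ger0_norm//; lra.
  exists (maxn N K); split; first by apply: hN; exact: leq_maxl.
  have [_ hu] := uP (maxn N K); apply: (lt_trans hu).
  have := hK _ (leq_maxr N K); rewrite /= sub0r normrN ger0_norm ?exprn_ge0// => q.
  have : 0 < (8^-1 : R) ^+ maxn N K by rewrite exprn_gt0.
  by move: q; move: ((8^-1 : R) ^+ _) => *; lra.
have Mt m t : M m -> forall n, M (u n + t%:C *: m).
  by move=> Mm n; rewrite addrC; apply: ML => //; have [] := uP n.
(* minimality: [nsq (k - t m) >= d], up to the distance from [u n] to its limit *)
have key m t : M m -> 2 * t * rip (h - l) m <= t ^+ 2 * nsq m.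
  move=> Mm; rewrite leNgt; apply/negP => bad.
  pose g := 2 * t * rip (h - l) m - t ^+ 2 * nsq m.
  have g0 : 0 < g by rewrite subr_gt0.
  have [c c0 hc] := rip_small ((-2 * t)%:C *: m) (divr_gt0 g0 (@ltr0n R 4)).
  have [|n [n1 n2]] := @small (Num.min c (g / 4)).
    by rewrite lt_min c0 divr_gt0.
  have h1 := dlb _ (Mt m t Mm n).
  have n3 : nsq (l - u n) < c by apply: (lt_le_trans n1); rewrite ge_min lexx.
  have h2 := hc _ n3.
  have h3 : nsq (h - u n) < d + g / 4.
    by apply: (lt_le_trans n2); rewrite lerD2l ge_min lexx orbT.
  have e1 : nsq (h - (u n + t%:C *: m)) = nsq (h - u n)
      - 2 * (t * (rip (h - l) m + rip m (l - u n))) + t ^+ 2 * nsq m.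
    rewrite (_ : h - (_ + _) = (h - u n) - t%:C *: m) ?opprD ?addrA//.
    rewrite (nsqB (h - u n)) ripZr (ripZ t m) (ripZr t m) (ripC m) -ripD [h - l + _]addrA subrK.
    by ring.
  move: g0 h1 h2 h3; rewrite e1 ripZ /g.
  move: (nsq (h - u n)) (rip (h - l) m) (rip m _) (nsq m) => *; lra.
have k0 : h - l = 0.
  apply: orth => m Mm.
  have MJ : M (J m) by have := ML 'i _ _ Mm M0; rewrite addr0.
  rewrite -(ip0l (h - l)); apply: ip_eq.
    by rewrite rip0 ripC; apply: rip_orth => t; exact: key.
  by rewrite scaler0 rip0 ripC; apply: rip_orth => t; exact: key.
have [n [n1 _]] := small _ e0.
exists (u n); first by have [] := uP n.
by rewrite -(subrK l h) k0 add0r.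
Qed.

Lemma adjoint_subspace T (a : R[i]) x y x' y' : adjoint ip T (x, y) ->
  adjoint ip T (x', y') -> adjoint ip T (a *: x + x', a *: y + y').
Proof.
move=> h h' p q Tpq /=.
by rewrite !ipDr !ipZr (h _ _ Tpq) (h' _ _ Tpq).
Qed.

Lemma adjoint0 T : adjoint ip T (0, 0).
Proof. by move=> p q _ /=; rewrite -(scale0r p) !ipZr rmorph0 !mul0r. Qed.

Lemma adjoint_scale T (a : R[i]) x y : adjoint ip T (x, y) ->
  adjoint ip T (a *: x, a *: y).
Proof.
by move=> h; have := adjoint_subspace a h (@adjoint0 T); rewrite !addr0.
Qed.

(** One inequality between real parts is enough: multiplying the adjoint pair by -1 reverses it, and
    multiplying it by i gives the imaginary part. *)
Lemma adjoint_closure_le T x y x' y' : adjoint ip T (x, y) ->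
  op_closure ip T (x', y') -> rip y' x <= rip x' y.
Proof.
move=> h /op_closureP cl; apply/ler_addgt0Pl => e e0; rewrite -lerBlDr.
have e20 : 0 < e / 2 by rewrite divr_gt0.
have [d d0 hd] := rip_small x e20.
have [d' d'0 hd'] := rip_small (- y) e20.
have [|p [q [Tpq hp hq]]] := cl (Num.min d d'); first by rewrite lt_min d0.
have h1 : rip x (y' - q) < e / 2.
  by apply: hd; apply: (lt_le_trans hq); rewrite ge_min lexx.
have h2 : rip (- y) (x' - p) < e / 2.
  by apply: hd'; apply: (lt_le_trans hp); rewrite ge_min lexx orbT.
have : rip q x = rip p y by rewrite /rip (h _ _ Tpq).
move: h1 h2; rewrite ripN !ripBr !(ripC x) !(ripC y).
by move: (rip y' x) (rip q x) (rip x' y) (rip p y) => *; lra.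
Qed.

Lemma adjoint_closure T x y x' y' : adjoint ip T (x, y) ->
  op_closure ip T (x', y') -> ip y' x = ip x' y.
Proof.
move=> h cl.
have eqr u v : adjoint ip T (u, v) -> rip y' u = rip x' v.
  move=> huv; apply/eqP; rewrite eq_le (adjoint_closure_le huv cl)/=.
  have := adjoint_closure_le (adjoint_scale (-1) huv) cl.
  by rewrite !scaleN1r !ripNr lerN2.
apply: ip_eq; first exact: eqr.
apply: oppr_inj; rewrite -!ripJr; apply: eqr; exact: adjoint_scale.
Qed.

(* With [delta = y - a] and [eta = (z - b) + i delta], where [(a, b)] in [T] is such that
   [eta] is small, [delta] is tested against [psi - i phi], [(phi, psi)] in [T]; symmetry
   gives [|psi - i phi|^2 = |psi|^2 + |phi|^2]. *)
Lemma adjoint_sub_closure T : T (0, 0) ->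
  (forall (a : R[i]) x y x' y', T (x, y) -> T (x', y') -> T (a *: x + x', a *: y + y')) ->
  T `<=` adjoint ip T ->
  (forall h, (forall x y, T (x, y) -> ip (y + J x) h = 0) -> h = 0) ->
  (forall h, (forall x y, T (x, y) -> ip (y - J x) h = 0) -> h = 0) ->
  adjoint ip T `<=` op_closure ip T.
Proof.
move=> T0 TL Ts hp hm [y z] adj; apply/op_closureP => e e0 /=.
have range_subspace (c : R[i]) :
    subspace [set w | exists x y, T (x, y) /\ w = y + c *: x].
  split; first by exists 0, 0; rewrite scaler0 addr0.
  move=> a _ _ [x1 [y1 [T1 ->]]] [x2 [y2 [T2 ->]]].
  exists (a *: x1 + x2), (a *: y1 + y2); split; first exact: TL.
  by rewrite !scalerDr !scalerA (mulrC a c) addrACA.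
(* The estimates below give at most 13/2 of this quantity for [nsq d] and at most 15 of it for
   [nsq g]. *)
have e16 : 0 < e / 16 by rewrite divr_gt0.
have [|_ [a [b [Tab ->]]] heta] := dense_of_orth (z + J y) (range_subspace 'i) _ e16.
  move=> h H; apply: hp => x1 y1 T1; apply: H; by exists x1, y1.
have [|_ [p [q [Tpq ->]]] hth] := dense_of_orth (y - a) (range_subspace (- 'i)) _ e16.
  move=> h H; apply: hm => x1 y1 T1; apply: H; exists x1, y1; by rewrite scaleNr.
have eeta : z + J y - (b + J a) = (z - b) + J (y - a).
  by rewrite opprD addrACA scalerBr.
move: heta hth; rewrite eeta scaleNr.
set d := y - a; set g := z - b; set th := d - _ => heta hth.
have sym : rip q (J p) = 0.
  rewrite ripJr ripJl opprK; have := Ts _ Tpq _ _ Tpq => /= E.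
  by move: (ip_herm p q); rewrite E; case: (ip p q) => c0 c1 [] /=; lra.
have nqp : nsq (q - J p) = nsq q + nsq p by rewrite nsqB sym ripJJ mulr0 subr0.
have test : rip (q - J p) d = rip p (g + J d).
  rewrite ripB (ripDr p) ripJr; congr (_ - _).
  rewrite !ripBr /rip; have /= -> := adj _ _ Tpq.
  by have /= -> := Ts _ Tab _ _ Tpq.
have dth : d = th + (q - J p) by rewrite subrK.
have h1 : nsq d = rip th d + rip p (g + J d) by rewrite [X in rip X d]dth ripD test.
have h2 : nsq p <= 2 * nsq d + 2 * nsq th.
  have : nsq (q - J p) <= 2 * nsq d + 2 * nsq (- th).
    have -> : q - J p = d - th by rewrite {1}dth [RHS]addrC addKr.
    exact: nsqD_le.
  have : 0 <= nsq q := ip_ge0 q.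
  by rewrite nqp nsqN; move: (nsq q) (nsq p) (nsq d) (nsq th) => *; lra.
have h3 : 2 * rip th d <= 2 * nsq th + 2^-1 * nsq d.
  by apply: amgm; rewrite ltr0n.
have h4 : 2 * rip p (g + J d) <= 4^-1 * nsq p + 4 * nsq (g + J d).
  by have := @amgm 4^-1 p (g + J d); rewrite invrK; apply; rewrite invr_gt0.
have nd : nsq d <= 5 / 2 * nsq th + 4 * nsq (g + J d).
  move: h1 h2 h3 h4.
  move: (nsq d) (nsq p) (nsq th) (rip th d) (rip p _) (nsq (g + _)) => *; lra.
have ng : nsq g <= 2 * nsq (g + J d) + 2 * nsq d.
  have := nsqD_le (g + J d) (- J d); rewrite addrK nsqN ripJJ; exact.
have : 0 <= nsq th := ip_ge0 th.
have : 0 <= nsq (g + J d) := ip_ge0 _.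
exists a, b; split=> //; rewrite -/d -/g;
  move: heta hth nd ng; move: (nsq d) (nsq g) (nsq th) (nsq (g + _)) => *; lra.
Qed.

(** Everything rests on the equality of the adjoint and the closure of T: by continuity the closure
    has the same adjoint as T, hence is its own adjoint, and a dense domain makes the adjoint
    single-valued. *)
Theorem essentially_self_adjoint_criterion T : T (0, 0) ->
  (forall (a : R[i]) x y x' y', T (x, y) -> T (x', y') -> T (a *: x + x', a *: y + y')) ->
  T `<=` adjoint ip T ->
  (forall h, (forall x y, T (x, y) -> ip x h = 0) -> h = 0) ->
  (forall h, (forall x y, T (x, y) -> ip (y + J x) h = 0) -> h = 0) ->
  (forall h, (forall x y, T (x, y) -> ip (y - J x) h = 0) -> h = 0) ->
  essentially_self_adjoint ip T.
Proof.
move=> T0 TL Ts hd hp hm.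
have Tcl : T `<=` op_closure ip T.
  move=> [x y] Txy; apply/op_closureP => e e0; exists x, y; split=> //=.
    by rewrite subrr rip0.
  by rewrite subrr rip0.
have clE : adjoint ip T = op_closure ip T.
  apply/seteqP; split; first exact: adjoint_sub_closure.
  move=> [x y] cl p q Tpq /=; rewrite (ip_herm x) (ip_herm y); congr (_ ^*).
  by apply/esym/(adjoint_closure _ cl); exact: Ts.
have dense : densely_defined ip T.
  move=> y e e0.
  have [|||m [z Tmz] ym] := @dense_of_orth (op_domain T) y (e ^+ 2).
  - split; first by exists 0.
    by move=> a x x' [z Tz] [z' Tz']; exists (a *: z + z'); exact: TL.
  - by move=> h H; apply: hd => x z Txz; apply: H; exists z.
  - by rewrite exprn_gt0.
  by exists m; [exists z|rewrite hnorm_lt].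
have func x y y' : adjoint ip T (x, y) -> adjoint ip T (x, y') -> y = y'.
  move=> h h'; apply/subr0_eq/hd => p q Tpq.
  by rewrite ipDr -scaleN1r ipZr -(h _ _ Tpq) -(h' _ _ Tpq) rmorphN1 mulN1r subrr.
split; split=> //.
- split=> // x y y' Txy Txy'; exact: (func x y y' (Ts _ Txy) (Ts _ Txy')).
- rewrite -clE; split=> //; first exact: adjoint0.
  by move=> a x y x' y'; exact: adjoint_subspace.
- by move=> y e e0; have [m [z Tmz] ym] := dense y e e0; exists m => //; exists z; exact: Tcl.
- apply/seteqP; split.
    by move=> [x y] h; rewrite -clE => p q /Tcl /h.
  move=> [x y] cl p q clpq /=; rewrite -clE in cl.
  exact: (adjoint_closure cl clpq).
Qed.

End HilbertCriterion.

(** * Completeness of weighted L2 spaces *)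

Section Completeness.
Variable R : realType.
Notation mu := (@lebesgue_measure R).
Implicit Types (D : set R) (k f g l : R -> R).

Lemma half_cvg0 (r : R) : 2^-1 ^+ n * r @[n --> \oo] --> (0 : R).
Proof.
rewrite -[X in _ --> X](mul0r r); apply: cvgM; last exact: cvg_cst.
by apply: cvg_expr; rewrite ger0_norm ?invr_ge0// invf_lt1 ?ltr1n.
Qed.

Lemma telescope_cvg (a : nat -> R) (r : R) :
  (forall j, `|a j.+1 - a j| <= 2^-1 ^+ j * r) ->
  exists l : R, a n @[n --> \oo] --> l /\ forall n, `|l - a n| <= 2 * (2^-1 ^+ n * r).
Proof.
move=> h.
have r0 : 0 <= r by have := le_trans (normr_ge0 _) (h 0%N); rewrite expr0 mul1r.
have tel n p : `|a (n + p)%N - a n| <= 2 * (2^-1 ^+ n * r) - 2 * (2^-1 ^+ (n + p) * r).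
  elim: p => [|p IH]; first by rewrite addn0 !subrr normr0.
  rewrite addnS -(subrK (a (n + p)%N) (a _.+1)) -addrA.
  apply: le_trans (ler_normD _ _) _; have := h (n + p)%N.
  move: IH; rewrite exprS -(mulrA 2^-1) => IH hnp; set X := 2^-1 ^+ (n + p) * r in IH hnp *.
  by apply: le_trans (lerD hnp IH) _; lra.
(* Subtracting the remaining tail of the geometric bound makes the sequence nondecreasing and
   bounded, and changes it by a null sequence only. *)
pose b n := a n - 2 * (2^-1 ^+ n * r).
have nd : nondecreasing_seq b.
  apply/nondecreasing_seqP => n; rewrite /b exprS.
  have := h n; rewrite ler_norml => /andP[+ _].
  rewrite -[2^-1 * _ * r]mulrA; move: (2^-1 ^+ n * r) (a n) (a n.+1) => *; lra.
have pp n : 0 <= 2^-1 ^+ n * r by rewrite mulr_ge0 ?exprn_ge0 ?invr_ge0.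
have cb : cvgn b.
  apply: nondecreasing_is_cvgn nd _; exists (a 0%N + 2 * r) => _ [n _ <-].
  have := tel 0%N n; rewrite add0n expr0 mul1r ler_norml => /andP[_].
  have := pp n; rewrite /b; move: (2^-1 ^+ n * r) (a n) (a 0%N) => *; lra.
exists (limn b).
have al : a n @[n --> \oo] --> limn b.
  have : (b n + 2 * (2^-1 ^+ n * r)) @[n --> \oo] --> limn b + 2 * 0.
    by apply: cvgD; [exact: cb|apply: cvgMr; exact: half_cvg0].
  rewrite mulr0 addr0; under eq_fun do rewrite subrK; exact.
split=> // n.
have : `|a m - a n| @[m --> \oo] --> `|limn b - a n|.
  by apply: cvg_norm; apply: cvgB; [exact: al|exact: cvg_cst].
move=> c; apply: (ler_cvg_to c (cvg_cst (2 * (2^-1 ^+ n * r)))).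
exists n => // m /= nm; have := tel n (m - n)%N; rewrite subnKC//.
by have := pp m => pm tm; apply: (le_trans tm); rewrite lerBlDr lerDl mulr_ge0.
Qed.

Lemma L1_weight_sum D k f g : meas D -> mfun D k -> (forall x, D x -> 0 <= k x) ->
  mfun D f -> mfun D g -> L1 D (fun x => k x * f x ^+ 2) -> L1 D (fun x => k x * g x ^+ 2) ->
  L1 D (fun x => k x * (f x + g x) ^+ 2).
Proof.
move=> mD mk k0 mf mg hf hg.
apply: (@L1_le _ _ _ (fun x => 2 * (k x * f x ^+ 2) + 2 * (k x * g x ^+ 2))) => //.
- by apply: measurable_funM => //; apply: measurable_funX; exact: measurable_funD.
- move=> x Dx; rewrite ger0_norm; last exact: (mulr_ge0 (k0 x Dx) (sqr_ge0 _)).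
  rewrite -subr_ge0 [leRHS](_ : _ = k x * (f x - g x) ^+ 2); last by ring.
  exact: (mulr_ge0 (k0 x Dx) (sqr_ge0 _)).
- exact: (L1D mD (L1Z 2 mD hf) (L1Z 2 mD hg)).
Qed.

(* [S = sum_n 4^n k (g (n + 1) - g n)^2] is integrable, and [g n x] converges geometrically
   where [S x] is finite. *)
Lemma weighted_L2_complete D k (g : nat -> R -> R) : meas D -> mfun D k ->
  (forall x, D x -> 0 < k x) -> (forall n, mfun D (g n)) ->
  (forall n, L1 D (fun x => k x * g n x ^+ 2)) ->
  (forall n, rint D (fun x => k x * (g n.+1 x - g n x) ^+ 2) <= 8^-1 ^+ n) ->
  exists l, [/\ mfun D l, L1 D (fun x => k x * l x ^+ 2) &
    forall n, rint D (fun x => k x * (l x - g n x) ^+ 2) <= 8 * 4^-1 ^+ n].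
Proof.
move=> mD mk k0 mg hg hd.
have k0' x : D x -> 0 <= k x by move=> Dx; exact: (ltW (k0 x Dx)).
pose d n x := k x * (g n.+1 x - g n x) ^+ 2.
have Ld n : L1 D (d n).
  apply: L1_weight_sum => //; first by apply: measurable_funN.
  by apply: L1_eq (hg n) => // x _; rewrite sqrrN.
have d0 n x : D x -> 0 <= d n x.
  by move=> Dx; apply: mulr_ge0; [exact: k0'|exact: sqr_ge0].
pose F n x : \bar R := (4 ^+ n * d n x)%:E.
have F0 n x : D x -> (0 <= F n x)%E.
  by move=> Dx; rewrite lee_fin mulr_ge0 ?exprn_ge0 ?d0.
have mF n : mfun D (F n).
  apply/measurable_EFinP; apply: measurable_funM => //; exact: L1_meas (Ld n).
pose S x := (\sum_(0 <= n <oo) F n x)%E.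
have mS : mfun D S.
  exact: (@ge0_emeasurable_sum _ _ _ D F xpredT (fun n x Dx _ => F0 n x Dx) (fun n _ => mF n)).
have S0 x : D x -> (0 <= S x)%E.
  by move=> Dx; apply: nneseries_ge0 => n _ _; exact: F0.
have intF n : (\int[mu]_(x in D) F n x <= (2^-1 ^+ n)%:E)%E.
  rewrite rint_EFin//; last by apply: L1Z.
  rewrite lee_fin rintZ// (_ : 2^-1 ^+ n = 4 ^+ n * 8^-1 ^+ n).
    by apply: ler_wpM2l; [exact: exprn_ge0|exact: hd].
  by rewrite -exprMn; congr (_ ^+ n); lra.
have geo n : \sum_(0 <= i < n) (2^-1 : R) ^+ i <= 2.
  have -> : \sum_(0 <= i < n) (2^-1 : R) ^+ i = 2 - 2 * 2^-1 ^+ n.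
    elim: n => [|n IH]; first by rewrite big_nil expr0; lra.
    by rewrite big_nat_recr//= IH exprS; lra.
  by rewrite lerBlDr lerDl mulr_ge0// exprn_ge0// invr_ge0.
have intS : (\int[mu]_(x in D) S x <= 2%:E)%E.
  rewrite /S integral_nneseries//.
  apply: lime_le.
    by apply: is_cvg_nneseries => n _ _; apply: integral_ge0 => x Dx; exact: F0.
  apply: nearW => n; apply: le_trans (_ : (\sum_(0 <= i < n) (2^-1 ^+ i)%:E <= 2%:E)%E).
    by apply: lee_sum => i _; exact: intF.
  by rewrite sumEFin lee_fin geo.
have iS : mu.-integrable D S.
  apply/integrableP; split=> //.
  under eq_integral => x /set_mem Dx do rewrite gee0_abs ?S0//.
  exact: (le_lt_trans intS (ltry _)).
pose s x := fine (S x).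
have s0 x : D x -> 0 <= s x by move=> Dx; exact: fine_ge0 (S0 x Dx).
have Ls : L1 D s.
  apply: le_integrable iS => //.
    by apply/measurable_EFinP; apply: (measurableT_comp _ mS); exact: fine_measurable.
  move=> x Dx; rewrite gee0_abs ?lee_fin ?s0//; apply: le_trans (lee_abs _).
  by have := S0 x Dx; rewrite /s /=; case: (S x).
have ints : rint D s <= 2.
  rewrite -lee_fin -rint_EFin//; apply: le_trans intS; apply: ge0_le_integral => //.
  - exact: (measurable_int _ Ls).
  - by move=> x Dx; have := S0 x Dx; rewrite /s /=; case: (S x).
(* Where the series diverges, on a null set, the sequence is replaced by zero: the limit then exists
   at every point of D and is measurable. *)
pose h n x := if (S x < +oo)%E then g n x else 0.
have mh n : mfun D (h n).
  apply: measurable_fun_if => //.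
  - exact: (measurable_fun_lte mS).
  - by apply: (measurable_funS mD _ (mg n)); exact: subIsetl.
have hP x : D x -> exists l : R, h n x @[n --> \oo] --> l /\
    forall n, k x * (l - h n x) ^+ 2 <= 4 * 4^-1 ^+ n * s x.
  move=> Dx; rewrite /h; case: (boolP (S x < +oo)%E) => Sx; last first.
    exists 0; split; first exact: cvg_cst.
    by move=> n; rewrite subrr expr0n mulr0 mulr_ge0 ?s0// mulr_ge0// exprn_ge0 ?invr_ge0.
  have SE : S x = (s x)%:E by rewrite fineK// ge0_fin_numE ?S0.
  (* Chosen so that k r^2 = s: then 4^j k (g (j + 1) - g j)^2 <= s says that |g (j + 1) - g j| <=
     2^-j r. *)
  pose r := Num.sqrt (s x / k x).
  have r0 : 0 <= r := sqrtr_ge0 _.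
  have kr : k x * r ^+ 2 = s x.
    by rewrite sqr_sqrtr ?divr_ge0 ?k0' ?s0// mulrCA divff ?mulr1// gt_eqF// k0.
  have step j : `|g j.+1 x - g j x| <= 2^-1 ^+ j * r.
    have : (F j x <= S x)%E.
      apply: le_trans (nneseries_lim_ge j.+1 (fun n _ _ => F0 n x Dx)).
      rewrite big_nat_recr//=; apply: leeDr.
      by apply: sume_ge0 => n _; exact: F0.
    rewrite SE lee_fin -kr /d => h1.
    rewrite -ler_sqr ?nnegrE ?mulr_ge0 ?exprn_ge0 ?invr_ge0// real_normK ?num_real//.
    rewrite exprMn -exprM mulnC exprM (_ : 2^-1 ^+ 2 = 4^-1); last by field.
    rewrite exprVn ler_pdivlMl ?exprn_gt0//.
    by rewrite -(ler_pM2l (k0 x Dx)) mulrCA.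
  have [l [gl hl]] := telescope_cvg step; exists l; split=> // n.
  rewrite -kr [leRHS]mulrCA; apply: ler_wpM2l; first exact: k0'.
  have hn : `|l - g n x| ^+ 2 <= (2 * (2^-1 ^+ n * r)) ^+ 2.
    by rewrite ler_sqr ?nnegrE ?mulr_ge0 ?exprn_ge0 ?invr_ge0//; exact: hl.
  move: hn; rewrite real_normK ?num_real// => hn; apply: (le_trans hn).
  rewrite !exprMn -exprM mulnC exprM (_ : 2^-1 ^+ 2 = 4^-1); last by field.
  by rewrite mulrA (_ : 2 ^+ 2 = 4 :> R)//; ring.
pose l x := limn (h^~ x).
have hl x : D x -> h n x @[n --> \oo] --> l x.
  by move=> Dx; have [y [hy _]] := hP x Dx; rewrite /l (cvg_lim _ hy).
have lh n x : D x -> k x * (l x - h n x) ^+ 2 <= 4 * 4^-1 ^+ n * s x.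
  by move=> Dx; have [y [hy hn]] := hP x Dx; rewrite /l (cvg_lim _ hy).
have ml : mfun D l by apply: (@measurable_fun_cvg _ _ _ D h).
have mlg (f : R -> R) : mfun D f -> mfun D (fun x => k x * (l x - f x) ^+ 2).
  by move=> mf; apply: measurable_funM => //; apply: measurable_funX; exact: measurable_funB.
have aeS : {ae mu, forall x, D x -> g^~ x = h^~ x}.
  have := integrable_ae mD iS; apply: (@filterS _ _ (ae_filter_ringOfSetsType mu)) => x fS Dx.
  by apply/funext => n; rewrite /h ifT// -ge0_fin_numE ?S0//; exact: fS.
have eqn n : {ae mu, forall x, D x -> k x * (l x - h n x) ^+ 2 = k x * (l x - g n x) ^+ 2}.
  move: aeS; apply: (@filterS _ _ (ae_filter_ringOfSetsType mu)) => x e Dx.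
  by move: (e Dx) => /(congr1 (fun G : nat -> R => G n)) ->.
have Llh n : L1 D (fun x => k x * (l x - h n x) ^+ 2).
  apply: L1_le (L1Z (4 * 4^-1 ^+ n) mD Ls) => //; first exact: mlg.
  by move=> x Dx; rewrite ger0_norm ?lh//; exact: (mulr_ge0 (k0' x Dx) (sqr_ge0 _)).
have Llg n : L1 D (fun x => k x * (l x - g n x) ^+ 2).
  by apply: L1_ae (eqn n) (Llh n) => //; exact: mlg.
exists l; split=> //.
  apply: (@L1_eq _ D (fun x => k x * ((l x - g 0%N x) + g 0%N x) ^+ 2)) => //.
    by move=> x _; rewrite subrK.
  by apply: L1_weight_sum => //; exact: measurable_funB.
move=> n; rewrite -(rint_ae mD (mlg _ (mh n)) (mlg _ (mg n)) (eqn n)).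
apply: (@le_trans _ _ (rint D (fun x => 4 * 4^-1 ^+ n * s x))).
  by apply: rint_le => //; [exact: L1Z|exact: lh].
rewrite rintZ// [leRHS](_ : _ = 4 * 4^-1 ^+ n * 2); last by ring.
by rewrite ler_wpM2l ?mulr_ge0 ?exprn_ge0 ?invr_ge0.
Qed.
End Completeness.

Local Open Scope quotient_scope.

(** * Bilinearity of the real inner product, and square integrability on open and closed
    intervals *)

Section RealInner.
Variables (R : realType) (alpha beta C : R).
Notation mu := (@lebesgue_measure R).
Implicit Types (D : set R) (f g h : R -> R).
Notation w0 := (weight01 alpha beta).
Notation w1 := (weight1oo alpha beta).
Notation L2sq := (weightedL2 alpha beta).
Notation rin := (wprod alpha beta C).

Lemma rinC f g : rin f g = rin g f.
Proof.
by congr (_ + _ * _); apply: rint_eq => x _; rewrite (mulrC (f x)).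
Qed.

Lemma L2sqZ (c : R) f : L2sq f -> L2sq (fun x => c * f x).
Proof.
move=> [m0 m1 h0 h1]; split; [exact: measurable_funM|exact: measurable_funM| |].
  by apply: L1_eq (L1Z (c ^+ 2) (@I0_meas R) h0) => [|x _]; [exact: I0_meas|ring].
by apply: L1_eq (L1Z (c ^+ 2) (@I1_meas R) h1) => [|x _]; [exact: I1_meas|ring].
Qed.

Lemma L2sqD f g : L2sq f -> L2sq g -> L2sq (fun x => f x + g x).
Proof.
move=> [m0 m1 h0 h1] [m0' m1' h0' h1'].
split; [exact: measurable_funD|exact: measurable_funD| |].
  apply: L1_weight_sum => //; [exact: I0_meas|exact: measurable_weight01|].
  by move=> x _; exact: weight01_ge0.
apply: L1_weight_sum => //; [exact: I1_meas|exact: measurable_weight1oo|].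
by move=> x _; exact: weight1oo_ge0.
Qed.

Lemma rinD f g h : L2sq f -> L2sq g -> L2sq h ->
  rin (fun x => f x + g x) h = rin f h + rin g h.
Proof.
move=> hf hg hh; rewrite /rin addrACA -mulrDr; congr (_ + _ * _).
  rewrite -rintD; [|exact: I0_meas|exact: L2sq_prod0|exact: L2sq_prod0].
  by apply: rint_eq => x _; ring.
rewrite -rintD; [|exact: I1_meas|exact: L2sq_prod1|exact: L2sq_prod1].
by apply: rint_eq => x _; ring.
Qed.

Lemma rinZ (c : R) f h : L2sq f -> L2sq h -> rin (fun x => c * f x) h = c * rin f h.
Proof.
move=> hf hh; rewrite /rin mulrDr mulrCA; congr (_ + _ * _).
  rewrite -rintZ; [|exact: I0_meas|exact: L2sq_prod0].
  by apply: rint_eq => x _; ring.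
rewrite -rintZ; [|exact: I1_meas|exact: L2sq_prod1].
by apply: rint_eq => x _; ring.
Qed.

Lemma rin_ge0 f : 0 <= C -> 0 <= rin f f.
Proof.
move=> C0; apply: addr_ge0; last apply: mulr_ge0 => //.
  by apply: rint_ge0 => x _; apply: (mulr_ge0 (weight01_ge0 _ _ _)); rewrite -expr2 sqr_ge0.
by apply: rint_ge0 => x _; apply: (mulr_ge0 (weight1oo_ge0 _ _ _)); rewrite -expr2 sqr_ge0.
Qed.

Lemma ae_neq (a : R) : {ae mu, forall x, x <> a}.
Proof.
exists [set a]; split=> //; first exact: lebesgue_measure_set1.
by move=> x /= /contrapT.
Qed.

Lemma mfun_half f : mfun (@I0 R) f -> mfun (@I1 R) f -> mfun `[0, +oo[ f.
Proof.
move=> m0 m1.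
have -> : `[0, +oo[%classic = (@I0 R `|` @I1 R) `|` ([set 0] `|` [set 1]).
  apply/seteqP; split=> x /=.
    rewrite in_itv/= andbT le_eqVlt => /predU1P[<-|x0]; first by right; left.
    have [x1|x1|->] := ltgtP x 1; last by right; right.
    - by left; left; apply/I0E; rewrite x0.
    - by left; right; apply/I1E.
  move=> [[/I0E/andP[x0 _]|/I1E x1]|[]->]; rewrite in_itv/= andbT ?lexx ?ler01//.
    exact: ltW.
  by rewrite (le_trans ler01)// ltW.
have mI : measurable (@I0 R `|` @I1 R) by apply: measurableU; [exact: I0_meas|exact: I1_meas].
apply/measurable_funU => //; first by apply: measurableU; exact: measurable_set1.
split; first by apply/measurable_funU; [exact: I0_meas|exact: I1_meas|split].
apply/measurable_funU; [exact: measurable_set1|exact: measurable_set1|].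
by split; exact: measurable_fun_set1.
Qed.

(** The space H is defined by integrals over [0, 1] and [1, oo[, while the analysis takes place on
    the open intervals; the difference is a null set. *)
Lemma null_transfer (D E : set R) f : meas D -> meas E -> D `<=` E ->
  {ae mu, forall x, E x -> D x} -> mfun E f ->
  (L1 D f -> L1 E f) /\ rint E f = rint D f.
Proof.
move=> mD mE DE ae mf.
have mfD : mfun E (f \_ D).
  apply/(measurable_restrict f mD mE); rewrite setIidr//.
  exact: (measurable_funS mE DE mf).
have eqD x : D x -> f x = (f \_ D) x by move=> Dx; rewrite patchE mem_set.
have e0 x : E x -> ~ D x -> (f \_ D) x = 0.
  by move=> _ nD; rewrite patchE memNset.
have aeE : {ae mu, forall x, E x -> (f \_ D) x = f x}.
  apply: (@filterS _ _ (ae_filter_ringOfSetsType mu) _ _ _ ae) => x h Ex.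
  by rewrite -eqD//; exact: h.
split.
  move=> hf; apply: (L1_ae mE mf aeE); apply: (L1_supp mD mE DE e0).
  exact: (L1_eq mD eqD hf).
rewrite -(rint_ae mE mfD mf aeE) (rint_supp DE e0).
by apply: rint_eq => x Dx; rewrite -eqD.
Qed.

Lemma I0_sub_cc : @I0 R `<=` `[0, 1].
Proof. exact: subset_itv_oo_cc. Qed.

Lemma I1_sub_co : @I1 R `<=` `[1, +oo[.
Proof. by move=> x /I1E x1; rewrite /= in_itv/= andbT ltW. Qed.

Lemma transfer01 f : mfun `[0, 1] f ->
  (L1 (@I0 R) f -> L1 `[0, 1] f) /\ rint `[0, 1] f = rint (@I0 R) f.
Proof.
apply: null_transfer; [exact: I0_meas|exact: measurable_itv|exact: I0_sub_cc|].
apply: (@filterS2 _ _ (ae_filter_ringOfSetsType mu) _ _ _ _ (ae_neq 0) (ae_neq 1)) => x /eqP x0 /eqP x1.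
by rewrite /= in_itv/= => /andP[x0' x1']; apply/I0E; rewrite !lt_neqAle x0' x1' x1 eq_sym x0.
Qed.

Lemma transfer1oo f : mfun `[1, +oo[ f ->
  (L1 (@I1 R) f -> L1 `[1, +oo[ f) /\ rint `[1, +oo[ f = rint (@I1 R) f.
Proof.
apply: null_transfer; [exact: I1_meas|exact: measurable_itv|exact: I1_sub_co|].
apply: (@filterS _ _ (ae_filter_ringOfSetsType mu) _ _ _ (ae_neq 1)) => x /eqP x1.
by rewrite /= in_itv/= andbT => x1'; apply/I1E; rewrite lt_neqAle x1' eq_sym x1.
Qed.

Lemma lty_L1 D f : meas D -> mfun D f -> (forall x, D x -> 0 <= f x) ->
  ((\int[mu]_(x in D) (f x)%:E < +oo)%E <-> L1 D f).
Proof.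
move=> mD mf f0; split=> [h|/integrableP[_]].
  apply/integrableP; split; first exact/measurable_EFinP.
  by under eq_integral => x /set_mem Dx do rewrite /= ger0_norm ?f0//.
by under eq_integral => x /set_mem Dx do rewrite /= ger0_norm ?f0//.
Qed.

Notation re f := (fun x => complex.Re (f x)).
Notation im f := (fun x => complex.Im (f x)).

Lemma square_integrableP (f : R -> R[i]) :
  square_integrable alpha beta f <-> L2sq (re f) /\ L2sq (im f).
Proof.
have mh : meas (`[0%R, +oo[%classic : set R) by exact: measurable_itv.
have m01 : meas (`[0%R, 1%R]%classic : set R) by exact: measurable_itv.
have m1o : meas (`[1%R, +oo[%classic : set R) by exact: measurable_itv.
have s0 : @I0 R `<=` `[0, +oo[ := subset_trans I0_sub_cc (@sub_01_half R).
have s1 : @I1 R `<=` `[1, +oo[ := I1_sub_co.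
have s1' : @I1 R `<=` `[0, +oo[ := subset_trans s1 (@sub_1oo_half R).
have q0 x : 0 <= Normc.normc (f x) ^+ 2 * w0 x.
  exact: (mulr_ge0 (sqr_ge0 _) (weight01_ge0 _ _ _)).
have q1 x : 0 <= Normc.normc (f x) ^+ 2 * w1 x.
  exact: (mulr_ge0 (sqr_ge0 _) (weight1oo_ge0 _ _ _)).
have mq (D : set R) (w : R -> R) : meas D -> D `<=` `[0, +oo[ -> mfun `[0, +oo[ (re f) ->
    mfun `[0, +oo[ (im f) -> (forall E, mfun E w) ->
    mfun D (fun x => Normc.normc (f x) ^+ 2 * w x).
  move=> mD sD mR mI mw; apply/measurable_EFinP; apply: measurable_weighted_sqr => //.
  - exact: (measurable_funS mh sD).
  - exact: (measurable_funS mh sD).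
  - exact: mw.
have le_part (J : set R) (w g : R -> R) : meas J -> (forall x, 0 <= w x) -> (forall E, mfun E w) ->
    mfun J g -> (forall x, g x ^+ 2 <= Normc.normc (f x) ^+ 2) ->
    L1 J (fun x => Normc.normc (f x) ^+ 2 * w x) -> L1 J (fun x => w x * g x ^+ 2).
  move=> mD w0' mw mg le h; apply: (L1_le _ _ _ h) => //.
    by apply: measurable_funM => //; exact: measurable_funX.
  move=> x _; rewrite ger0_norm; last exact: (mulr_ge0 (w0' x) (sqr_ge0 _)).
  by rewrite mulrC; apply: ler_wpM2r.
have lR x : complex.Re (f x) ^+ 2 <= Normc.normc (f x) ^+ 2.
  by rewrite sqr_normcE lerDl sqr_ge0.
have lI x : complex.Im (f x) ^+ 2 <= Normc.normc (f x) ^+ 2.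
  by rewrite sqr_normcE lerDr sqr_ge0.
split=> [[mR mI h0 h1]|[[mR0 mR1 hR0 hR1] [mI0 mI1 hI0 hI1]]].
  have mR0 := measurable_funS mh s0 mR; have mR1 := measurable_funS mh s1' mR.
  have mI0 := measurable_funS mh s0 mI; have mI1 := measurable_funS mh s1' mI.
  have {h0}h0 : L1 (@I0 R) (fun x => Normc.normc (f x) ^+ 2 * w0 x).
    have q := mq _ _ m01 (@sub_01_half R) mR mI (@measurable_weight01 R alpha beta).
    exact: (L1S (@I0_meas R) m01 I0_sub_cc ((lty_L1 m01 q (fun x _ => q0 x)).1 h0)).
  have {h1}h1 : L1 (@I1 R) (fun x => Normc.normc (f x) ^+ 2 * w1 x).
    have q := mq _ _ m1o (@sub_1oo_half R) mR mI (@measurable_weight1oo R alpha beta).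
    exact: (L1S (@I1_meas R) m1o I1_sub_co ((lty_L1 m1o q (fun x _ => q1 x)).1 h1)).
  have M0 := @I0_meas R; have M1 := @I1_meas R.
  have W0 := @weight01_ge0 R alpha beta; have W1 := @weight1oo_ge0 R alpha beta.
  have V0 := @measurable_weight01 R alpha beta; have V1 := @measurable_weight1oo R alpha beta.
  by split; split; [exact: mR0|exact: mR1|exact: le_part lR h0|exact: le_part lR h1
    |exact: mI0|exact: mI1|exact: le_part lI h0|exact: le_part lI h1].
have mR := mfun_half mR0 mR1; have mI := mfun_half mI0 mI1.
split=> //.
  have m := mq _ _ m01 (@sub_01_half R) mR mI (@measurable_weight01 R alpha beta).
  apply/lty_L1 => //; apply: (transfer01 m).1.
  apply: L1_eq (L1D (@I0_meas R) hR0 hI0) => [|x _]; first exact: I0_meas.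
  by rewrite sqr_normcE mulrDl (mulrC (w0 x)) (mulrC (w0 x)).
have m := mq _ _ m1o (@sub_1oo_half R) mR mI (@measurable_weight1oo R alpha beta).
apply/lty_L1 => //; apply: (transfer1oo m).1.
apply: L1_eq (L1D (@I1_meas R) hR1 hI1) => [|x _]; first exact: I1_meas.
by rewrite sqr_normcE mulrDl (mulrC (w1 x)) (mulrC (w1 x)).
Qed.

End RealInner.

(** * The Hilbert space of classes: inner product and completeness *)

Section Inner.
Variables (R : realType) (alpha beta theta : R).
Notation mu := (@lebesgue_measure R).
Notation C := (sin ((alpha + theta) * pi) / sin (theta * pi) : R).
Hypothesis C0 : 0 < C.
Notation w0 := (weight01 alpha beta).
Notation w1 := (weight1oo alpha beta).
Notation L2sq := (weightedL2 alpha beta).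
Notation rin := (wprod alpha beta C).
Notation re f := (fun x => complex.Re (f x)).
Notation im f := (fun x => complex.Im (f x)).
Notation H := (L2 alpha beta).
Notation ip := (@L2_inner R alpha beta theta).

Lemma complex_integral_prod (D I : set R) (w : R -> R) (f g : R -> R[i]) :
  meas D -> meas I -> mfun D w ->
  (forall h, mfun D h -> rint D h = rint I h) ->
  mfun D (re f) -> mfun D (im f) -> mfun D (re g) -> mfun D (im g) ->
  L1 I (fun x => w x * (complex.Re (f x) * complex.Re (g x))) ->
  L1 I (fun x => w x * (complex.Im (f x) * complex.Im (g x))) ->
  L1 I (fun x => w x * (complex.Im (f x) * complex.Re (g x))) ->
  L1 I (fun x => w x * (complex.Re (f x) * complex.Im (g x))) ->
  complex_integral D (fun x => f x * (g x)^* * (w x)%:C) =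
  (rint I (fun x => w x * (complex.Re (f x) * complex.Re (g x))) +
   rint I (fun x => w x * (complex.Im (f x) * complex.Im (g x)))) +i*
  (rint I (fun x => w x * (complex.Im (f x) * complex.Re (g x))) -
   rint I (fun x => w x * (complex.Re (f x) * complex.Im (g x)))).
Proof.
move=> mD mI mw tr fR fI gR gI h1 h2 h3 h4; rewrite /complex_integral; congr (_ +i* _).
  rewrite -rintD// -tr.
    apply: rint_eq => x _; case: (f x) (g x) => [a b] [c d] /=; ring.
  by apply: measurable_funD; apply: measurable_funM => //; apply: measurable_funM.
rewrite -rintB// -tr.
  apply: rint_eq => x _; case: (f x) (g x) => [a b] [c d] /=; ring.
by apply: measurable_funB; apply: measurable_funM => //; apply: measurable_funM.
Qed.

Lemma innerE (f g : R -> R[i]) : square_integrable alpha beta f ->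
  square_integrable alpha beta g ->
  inner alpha beta theta f g =
  (rin (re f) (re g) + rin (im f) (im g)) +i* (rin (im f) (re g) - rin (re f) (im g)).
Proof.
move=> qf qg.
have [f1 f2] := (square_integrableP _ _ _).1 qf.
have [g1 g2] := (square_integrableP _ _ _).1 qg.
have [fR fI _ _] := qf; have [gR gI _ _] := qg.
have mh : meas (`[0%R, +oo[%classic : set R) by exact: measurable_itv.
have m01 : meas (`[0%R, 1%R]%classic : set R) by exact: measurable_itv.
have m1o : meas (`[1%R, +oo[%classic : set R) by exact: measurable_itv.
have t0 h : mfun `[0, 1] h -> rint `[0, 1] h = rint (@I0 R) h by move/transfer01 => [].
have t1 h : mfun `[1, +oo[ h -> rint `[1, +oo[ h = rint (@I1 R) h by move/transfer1oo => [].
have r0 (h : R -> R) := @measurable_funS _ _ _ _ _ _ h mh (@sub_01_half R).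
have r1 (h : R -> R) := @measurable_funS _ _ _ _ _ _ h mh (@sub_1oo_half R).
rewrite /inner (@complex_integral_prod _ _ _ _ _ m01 (@I0_meas R) (@measurable_weight01 _ _ _ _) t0
  (r0 _ fR) (r0 _ fI) (r0 _ gR) (r0 _ gI)); try exact: L2sq_prod0.
rewrite (@complex_integral_prod _ _ _ _ _ m1o (@I1_meas R) (@measurable_weight1oo _ _ _ _) t1
  (r1 _ fR) (r1 _ fI) (r1 _ gR) (r1 _ gI)); try exact: L2sq_prod1.
rewrite /rin; move: (rint _ _) (rint _ _) (rint _ _) (rint _ _) (rint _ _) (rint _ _) (rint _ _) (rint _ _).
by move=> *; apply/eqP; rewrite eq_complex /=; apply/andP; split; apply/eqP; ring.
Qed.

Lemma re_lin (a : R[i]) (f g : R -> R[i]) : re (fun x => a * f x + g x) =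
  (fun x => (complex.Re a * complex.Re (f x) + (- complex.Im a) * complex.Im (f x)) + complex.Re (g x)).
Proof. by apply/funext => x; case: a (f x) (g x) => [? ?] [? ?] [? ?] /=; rewrite mulNr. Qed.

Lemma im_lin (a : R[i]) (f g : R -> R[i]) : im (fun x => a * f x + g x) =
  (fun x => (complex.Re a * complex.Im (f x) + complex.Im a * complex.Re (f x)) + complex.Im (g x)).
Proof. by apply/funext => x; case: a (f x) (g x) => [? ?] [? ?] [? ?]. Qed.

Lemma inner_lin (a : R[i]) (f g h : R -> R[i]) : square_integrable alpha beta f ->
  square_integrable alpha beta g -> square_integrable alpha beta h ->
  inner alpha beta theta (fun x => a * f x + g x) h =
  a * inner alpha beta theta f h + inner alpha beta theta g h.
Proof.
move=> qf qg qh.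
have [f1 f2] := (square_integrableP _ _ _).1 qf.
have [g1 g2] := (square_integrableP _ _ _).1 qg.
have [h1 h2] := (square_integrableP _ _ _).1 qh.
have u1 : L2sq (re (fun x => a * f x + g x)).
  by rewrite re_lin; apply: L2sqD => //; apply: L2sqD; apply: L2sqZ.
have u2 : L2sq (im (fun x => a * f x + g x)).
  by rewrite im_lin; apply: L2sqD => //; apply: L2sqD; apply: L2sqZ.
have qu : square_integrable alpha beta (fun x => a * f x + g x).
  by apply/square_integrableP.
have lin (c d : R) (p q r k : R -> R) : L2sq p -> L2sq q -> L2sq r -> L2sq k ->
    rin (fun x => (c * p x + d * q x) + r x) k = c * rin p k + d * rin q k + rin r k.
  move=> hp hq hr hk.
  rewrite (@rinD _ _ _ _ (fun x => c * p x + d * q x) r k)//; last by apply: L2sqD; apply: L2sqZ.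
  rewrite (@rinD _ _ _ _ (fun x => c * p x) (fun x => d * q x) k)//; try exact: L2sqZ.
  by rewrite !rinZ.
rewrite !innerE// re_lin im_lin !lin//; case: a {u1 u2 qu} => a b /=.
move: (rin (re f) _) (rin (re f) _) (rin (im f) _) (rin (im f) _).
move: (rin (re g) _) (rin (re g) _) (rin (im g) _) (rin (im g) _) => *.
by apply/eqP; rewrite eq_complex /=; apply/andP; split; apply/eqP; ring.
Qed.

Lemma L2fun_square (f : L2fun alpha beta) : square_integrable alpha beta f.
Proof. by have /asboolP := valP f. Qed.

Definition mkL2fun (f : R -> R[i]) (hf : square_integrable alpha beta f) : L2fun alpha beta :=
  MkL2fun (asboolT hf : f \in L2_pred alpha beta).

Definition cls (f : L2fun alpha beta) : H := \pi_(L2 alpha beta) f.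

Lemma clsK (x : H) : cls (repr x) = x.
Proof. exact: reprK. Qed.

Lemma clsD f g : cls (f + g) = cls f + cls g.
Proof. exact: pi_L2D. Qed.

Lemma clsZ a f : cls (a *: f) = a *: cls f.
Proof. by rewrite -[RHS]/(L2_scale a (\pi_(L2 alpha beta) f)) pi_L2_scale. Qed.

Lemma clsB f g : cls (f - g) = cls f - cls g.
Proof. by rewrite -scaleN1r clsD clsZ scaleN1r. Qed.

Lemma ip_cls f g : ip (cls f) (cls g) = inner alpha beta theta f g.
Proof. exact: L2_innerE. Qed.

Lemma L2_inner_linear (a : R[i]) (x y z : H) : ip (a *: x + y) z = a * ip x z + ip y z.
Proof.
rewrite -[x]clsK -[y]clsK -[z]clsK; move: (repr x) (repr y) (repr z) => f g h.
rewrite -clsZ -clsD !ip_cls.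
exact: (inner_lin a (L2fun_square f) (L2fun_square g) (L2fun_square h)).
Qed.

Lemma L2_inner_herm (x y : H) : ip y x = (ip x y)^*.
Proof.
rewrite -[x]clsK -[y]clsK; move: (repr x) (repr y) => f g; rewrite !ip_cls.
rewrite !innerE; [|exact: L2fun_square..].
rewrite (rinC _ _ _ (re g) (re f)) (rinC _ _ _ (im g) (im f)) (rinC _ _ _ (im g)) (rinC _ _ _ (re g)).
by rewrite /= opprB.
Qed.

Lemma nsq_cls f : complex.Re (ip (cls f) (cls f)) = rin (re f) (re f) + rin (im f) (im f).
Proof. by rewrite ip_cls innerE//; exact: L2fun_square. Qed.

Lemma L2_inner_ge0 (x : H) : 0 <= complex.Re (ip x x).
Proof. by rewrite -[x]clsK nsq_cls addr_ge0// rin_ge0// ltW. Qed.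

Lemma ae_half (P : R -> Prop) : {ae mu, forall x, @I0 R x -> P x} ->
  {ae mu, forall x, @I1 R x -> P x} -> {ae mu, forall x, 0 <= x -> P x}.
Proof.
move=> h0 h1.
have h2 := @filterS2 _ _ (ae_filter_ringOfSetsType mu) _ _ _ (fun _ a b => conj a b) h0 h1.
have h3 := @filterS2 _ _ (ae_filter_ringOfSetsType mu) _ _ _ (fun _ a b => conj a b)
  (ae_neq (0 : R)) (ae_neq (1 : R)).
apply: (@filterS2 _ _ (ae_filter_ringOfSetsType mu) _ _ _ _ h2 h3) => x [p0 p1] [/eqP x0 /eqP x1] xge.
have [xl|xl|xE] := ltgtP x 1; last by rewrite xE eqxx in x1.
  by apply: p0; apply/I0E; rewrite xl lt_neqAle eq_sym x0 xge.
by apply: p1; apply/I1E.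
Qed.

Lemma cls0 (f : L2fun alpha beta) : {ae mu, forall x, 0 <= x -> complex.Re (f x) = 0} ->
  {ae mu, forall x, 0 <= x -> complex.Im (f x) = 0} -> cls f = 0.
Proof.
move=> h1 h2; have -> : 0 = cls 0 by rewrite -[0 in RHS](scale0r 0) clsZ scale0r.
apply/L2_eqP.
apply: (@filterS2 _ _ (ae_filter_ringOfSetsType mu) _ _ _ _ h1 h2) => x e1 e2 x0.
by apply/eqP; rewrite eq_complex /= e1// e2// !eqxx.
Qed.

(** Each interval has its own limit, C being absorbed into the weight on (1, oo), and the two limits
    are glued; 16 is twice the constant 8 of [weighted_L2_complete]. *)
Lemma rin_complete (g : nat -> R -> R) : (forall n, L2sq (g n)) ->
  (forall n, rin (fun x => g n.+1 x - g n x) (fun x => g n.+1 x - g n x) <= 8^-1 ^+ n) ->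
  exists2 l : R -> R, L2sq l &
    forall n, rin (fun x => l x - g n x) (fun x => l x - g n x) <= 16 * 4^-1 ^+ n.
Proof.
move=> Lg hg.
have i0 f : 0 <= rint (@I0 R) (fun x => w0 x * (f x * f x)).
  apply: rint_ge0 => x _; apply: (mulr_ge0 (weight01_ge0 _ _ _)).
  by rewrite -expr2 sqr_ge0.
have i1 f : 0 <= rint (@I1 R) (fun x => w1 x * (f x * f x)).
  apply: rint_ge0 => x _; apply: (mulr_ge0 (weight1oo_ge0 _ _ _)).
  by rewrite -expr2 sqr_ge0.
have C1 f : L1 (@I1 R) (fun x => w1 x * f x ^+ 2) ->
    L1 (@I1 R) (fun x => C * w1 x * f x ^+ 2).
  move=> h; apply: L1_eq (L1Z C (@I1_meas R) h) => [|x _]; first exact: I1_meas.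
  by rewrite mulrA.
have Cint f : L1 (@I1 R) (fun x => w1 x * f x ^+ 2) ->
    rint (@I1 R) (fun x => C * w1 x * f x ^+ 2) = C * rint (@I1 R) (fun x => w1 x * (f x * f x)).
  move=> h; rewrite -rintZ//; last exact: I1_meas.
  by apply: rint_eq => x _; rewrite mulrA.
have Ld n : L2sq (fun x => g n.+1 x - g n x).
  apply: (@L2sqD _ _ _ (g n.+1) (fun x => - g n x)) => //.
  by have := L2sqZ (-1) (Lg n); under eq_fun do rewrite mulN1r.
have [l0 [ml0 hl0 bl0]] : exists l : R -> R, [/\ mfun (@I0 R) l,
    L1 (@I0 R) (fun x => w0 x * l x ^+ 2) &
    forall n, rint (@I0 R) (fun x => w0 x * (l x - g n x) ^+ 2) <= 8 * 4^-1 ^+ n].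
  apply: weighted_L2_complete.
  - exact: I0_meas.
  - exact: measurable_weight01.
  - exact: w0_gt0.
  - by move=> n; have [] := Lg n.
  - by move=> n; have [] := Lg n.
  - move=> n; apply: le_trans (hg n); rewrite /rin lerDl.
    exact: (mulr_ge0 (ltW C0) (i1 _)).
have [l1 [ml1 hl1 bl1]] : exists l : R -> R, [/\ mfun (@I1 R) l,
    L1 (@I1 R) (fun x => C * w1 x * l x ^+ 2) &
    forall n, rint (@I1 R) (fun x => C * w1 x * (l x - g n x) ^+ 2) <= 8 * 4^-1 ^+ n].
  apply: weighted_L2_complete.
  - exact: I1_meas.
  - by apply: measurable_funM => //; exact: measurable_weight1oo.
  - by move=> x Ix; rewrite mulr_gt0// w1_gt0.
  - by move=> n; have [] := Lg n.
  - by move=> n; apply: C1; have [] := Lg n.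
  - move=> n; apply: le_trans (hg n); rewrite Cint; last by have [] := Ld n.
    by rewrite /rin lerDr; exact: i0.
pose l x := if x < 1 then l0 x else l1 x.
have e0 x : I0 x -> l x = l0 x by move=> /I0E/andP[_ x1]; rewrite /l x1.
have e1 x : I1 x -> l x = l1 x by move=> /I1E x1; rewrite /l ltNge ltW.
have Ll : L2sq l.
  split.
  - by apply: (eq_measurable_fun l0) => // x /set_mem Ix; rewrite e0.
  - by apply: (eq_measurable_fun l1) => // x /set_mem Ix; rewrite e1.
  - by apply: L1_eq hl0 => [|x Ix]; [exact: I0_meas|rewrite e0].
  - apply: L1_eq (L1Z C^-1 (@I1_meas R) hl1) => [|x Ix]; first exact: I1_meas.
    by rewrite e1// -(mulrA C) mulKf// gt_eqF.
exists l => // n.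
have Ldl : L2sq (fun x => l x - g n x).
  apply: (@L2sqD _ _ _ l (fun x => - g n x)) => //.
  by have := L2sqZ (-1) (Lg n); under eq_fun do rewrite mulN1r.
rewrite /rin -Cint; last by have [] := Ldl.
have -> : rint (@I0 R) (fun x => w0 x * ((l x - g n x) * (l x - g n x))) =
    rint (@I0 R) (fun x => w0 x * (l0 x - g n x) ^+ 2).
  by apply: rint_eq => x Ix; rewrite e0.
have -> : rint (@I1 R) (fun x => C * w1 x * (l x - g n x) ^+ 2) =
    rint (@I1 R) (fun x => C * w1 x * (l1 x - g n x) ^+ 2).
  by apply: rint_eq => x Ix; rewrite e1.
by have := bl0 n; have := bl1 n; move: (rint _ _) (rint _ _) => *; lra.
Qed.

Lemma L2_inner_complete (u : nat -> H) :
  (forall n, complex.Re (ip (u n.+1 - u n) (u n.+1 - u n)) <= 8^-1 ^+ n) ->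
  exists x, forall e : R, 0 < e -> exists N : nat, forall n, (N <= n)%N ->
    complex.Re (ip (x - u n) (x - u n)) < e.
Proof.
move=> hu; pose f n : L2fun alpha beta := repr (u n).
have fE n : u n = cls (f n) by rewrite clsK.
have hf n : L2sq (re (f n)) /\ L2sq (im (f n)).
  exact: (square_integrableP _ _ _).1 (L2fun_square (f n)).
have reB (g h : L2fun alpha beta) : re (g - h) = (fun x => complex.Re (g x) - complex.Re (h x)).
  apply/funext => x; rewrite -[LHS]/(complex.Re (L2val g x - L2val h x)).
  by case: (L2val g x) (L2val h x) => [? ?] [? ?].
have imB (g h : L2fun alpha beta) : im (g - h) = (fun x => complex.Im (g x) - complex.Im (h x)).
  apply/funext => x; rewrite -[LHS]/(complex.Im (L2val g x - L2val h x)).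
  by case: (L2val g x) (L2val h x) => [? ?] [? ?].
have C0' := ltW C0.
have h1 n := hu n; have {h1} h1 n : rin (re (f n.+1 - f n)) (re (f n.+1 - f n)) +
    rin (im (f n.+1 - f n)) (im (f n.+1 - f n)) <= 8^-1 ^+ n.
  by rewrite -nsq_cls clsB -!fE.
have [l1 Ll1 b1] : exists2 l : R -> R, L2sq l & forall n,
    rin (fun x => l x - re (f n) x) (fun x => l x - re (f n) x) <= 16 * 4^-1 ^+ n.
  apply: rin_complete => n; first by have [] := hf n.
  apply: le_trans (h1 n); rewrite -reB lerDl; exact: rin_ge0.
have [l2 Ll2 b2] : exists2 l : R -> R, L2sq l & forall n,
    rin (fun x => l x - im (f n) x) (fun x => l x - im (f n) x) <= 16 * 4^-1 ^+ n.
  apply: rin_complete => n; first by have [] := hf n.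
  apply: le_trans (h1 n); rewrite -imB lerDr; exact: rin_ge0.
pose l x := l1 x +i* l2 x.
have ql : square_integrable alpha beta l by apply/square_integrableP.
pose L := mkL2fun ql; exists (cls L) => e e0.
(* The real and the imaginary part contribute at most 16 * 4^-n each. *)
have e32 : 0 < e / 32 by rewrite divr_gt0.
have /cvgrPdist_lt/(_ _ e32)[N _ hN] : (4^-1 : R) ^+ n @[n --> \oo] --> (0 : R).
  by apply: cvg_expr; rewrite ger0_norm//; lra.
exists N => n Nn.
have hn : (4^-1 : R) ^+ n < e / 32.
  by have := hN _ Nn; rewrite /= sub0r normrN ger0_norm ?exprn_ge0.
rewrite fE -clsB nsq_cls reB imB.
apply: le_lt_trans (lerD (b1 n) (b2 n)) _.
by move: hn; move: ((4^-1 : R) ^+ n) => *; lra.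
Qed.

End Inner.

(** * Linearity of the real domain and of the real operator *)

Section LinearCombinations.
Variable R : realType.
Implicit Types (f g u v w : R -> R) (c x e K M : R).

Lemma smooth_lin (D : set R) c f g : open D -> smooth D f -> smooth D g ->
  smooth D (fun x => c * f x + g x).
Proof. by move=> oD sf sg; apply: (smoothD oD _ sg); exact: smoothZ. Qed.

Lemma derive1n_lin (D : set R) c f g n x : open D -> smooth D f -> smooth D g -> D x ->
  derive1n n (fun t => c * f t + g t) x = c * derive1n n f x + derive1n n g x.
Proof.
move=> oD sf sg; elim: n x => [//|n IH] x Dx; rewrite !derive1nS.
rewrite (derive1_eq_on oD IH Dx); apply: is_derive_derive1; apply: is_deriveD'.
  by apply: is_deriveZ'; exact: (smooth_is_derive (smooth_derive1n (m := n) sf)).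
exact: (smooth_is_derive (smooth_derive1n (m := n) sg)).
Qed.

Lemma rlim0_lin c f g : rlim0 f -> rlim0 g -> rlim0 (fun x => c * f x + g x).
Proof.
move=> [[e e0 sf] lf cf] [[e' e0' sg] lg cg].
pose m := Num.min e e'; have m0 : 0 < m by rewrite lt_min e0.
have om : open (`]0, m[%classic : set R) by exact: interval_open.
have sf' : smooth `]0, m[ f.
  by apply: smooth_sub sf => x; rewrite /= !in_itv/= lt_min => /andP[-> /andP[->]].
have sg' : smooth `]0, m[ g.
  by apply: smooth_sub sg => x; rewrite /= !in_itv/= lt_min => /andP[-> /andP[_ ->]].
split; first by exists m; [exact: m0|exact: (smooth_lin om sf' sg')].
  move=> n; have [l fl] := lf n; have [l' gl] := lg n; exists (c * l + l').
  have : (c * derive1n n f x + derive1n n g x) @[x --> 0^'+] --> c * l + l'.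
    by apply: cvgD => //; exact: cvgMr.
  apply: cvg_trans; apply: near_eq_cvg; apply/right0P; exists m => // x xm.
  by rewrite (derive1n_lin c n om)// /= in_itv.
by apply: cvgD => //; exact: cvgMr.
Qed.

Variables (alpha beta C s : R).
Notation ER := (realE alpha C s).
Notation Dr := (hypD alpha beta).

Lemma ER_lin c f g : ER f -> ER g -> ER (fun x => c * f x + g x).
Proof.
move=> [sf rf [u [v [e e0 [su sv fl fr]]]] [w [M rw fM]]].
move=> [sg rg [u' [v' [e' e0' [su' sv' gl gr]]]] [w' [M' rw' gM]]].
split; first exact: (smooth_lin (@I01_open R) sf sg).
- exact: rlim0_lin.
- pose m := Num.min e e'; have m0 : 0 < m by rewrite lt_min e0.
  have om : open (`]1 - m, 1 + m[%classic : set R) by exact: interval_open.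
  have le : m <= e by rewrite ge_min lexx.
  have le' : m <= e' by rewrite ge_min lexx orbT.
  have sb : `]1 - m, 1 + m[ `<=` (`]1 - e, 1 + e[ : set R).
    by apply: subset_itvW; [rewrite lerD2l lerN2|rewrite lerD2l].
  have sb' : `]1 - m, 1 + m[ `<=` (`]1 - e', 1 + e'[ : set R).
    by apply: subset_itvW; [rewrite lerD2l lerN2|rewrite lerD2l].
  exists (fun x => c * u x + u' x), (fun x => c * v x + v' x), m => //; split.
  + exact: (smooth_lin om (smooth_sub sb su) (smooth_sub sb' su')).
  + exact: (smooth_lin om (smooth_sub sb sv) (smooth_sub sb' sv')).
  + move=> x /andP[xl x1]; rewrite fl ?gl; first by ring.
      by rewrite x1 andbT (le_lt_trans _ xl)// lerD2l lerN2.
    by rewrite x1 andbT (le_lt_trans _ xl)// lerD2l lerN2.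
  + move=> x /andP[x1 xr]; rewrite fr ?gr; first by ring.
      by rewrite x1/= (lt_le_trans xr)// lerD2l.
    by rewrite x1/= (lt_le_trans xr)// lerD2l.
- exists (fun x => c * w x + w' x), (Num.max M M'); first exact: rlim0_lin.
  by move=> x; rewrite gt_max => /andP[xM xM']; rewrite fM// gM//; ring.
Qed.

Lemma ER0 f : ER f -> ER (fun=> 0).
Proof.
move=> Ef; have := ER_lin (-1) Ef Ef; congr ER.
by apply/funext => x; rewrite mulN1r addNr.
Qed.

Lemma Dr_lin c f g x : smooth (@I0 R `|` @I1 R) f -> smooth (@I0 R `|` @I1 R) g ->
  I0 x \/ I1 x -> Dr (fun t => c * f t + g t) x = c * Dr f x + Dr g x.
Proof.
move=> sf sg Ix; have h n := @derive1n_lin _ c f g n x (@I01_open R) sf sg Ix.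
have := h 1%N; have := h 2%N; rewrite !derive1nS !derive1n0 => h2 h1.
rewrite /hypD h1 h2; move: (derive1 (derive1 f) x) (derive1 (derive1 g) x).
by move: (derive1 f x) (derive1 g x) => *; ring.
Qed.

End LinearCombinations.

(** * The space E through real and imaginary parts *)

Section ComplexSpace.
Variables (R : realType) (alpha beta theta r : R).
Notation C := (sin ((alpha + theta) * pi) / sin (theta * pi) : R).
Notation ER := (realE alpha C (alpha + beta + r + 1)).
Notation Dr := (hypD alpha beta).
Notation re f := (fun x => complex.Re (f x)).
Notation im f := (fun x => complex.Im (f x)).
Implicit Types f g u v w : R -> R[i].

Lemma smooth_onP (D : set R) f : smooth_on D f <-> smooth D (re f) /\ smooth D (im f).
Proof.
split=> [h|[h1 h2] n x Dx]; last exact: (conj (h1 n x Dx) (h2 n x Dx)).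
exact: (conj (fun n x Dx => (h n x Dx).1) (fun n x Dx => (h n x Dx).2)).
Qed.

Lemma smooth_right0P f : smooth_right0 f <-> rlim0 (re f) /\ rlim0 (im f).
Proof.
split=> [[[e e0 /smooth_onP[s1 s2]] l c1 c2]|[[[e e0 s1] l1 c1] [[e' e0' s2] l2 c2]]].
  split; split => //; do ?[by exists e].
    by move=> n; have [k [k1 _]] := l n; exists k.1.
  by move=> n; have [k [_ k2]] := l n; exists k.2.
split=> //.
  exists (Num.min e e'); first by rewrite lt_min e0.
  apply/smooth_onP; split.
    by apply: smooth_sub s1 => x; rewrite /= !in_itv/= lt_min => /andP[-> /andP[->]].
  by apply: smooth_sub s2 => x; rewrite /= !in_itv/= lt_min => /andP[-> /andP[_ ->]].
by move=> n; have [k1 h1] := l1 n; have [k2 h2] := l2 n; exists (k1, k2).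
Qed.

Lemma ReMC (a : R[i]) (c : R) : complex.Re (a * c%:C) = complex.Re a * c.
Proof. by case: a => a b /=; rewrite mulr0 subr0. Qed.

Lemma ImMC (a : R[i]) (c : R) : complex.Im (a * c%:C) = complex.Im a * c.
Proof. by case: a => a b /=; rewrite mulr0 add0r. Qed.

Lemma near1P (P : R -> Prop) : (\forall x \near (1 : R), P x) <->
  exists2 e : R, 0 < e & forall x, 1 - e < x < 1 + e -> P x.
Proof.
split=> [/nbhs_ballP[e /= e0 H]|[e e0 H]].
  exists e => // x /andP[xl xr]; apply: H; rewrite /ball/= ltr_norml; apply/andP; split; lra.
near=> x; apply: H; apply/andP; split; near: x.
  by apply: lt_nbhsr; rewrite ltrBlDr ltrDl.
by apply: lt_nbhsl; rewrite ltrDl.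
Unshelve. all: by end_near. Qed.

Lemma pinftyP (P : R -> Prop) : (\forall x \near +oo, P x) <->
  exists M : R, forall x, M < x -> P x.
Proof.
by split=> [[M [_ H]]|[M H]]; [exists M|exists M; split=> //; exact: num_real].
Qed.

(** The coefficients in the three conditions are real, so each condition splits; the radii and
    thresholds of the two parts are merged by taking minima and maxima. *)
Lemma spaceE_ER f : spaceE alpha beta theta r f <-> ER (re f) /\ ER (im f).
Proof.
have sE : - alpha - beta - r - 1 = - (alpha + beta + r + 1) by ring.
have CE : sin (theta * pi) / sin ((alpha + theta) * pi) = C^-1 by rewrite invf_div.
rewrite /spaceE sE CE; split.
  move=> [/smooth_onP[s1 s2] /smooth_right0P[r1 r2]
    [u [v [[e e0 /smooth_onP[u1 u2]] [e' e0' /smooth_onP[v1 v2]] /near1P[d d0 h]]]]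
    [w /smooth_right0P[w1 w2] /pinftyP[M hM]]].
  pose m := Num.min d (Num.min e e').
  have m0 : 0 < m by rewrite !lt_min d0 e0.
  have md : m <= d by rewrite ge_min lexx.
  have me : m <= e by rewrite /m minCA ge_min lexx.
  have me' : m <= e' by rewrite /m minA ge_min lexx orbT.
  have sb (k : R) : m <= k -> `]1 - m, 1 + m[ `<=` (`]1 - k, 1 + k[ : set R).
    by move=> mk; apply: subset_itvW; rewrite ?lerD2l ?lerN2.
  have hd x : 1 - m < x < 1 + m -> 1 - d < x < 1 + d.
    move=> /andP[xl xr]; apply/andP; split.
      by apply: le_lt_trans xl; rewrite lerD2l lerN2.
    by apply: lt_le_trans xr _; rewrite lerD2l.
  split; split=> //.
  - exists (re u), (re v), m => //; split.
    + exact: (smooth_sub (sb _ me) u1).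
    + exact: (smooth_sub (sb _ me') v1).
    + move=> x /andP[xl x1]; have [|/(_ x1) -> _] := h x.
        by apply: hd; rewrite xl (lt_trans x1)// ltrDl.
      by rewrite ReD ReMC.
    + move=> x /andP[x1 xr]; have [|_ /(_ x1) ->] := h x.
        by apply: hd; rewrite xr (lt_trans _ x1)// ltrBlDr ltrDl.
      by rewrite ReD ReMC ReC.
  - by exists (re w), M => // x /hM ->; rewrite ReMC.
  - exists (im u), (im v), m => //; split.
    + exact: (smooth_sub (sb _ me) u2).
    + exact: (smooth_sub (sb _ me') v2).
    + move=> x /andP[xl x1]; have [|/(_ x1) -> _] := h x.
        by apply: hd; rewrite xl (lt_trans x1)// ltrDl.
      by rewrite ImD ImMC.
    + move=> x /andP[x1 xr]; have [|_ /(_ x1) ->] := h x.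
        by apply: hd; rewrite xr (lt_trans _ x1)// ltrBlDr ltrDl.
      by rewrite ImD ImMC mulrC ImMC mulrC.
  - by exists (im w), M => // x /hM ->; rewrite ImMC.
move=> [[s1 r1 [u1 [v1 [e e0 [su1 sv1 fl1 fr1]]]] [w1 [M rw1 fM1]]]].
move=> [s2 r2 [u2 [v2 [e' e0' [su2 sv2 fl2 fr2]]]] [w2 [M' rw2 fM2]]].
have ext (a b : R[i]) : complex.Re a = complex.Re b -> complex.Im a = complex.Im b -> a = b.
  by case: a b => [? ?] [? ?] /= -> ->.
pose m := Num.min e e'; have m0 : 0 < m by rewrite lt_min e0.
have me : m <= e by rewrite ge_min lexx.
have me' : m <= e' by rewrite ge_min lexx orbT.
have sb (k : R) : m <= k -> `]1 - m, 1 + m[ `<=` (`]1 - k, 1 + k[ : set R).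
  by move=> mk; apply: subset_itvW; rewrite ?lerD2l ?lerN2.
split; [exact/smooth_onP|exact/smooth_right0P| |].
  exists (fun x => u1 x +i* u2 x), (fun x => v1 x +i* v2 x); split.
  - exists m => //; apply/smooth_onP; split.
      exact: (smooth_sub (sb _ me) su1).
    exact: (smooth_sub (sb _ me') su2).
  - exists m => //; apply/smooth_onP; split.
      exact: (smooth_sub (sb _ me) sv1).
    exact: (smooth_sub (sb _ me') sv2).
  apply/near1P; exists m => // x /andP[xl xr].
  have l1 : 1 - e < x by apply: le_lt_trans xl; rewrite lerD2l lerN2.
  have l2 : 1 - e' < x by apply: le_lt_trans xl; rewrite lerD2l lerN2.
  have g1 : x < 1 + e by apply: (lt_le_trans xr); rewrite lerD2l.
  have g2 : x < 1 + e' by apply: (lt_le_trans xr); rewrite lerD2l.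
  split=> x1; apply: ext.
  - by rewrite ReD ReMC fl1// l1.
  - by rewrite ImD ImMC fl2// l2.
  - by rewrite ReD ReMC ReC fr1// x1.
  - by rewrite ImD ImMC mulrC ImMC fr2 ?x1// mulrC.
exists (fun x => w1 x +i* w2 x); first exact/smooth_right0P.
apply/pinftyP; exists (Num.max M M') => x; rewrite gt_max => /andP[xM xM'].
by apply: ext; [rewrite ReMC fM1|rewrite ImMC fM2].
Qed.

Lemma re_opD f : re (opD alpha beta f) = Dr (re f).
Proof.
apply/funext => x; rewrite /opD ReD !ReC /= !derive1nS derive1n0; exact: erefl.
Qed.

Lemma im_opD f : im (opD alpha beta f) = Dr (im f).
Proof.
apply/funext => x; rewrite /opD ImD mulrC ImMC [in X in _ + X]mulrC ImMC /= !derive1nS derive1n0.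
by rewrite /hypD mulrC [in X in _ + X]mulrC.
Qed.

End ComplexSpace.

(** * The operator on classes of functions *)

Section OperatorD.
Variables (R : realType) (alpha beta theta r : R).
Notation mu := (@lebesgue_measure R).
Notation C := (sin ((alpha + theta) * pi) / sin (theta * pi) : R).
Notation s := (alpha + beta + r + 1).
Hypotheses (halpha : -1 < alpha < 1) (halpha0 : alpha != 0) (hbeta : -1 < beta).
Hypotheses (C0 : 0 < C) (hs : 2 * s > alpha + beta + 1).
Notation w0 := (weight01 alpha beta).
Notation w1 := (weight1oo alpha beta).
Notation ER := (realE alpha C s).
Notation Dr := (hypD alpha beta).
Notation L2sq := (weightedL2 alpha beta).
Notation rin := (wprod alpha beta C).
Notation spaceE := (spaceE alpha beta theta r).
Notation opD := (opD alpha beta).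
Notation H := (L2 alpha beta).
Notation ip := (@L2_inner R alpha beta theta).
Notation T := (graphD alpha beta theta r).
Notation re f := (fun x => complex.Re (f x)).
Notation im f := (fun x => complex.Im (f x)).
Implicit Types (f g : R -> R[i]).

Lemma spaceE_square f : spaceE f ->
  square_integrable alpha beta f /\ square_integrable alpha beta (opD f).
Proof.
move=> /spaceE_ER[E1 E2].
have [L1' D1] := ER_L2sq halpha hbeta C0 hs E1.
have [L2' D2] := ER_L2sq halpha hbeta C0 hs E2.
split; first exact: (square_integrableP _ _ _).2 (conj L1' L2').
apply: (square_integrableP _ _ _).2; rewrite (re_opD alpha beta f) (im_opD alpha beta f).
exact: (conj D1 D2).
Qed.

Definition spaceE_fun f (hf : spaceE f) : L2fun alpha beta := mkL2fun (spaceE_square hf).1.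
Definition opD_fun f (hf : spaceE f) : L2fun alpha beta := mkL2fun (spaceE_square hf).2.

Lemma graphDP x y : T (x, y) <->
  exists f (hf : spaceE f), x = cls (spaceE_fun hf) /\ y = cls (opD_fun hf).
Proof.
split=> [[f [g [hf gE xE yE]]]|[f [hf [-> ->]]]].
  exists f, hf; split; first by rewrite [x]xE; congr (cls _); exact: val_inj.
  by rewrite [y]yE; congr (cls _); apply: val_inj.
by exists (spaceE_fun hf), (opD_fun hf).
Qed.

(** Derivatives of members of E are controlled only off 0 and 1, so linearity of [opD] is an
    identity between classes, not between functions. *)
Lemma cls_eq (f g : L2fun alpha beta) : (forall t : R, I0 t \/ I1 t -> f t = g t) ->
  cls f = cls g.
Proof. by move=> h; apply/L2_eqP; apply: ae_half; apply: aeW => t It; apply: h; [left|right]. Qed.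

Lemma spaceE_lin (a : R[i]) f g : spaceE f -> spaceE g -> spaceE (fun x => a * f x + g x).
Proof.
move=> /spaceE_ER[f1 f2] /spaceE_ER[g1 g2]; apply/spaceE_ER.
rewrite re_lin im_lin; split.
  have := ER_lin (complex.Re a) f1 (ER_lin (- complex.Im a) f2 g1); congr ER.
  by apply/funext => x; rewrite addrA.
have := ER_lin (complex.Re a) f2 (ER_lin (complex.Im a) f1 g2); congr ER.
by apply/funext => x; rewrite addrA.
Qed.

Lemma opD_lin (a : R[i]) f g (t : R) : spaceE f -> spaceE g -> I0 t \/ I1 t ->
  opD (fun x => a * f x + g x) t = a * opD f t + opD g t.
Proof.
move=> /spaceE_ER[f1 f2] /spaceE_ER[g1 g2] It.
have [sf1 _ _ _] := f1; have [sf2 _ _ _] := f2; have [sg1 _ _ _] := g1; have [sg2 _ _ _] := g2.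
have oI := @I01_open R.
have e (h : R -> R[i]) : opD h t = Dr (re h) t +i* Dr (im h) t.
  by rewrite -re_opD -im_opD; case: (opD h t).
have d (c d : R) (p q k : R -> R) : smooth (@I0 R `|` @I1 R) p -> smooth (@I0 R `|` @I1 R) q ->
    smooth (@I0 R `|` @I1 R) k ->
    Dr (fun x => (c * p x + d * q x) + k x) t = c * Dr p t + d * Dr q t + Dr k t.
  move=> sp sq sk; under [X in Dr X]eq_fun do rewrite -addrA.
  rewrite (Dr_lin _ _ c sp (smooth_lin oI sq sk) It) (Dr_lin _ _ d sq sk It).
  by rewrite addrA.
rewrite !e re_lin im_lin !d//; case: a => a b /=.
by apply/eqP; rewrite eq_complex /=; apply/andP; split; apply/eqP; ring.
Qed.

Lemma graphD_lin (a : R[i]) x y x' y' : T (x, y) -> T (x', y') -> T (a *: x + x', a *: y + y').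
Proof.
move=> /graphDP[f [hf [-> ->]]] /graphDP[g [hg [-> ->]]]; apply/graphDP.
exists _, (spaceE_lin a hf hg); rewrite -!clsZ -!clsD; split; apply: cls_eq => t It //.
exact/esym/opD_lin.
Qed.

Lemma inner_opD f g : spaceE f -> spaceE g ->
  inner alpha beta theta (opD f) g = inner alpha beta theta f (opD g).
Proof.
move=> hf hg; have [qf qdf] := spaceE_square hf; have [qg qdg] := spaceE_square hg.
have [f1 f2] := (spaceE_ER _ _ _ _ _).1 hf; have [g1 g2] := (spaceE_ER _ _ _ _ _).1 hg.
rewrite (innerE theta qdf qg) (innerE theta qf qdg).
rewrite (re_opD alpha beta f) (im_opD alpha beta f) (re_opD alpha beta g) (im_opD alpha beta g).
rewrite (green halpha hbeta C0 hs f1 g1) (green halpha hbeta C0 hs f2 g2).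
by rewrite (green halpha hbeta C0 hs f2 g1) (green halpha hbeta C0 hs f1 g2).
Qed.

Lemma graphD_symmetric : T `<=` adjoint ip T.
Proof.
move=> [x y] /graphDP[f [hf [-> ->]]] x' y' /graphDP[g [hg [-> ->]]].
rewrite [X in _ = X]ip_cls [X in X = _]ip_cls; exact: inner_opD.
Qed.

Lemma rin0l (g : R -> R) : rin (fun=> 0) g = 0.
Proof.
rewrite /wprod (rint_eq0 (D := @I0 R)); last by move=> t _; rewrite mul0r mulr0.
by rewrite (rint_eq0 (D := @I1 R)) ?mulr0 ?addr0// => t _; rewrite mul0r mulr0.
Qed.

Lemma rinNr (phi g : R -> R) : L2sq phi -> L2sq g -> rin phi (fun t => - g t) = - rin phi g.
Proof.
move=> Lp Lg; rewrite rinC (rinC _ _ _ phi g) -mulN1r -(rinZ C (-1) Lg Lp).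
by congr (wprod _ _ _ _ _); apply/funext => t; rewrite mulN1r.
Qed.

Lemma ER_orth (g : R -> R) : L2sq g -> (forall phi, ER phi -> rin phi g = 0) ->
  {ae mu, forall t, 0 <= t -> g t = 0}.
Proof.
move=> [mg0 mg1 hg0 hg1] hg.
(* Orthogonality to E is read as the weak equation D 0 = g, so that the restriction to test
   functions of one interval can be reused. *)
have wp : weak_pair alpha beta C s (fun=> 0) g.
  by move=> phi Ep; rewrite (hg phi Ep) rinC; exact: rin0l.
have z (D : set R) (f : R -> R) (w : R -> R) : rint D (fun t => w t * (f t * 0)) = 0.
  by apply: rint_eq0 => t _; rewrite !mulr0.
apply: ae_half.
  have := fundamental_lemma (@I0_itv R) (@I0c R) (@I0d R) (@I0_ex R)
    (L1loc_wy (@I0_open R) (@I0_itv R) (@smooth_w0 R alpha beta) (@weight01_ge0 R alpha beta) mg0 hg0).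
  move=> H; apply: (@filterS _ _ (ae_filter_ringOfSetsType mu) _ _ _ (H _)).
    move=> t ht It; move/eqP: (ht It); rewrite mulf_eq0 gt_eqF/=; last exact: w0_gt0.
    by move/eqP.
  move=> eta te; have e := WP_sweak0 wp te; rewrite z in e; rewrite [RHS]e.
  by apply: rint_eq => t _; rewrite mulrCA.
have := fundamental_lemma (@I1_itv R) (@I1c R) (@I1d R) (@I1_ex R)
  (L1loc_wy (@I1_open R) (@I1_itv R) (@smooth_w1 R alpha beta) (@weight1oo_ge0 R alpha beta) mg1 hg1).
move=> H; apply: (@filterS _ _ (ae_filter_ringOfSetsType mu) _ _ _ (H _)).
  move=> t ht It; move/eqP: (ht It); rewrite mulf_eq0 gt_eqF/=; last exact: w1_gt0.
  by move/eqP.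
move=> eta te; have e := WP_sweak1 C0 wp te; rewrite z in e; rewrite [RHS]e.
by apply: rint_eq => t _; rewrite mulrCA.
Qed.

Lemma inner_real (phi : R -> R) (k : R -> R[i]) : L2sq phi -> square_integrable alpha beta k ->
  inner alpha beta theta (fun t => (phi t)%:C) k = rin phi (re k) -i* rin phi (im k).
Proof.
move=> Lp qk.
have qp : square_integrable alpha beta (fun t => (phi t)%:C).
  apply: (square_integrableP _ _ _).2; split; first exact: Lp.
  by have := L2sqZ 0 Lp; congr (weightedL2 _ _ _); apply/funext => t; rewrite mul0r.
by rewrite (innerE theta qp qk) /= !rin0l addr0 sub0r.
Qed.

Lemma opD_real (phi : R -> R) : opD (fun t => (phi t)%:C) = (fun t => (Dr phi t)%:C).
Proof.
apply/funext => t; apply/eqP; rewrite eq_complex; apply/andP; split; apply/eqP.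
  exact: (congr1 (fun u : R -> R => u t) (re_opD alpha beta (fun x => (phi x)%:C))).
transitivity (Dr (fun=> 0) t); last exact: Dr_cst.
exact: (congr1 (fun u : R -> R => u t) (im_opD alpha beta (fun x => (phi x)%:C))).
Qed.

(** A real member of E separates the real and the imaginary part of [k]. *)
Lemma real_test (k : L2fun alpha beta) (phi : R -> R) : ER phi -> exists x y,
  [/\ T (x, y), ip x (cls k) = rin phi (re k) -i* rin phi (im k) &
      ip y (cls k) = rin (Dr phi) (re k) -i* rin (Dr phi) (im k)].
Proof.
move=> Ep; have hp : spaceE (fun t => (phi t)%:C).
  by apply: (spaceE_ER _ _ _ _ _).2; split; [exact: Ep|exact: ER0 Ep].
have [Lp LDp] := ER_L2sq halpha hbeta C0 hs Ep.
exists (cls (spaceE_fun hp)), (cls (opD_fun hp)); split.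
- by apply: (graphDP _ _).2; exists _, hp.
- rewrite ip_cls; exact: (inner_real Lp (L2fun_square k)).
rewrite ip_cls.
have -> : L2val (opD_fun hp) = (fun t => (Dr phi t)%:C).
  exact: (opD_real phi).
exact: (inner_real LDp (L2fun_square k)).
Qed.

Lemma domain_orth (k : H) : (forall x y, T (x, y) -> ip x k = 0) -> k = 0.
Proof.
rewrite -[k]clsK; move: (repr k) => {}k h.
have [Lk1 Lk2] := (square_integrableP _ _ _).1 (L2fun_square k).
have hr phi : ER phi -> rin phi (re k) = 0 /\ rin phi (im k) = 0.
  move=> Ep; have [x [y [/h -> + _]]] := real_test k Ep.
  by move=> [e1 e2]; split; [exact: esym e1|apply: oppr_inj; rewrite oppr0 -e2].
by apply: cls0; apply: ER_orth => // phi /hr[].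
Qed.

(** Testing with real functions gives, weakly, D (re k) = - e im k and D (im k) = e re k, with e = 1
    or -1; the sign decides which of re k and im k takes the place of y1 in [deficiency]. *)
Lemma range_orth (sg : bool) (k : H) :
  (forall x y, T (x, y) -> ip (y + (if sg then 'i else - 'i) *: x) k = 0) -> k = 0.
Proof.
rewrite -[k]clsK; move: (repr k) => {}k h.
have [Lk1 Lk2] := (square_integrableP _ _ _).1 (L2fun_square k).
pose e : R := if sg then 1 else -1.
have hr phi : ER phi -> rin (Dr phi) (re k) = - (e * rin phi (im k)) /\
    rin (Dr phi) (im k) = e * rin phi (re k).
  move=> Ep; have [x [y [Txy e1 e2]]] := real_test k Ep.
  have := h x y Txy; rewrite addrC (L2_inner_linear theta) e1 e2 /e.
  move: (rin _ _) (rin _ _) (rin _ _) (rin _ _) => a b c d.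
  by case: (sg) => -[/= h1 h2]; split; lra.
have ae : {ae mu, forall t, I0 t \/ I1 t -> complex.Re (k t) = 0 /\ complex.Im (k t) = 0}.
  have hL phi : ER phi -> L2sq phi by move=> Ep; have [] := ER_L2sq halpha hbeta C0 hs Ep.
  case: sg @e hr {h} => /= hr; last first.
    apply: (deficiency halpha halpha0 hbeta C0 hs Lk1 Lk2) => phi Ep.
      by have [-> _] := hr phi Ep; rewrite mulN1r opprK.
    have [_ ->] := hr phi Ep; rewrite rinNr//; last exact: hL.
    by rewrite mulN1r.
  have : {ae mu, forall t, I0 t \/ I1 t -> complex.Im (k t) = 0 /\ complex.Re (k t) = 0}.
    apply: (deficiency halpha halpha0 hbeta C0 hs Lk2 Lk1) => phi Ep.
      by have [_ ->] := hr phi Ep; rewrite mul1r.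
    have [-> _] := hr phi Ep; rewrite rinNr//; last exact: hL.
    by rewrite mul1r.
  by apply: (@filterS _ _ (ae_filter_ringOfSetsType mu)) => t ht It; have [] := ht It.
apply: cls0; apply: ae_half; apply: (@filterS _ _ (ae_filter_ringOfSetsType mu) _ _ _ ae) => t ht It.
- exact: (ht (or_introl It)).1.
- exact: (ht (or_intror It)).1.
- exact: (ht (or_introl It)).2.
- exact: (ht (or_intror It)).2.
Qed.

Lemma graphD0 : T (0, 0).
Proof.
have E0 : ER (fun=> 0).
  apply: test0_ER; split; first exact: (smooth_cst (c := 0) openT).
  by exists (c0 R 0), (c0 R 0); split=> //; exact: I0c.
have [x [y [Txy _ _]]] := real_test 0 E0.
by have := graphD_lin (-1) Txy Txy; rewrite !scaleN1r !addNr.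
Qed.

Lemma graphD_essentially_self_adjoint : essentially_self_adjoint ip T.
Proof.
apply: essentially_self_adjoint_criterion.
- exact: L2_inner_linear.
- exact: L2_inner_herm.
- exact: (L2_inner_ge0 C0).
- exact: (L2_inner_complete C0).
- exact: graphD0.
- exact: graphD_lin.
- exact: graphD_symmetric.
- exact: domain_orth.
- exact: (@range_orth true).
- by move=> k hk; apply: (@range_orth false) => x y Txy; rewrite scaleNr; exact: hk.
Qed.

End OperatorD.

(* The first conjunct is the inclusion E in H and the fact that D maps E to H,
   which are part of D being an operator in H with domain E. *)
Theorem theorem3 (R : realType) (alpha beta theta r : R)
  (htheta : 0 < theta < 1) (halpha : -1 < alpha < 1) (halpha0 : alpha != 0)
  (hbeta : -1 < beta)
  (hsin : 0 < sin ((alpha + theta) * pi) / sin (theta * pi))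
  (hr : is_minimum (exponent_set alpha beta theta) r) :
  (forall f : R -> R[i], spaceE alpha beta theta r f ->
     square_integrable alpha beta f /\
     square_integrable alpha beta (opD alpha beta f)) /\
  essentially_self_adjoint (L2_inner theta) (graphD alpha beta theta r).
Proof.
(* Equivalent to 2 r + alpha + beta + 1 > 0, the condition defining [exponent_set]. *)
have hs : 2 * (alpha + beta + r + 1) > alpha + beta + 1.
  by have [[_ h] _] := hr; lra.
split; first by move=> f; exact: (spaceE_square halpha hbeta hsin hs).
exact: (graphD_essentially_self_adjoint halpha halpha0 hbeta hsin hs).
Qed.
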